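(* Let $\lambda,\mu>0$, $k\ge1$ an integer and $\nu\in(0,1)$. Let $\mathcal{L}^\nu$ be the queue length process of a $\nu$-fractional $M/E_k/1$ queue, $M^\nu(t)=\mathbb{E}[\mathcal{L}^\nu(t)\mid\mathcal{L}^\nu(0)=0]$ and $\mathcal{P}_0^\nu(t)=\mathbb{P}(\mathcal{L}^\nu(t)=0\mid\mathcal{L}^\nu(0)=0)$. Then $M^\nu$ is a solution of the fractional Cauchy problem $$\begin{cases} D_t^\nu M^\nu=k(\lambda-\mu)+k\mu\, \mathcal{P}^\nu_0(t) \\ M^\nu(0)=0. \end{cases}$$
   Context: Classical queue: let $\mathcal{S}^*=\{(n,s): n\ge 1,\ 1\le s\le k\}$ ($n,s$ integers) and $\mathcal{S}=\mathcal{S}^*\cup\{(0,0)\}$. The state-phase process $Q(t)=(N(t),S(t))$ of the classical $M/E_k/1$ queue ($N$ = number of customers in the system, $S$ = phase of the customer currently being served, $S=0$ if $N=0$) is the continuous-time Markov chain on $\mathcal{S}$ with transition rates: $(0,0)\to(1,k)$ at rate $\lambda$; $(n,s)\to(n+1,s)$ at rate $\lambda$ for $(n,s)\in\mathcal{S}^*$; $(n,s)\to(n,s-1)$ at rate $k\mu$ for $s\ge2$; $(n,1)\to(n-1,k)$ at rate $k\mu$ for $n\ge2$; $(1,1)\to(0,0)$ at rate $k\mu$. Fractional queue: let $\{\sigma_\nu(t)\}_{t\ge0}$ be a $\nu$-stable subordinator independent of $Q$, with $\mathbb{E}[e^{-v\sigma_\nu(t)}]=e^{-tv^\nu}$ for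 $v>0$, and let $L_\nu(t)=\inf\{s\ge0:\sigma_\nu(s)>t\}$. The $\nu$-fractional $M/E_k/1$ queue has state-phase process $Q^\nu(t)=(N^\nu(t),S^\nu(t)):=Q(L_\nu(t))$. Its queue length process (in phases) is $\mathcal{L}^\nu(t)=k(N^\nu(t)-1)+S^\nu(t)$ if $N^\nu(t)\neq0$ and $\mathcal{L}^\nu(t)=0$ if $N^\nu(t)=0$. Caputo derivative: $D_t^\nu x=\frac{1}{\Gamma(1-\nu)}\int_0^t \frac{x'(\tau)}{(t-\tau)^\nu}\,d\tau$. *)

(* Defs.v *)
From HB Require Import structures.
From mathcomp Require Import all_boot all_order all_algebra.
From mathcomp Require Import all_classical all_reals all_analysis.

Set Implicit Arguments.
Unset Strict Implicit.
Unset Printing Implicit Defensive.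

Import Order.TTheory GRing.Theory Num.Theory.
Import numFieldNormedType.Exports.

Local Open Scope classical_set_scope.
Local Open Scope ring_scope.

(* All processes below are indexed by R but only their values at times t >= 0
   are constrained or used. *)

Section Processes.
Context {R : realType} {d : measure_display} {T : measurableType d}.
Variable P : probability T R.

Definition sigma_generated {d'} {E : measurableType d'} (I : set R)
    (X : R -> {RV P >-> E}) : set (set T) :=
  <<s [set A | exists2 t, I t & preimage_set_system setT (X t) measurable A] >>.

Definition history {d'} {E : measurableType d'} (X : R -> {RV P >-> E})
    (s : R) : set (set T) := sigma_generated [set u | 0 <= u <= s] X.

Definition independent (F G : set (set T)) : Prop :=
  forall A B, F A -> G B -> P (A `&` B) = (P A * P B)%E.

Definition independent_processes {d1 d2} {E1 : measurableType d1}
    {E2 : measurableType d2} (X : R -> {RV P >-> E1})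
    (Y : R -> {RV P >-> E2}) : Prop :=
  independent (sigma_generated [set t | 0 <= t] X)
              (sigma_generated [set t | 0 <= t] Y).

(* Elementary conditioning on an event A; meaningful when 0 < P A. *)
Definition cond_probability (B A : set T) : R :=
  fine (P (B `&` A)) / fine (P A).

Definition cond_expectation (X : T -> R) (A : set T) : R :=
  (\int[P]_(w in A) X w) / fine (P A).

End Processes.

(* A (standard, stochastic) transition function on S whose transition rates
   are q x y for x != y; the values q x x on the diagonal are irrelevant. *)
Record transition_function {R : realType} {S : choiceType} (q : S -> S -> R)
    (p : R -> S -> S -> R) : Prop := {
  tf_ge0 : forall t x y, 0 <= t -> 0 <= p t x y;
  tf_sum1 : forall t x, 0 <= t ->
    (\esum_(y in [set: S]) (p t x y)%:E = 1)%E;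
  tf_init : forall x y, p 0 x y = (x == y)%:R;
  tf_chapman_kolmogorov : forall s t x y, 0 <= s -> 0 <= t ->
    (\esum_(z in [set: S]) (p s x z * p t z y)%:E = (p (s + t) x y)%:E)%E;
  tf_rate : forall x y, x != y -> p h x y / h @[h --> 0^'+] --> q x y;
  tf_exit_rate : forall x,
    ((1 - p h x x) / h)%:E @[h --> 0^'+]
      --> (\esum_(y in [set y | y != x]) (q x y)%:E)%E
}.

(* X is a time-homogeneous continuous-time Markov chain on S with transition
   rates q, with right-continuous paths (for the discrete topology of S) and
   with arbitrary initial distribution. *)
Definition markov_chain {R : realType} {d d' : measure_display}
    {T : measurableType d} (P : probability T R) {S : measurableType d'}
    (q : S -> S -> R) (X : R -> {RV P >-> S}) : Prop :=
  (forall w t, 0 <= t -> \forall s \near t^'+, X s w = X t w) /\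
  exists2 p, transition_function q p &
    forall (s h : R) A x y, 0 <= s -> 0 <= h -> history X s A ->
      (P (A `&` [set w | X s w = x] `&` [set w | X (s + h)%R w = y])
       = P (A `&` [set w | X s w = x]) * (p h x y)%:E)%E.

Record stable_subordinator {R : realType} {d : measure_display}
    {T : measurableType d} (P : probability T R) (nu : R)
    (sigma : R -> {RV P >-> R}) : Prop := {
  sub_init : forall w, sigma 0 w = 0;
  sub_nondecreasing : forall w s t, 0 <= s -> s <= t -> sigma s w <= sigma t w;
  sub_right_continuous : forall w t, 0 <= t ->
    sigma s w @[s --> t^'+] --> sigma t w;
  sub_independent_increments : forall s t, 0 <= s -> s <= t ->
    independent P (history sigma s)
      (preimage_set_system setT (fun w => sigma t w - sigma s w) measurable);
  sub_stationary_increments : forall s t B, 0 <= s -> s <= t -> measurable B ->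
    P [set w | B (sigma t w - sigma s w)] = P [set w | B (sigma (t - s) w)];
  sub_laplace : forall v t, 0 < v -> 0 <= t ->
    ('E_P[(fun w => expR (- (v * sigma t w)))] = (expR (- (t * v `^ nu)))%:E)%E
}.

(* The set below is nonempty almost surely; when it is empty, inf returns 0. *)
Definition inverse_process {R : realType} {T : Type} (sigma : R -> T -> R)
    (t : R) (w : T) : R :=
  inf [set s | 0 <= s /\ t < sigma s w].

Definition is_state (k : nat) : pred (nat * nat) :=
  [pred x | (x == (0, 0)%N) || (1 <= x.1)%N && (1 <= x.2 <= k)%N].

Definition state (k : nat) := {x : nat * nat | is_state k x}.

Definition empty_state (k : nat) : state k := exist (is_state k) (0, 0)%N isT.

HB.instance Definition _ k := Countable.on (state k).
HB.instance Definition _ k := isPointed.Build (state k) (empty_state k).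
HB.instance Definition _ k := @isMeasurable.Build default_measure_display
  (state k) discrete_measurable discrete_measurable0
  discrete_measurableC discrete_measurableU.

Definition after_arrival (k : nat) (x : nat * nat) : nat * nat :=
  if x.1 == 0%N then (1, k)%N else (x.1.+1, x.2).

Definition after_phase_completion (k : nat) (x : nat * nat) : nat * nat :=
  if (2 <= x.2)%N then (x.1, x.2.-1)
  else if (2 <= x.1)%N then (x.1.-1, k)
  else (0, 0)%N.

Definition erlang_rate {R : realType} (lambda mu : R) {k : nat}
    (x y : state k) : R :=
  lambda *+ (val y == after_arrival k (val x)) +
  (k%:R * mu) *+ ((x != empty_state k) &&
                  (val y == after_phase_completion k (val x))).

Definition length_in_phases (k : nat) (x : state k) : nat :=
  if (val x).1 == 0%N then 0%N else (k * ((val x).1 - 1) + (val x).2)%N.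

Definition fractional_state_phase {R : realType} {T : Type} (k : nat)
    (Q : R -> T -> state k) (sigma : R -> T -> R) (t : R) (w : T) : state k :=
  Q (inverse_process sigma t w) w.

Definition fractional_queue_length {R : realType} {T : Type} (k : nat)
    (Q : R -> T -> state k) (sigma : R -> T -> R) (t : R) (w : T) : nat :=
  length_in_phases (fractional_state_phase Q sigma t w).

Definition Gamma {R : realType} (a : R) : R :=
  \int[lebesgue_measure]_(u in `]0, +oo[) (u `^ (a - 1) * expR (- u)).

Definition caputo_integrand {R : realType} (nu : R) (x : R -> R) (t u : R) : R :=
  derive1 x u / (t - u) `^ nu.

Definition caputo {R : realType} (nu : R) (x : R -> R) (t : R) : R :=
  (Gamma (1 - nu))^-1 *
  \int[lebesgue_measure]_(u in `]0, t[) caputo_integrand nu x t u.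

(* x solves D^nu x = f on ]0, +oo[ with x 0 = x0. The first three conditions
   say that the Caputo derivative is well defined and make x locally absolutely
   continuous on [0, +oo[; x need not be differentiable at 0. *)
Definition caputo_cauchy_solution {R : realType} (nu : R) (f : R -> R) (x0 : R)
    (x : R -> R) : Prop :=
  [/\ {within `[0, +oo[, continuous x},
      forall t, 0 < t -> derivable x t 1,
      forall t, 0 < t -> lebesgue_measure.-integrable `]0, t[
                           (EFin \o caputo_integrand nu x t),
      forall t, 0 < t -> caputo nu x t = f t
    & x 0 = x0].

(* Main.v *)
(* The length of the classical queue is a Markov chain on the natural numbers
   which jumps up by k at rate lambda and, when positive, down by 1 at rate
   k mu. Truncating the Chapman-Kolmogorov sums shows that P(length < j) is
   differentiable in time; integrating the sum of the tails and letting the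
   truncation level tend to infinity yields the mean length
     m(s) = k (lambda - mu) s + k mu F(s),   F' = f := P(length = 0).
   The inverse subordinator at time t is independent of the chain and, by
   self-similarity, has the law of t^nu S^(-nu) with S := sigma(1); hence
   M(t) = E[m(t^nu S^(-nu))] and P0(t) = E[f(t^nu S^(-nu))].
   It remains to see that the Caputo derivative of E[F(t^nu S^(-nu))] is
   E[f(t^nu S^(-nu))] whenever F' = f and F(0) = 0. Differentiating under the
   expectation, exchanging the integrals and substituting u = t S / (r + S)
   reduces this to the size-bias identity
     E[S h(S)] = nu / Gamma(1 - nu) int_0^oo r^(-nu) E[h(r + S)] dr
   for h(s) = s^(-1) f(t^nu s^(-nu)), whose two sides have the same Laplace
   transforms because E[exp(-v S)] = exp(-v^nu). *)
From HB Require Import structures.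
Require Import Defs.
From mathcomp Require Import all_boot all_order all_algebra.
From mathcomp Require Import all_classical all_reals all_analysis.
From mathcomp Require Import measurable_realfun ring lra zify.
Set Implicit Arguments.
Unset Strict Implicit.
Unset Printing Implicit Defensive.
Import Order.TTheory GRing.Theory Num.Theory.
Import numFieldNormedType.Exports.
Local Open Scope classical_set_scope.
Local Open Scope ring_scope.

(** * Uniqueness for Laplace transforms *)

(** A transition function only prescribes derivatives at time 0. The forward equations at later
    times are recovered from the boundedness of the exit rates, which makes truncation errors
    proportional to the time step. The measures behind the size-bias identity, S dP and r^(-nu) dr
    dP, have infinite mass, so uniqueness of Laplace transforms is applied after multiplying by
    exp(-s). Integrability of the Caputo integrand is not known beforehand: the derivative of
    E[F(t^nu S^(-nu))] may blow up at 0 and the kernel is singular at t. The exchanges of integrals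
    therefore concern nonnegative functions with extended real values, and finiteness is read off
    the resulting identity. Since the derivative k (lambda - mu) + k mu f of the mean length may be
    negative, the mean is split into its linear part and the time spent at length 0. Conditioning is
    on the fractional queue being empty at time 0. The inverse subordinator starts from 0 only
    almost surely, so this event agrees up to a null set with the chain being empty at its own time
    0. *)

Section Bernstein.
Context {R : realType}.
Implicit Types (f g : nat -> R) (x c : R) (n : nat).

(* The de Casteljau recursion: [(bernstein n f).[x]] is the expectation of [f]
   under the binomial law of parameters [n] and [x]. *)
Fixpoint bernstein n f : {poly R} :=
  if n is m.+1 then (1 - 'X) * bernstein m f + 'X * bernstein m (f \o succn)
  else (f 0%N)%:P.

Lemma bernsteinS n f x : (bernstein n.+1 f).[x] =
  (1 - x) * (bernstein n f).[x] + x * (bernstein n (f \o succn)).[x].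
Proof. by rewrite /= !hornerE. Qed.

Lemma le_bernstein n f g x : 0 <= x <= 1 ->
  (forall i, (i <= n)%N -> f i <= g i) ->
  (bernstein n f).[x] <= (bernstein n g).[x].
Proof.
move=> /andP[x0 x1]; elim: n f g => [|n IH] f g fg.
  by rewrite /= !hornerC; exact: fg.
rewrite !bernsteinS lerD// ler_wpM2l ?subr_ge0//; apply: IH => i ni.
  by apply: fg; exact: leqW.
exact: fg.
Qed.

(** Second moment of a binomial variable about [c]: variance plus squared distance from the mean to
    [c]. It is stated for every [c] because the second branch of the recursion moves [c] to [c - 1];
    [b = 0] gives the constants. *)
Lemma bernstein_variance n x a b c :
  (bernstein n (fun i => a + b * (i%:R - c) ^+ 2)).[x] =
  a + b * (n%:R * x * (1 - x) + (n%:R * x - c) ^+ 2).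
Proof.
elim: n c => [|n IH] c; first by rewrite /= hornerC; ring.
rewrite bernsteinS IH.
have -> : (fun i : nat => a + b * (i%:R - c) ^+ 2) \o succn =
    (fun i => a + b * (i%:R - (c - 1)) ^+ 2).
  by apply/funext => i /=; rewrite -natr1; ring.
by rewrite IH -natr1; ring.
Qed.

Arguments bernstein : simpl never.

Let sample (phi : R -> R) n i : R := phi (i%:R / n%:R).

Lemma bernstein_bounded (phi : R -> R) (M : R) n x : 0 <= x <= 1 ->
  (forall y, 0 <= y <= 1 -> `|phi y| <= M) ->
  `|(bernstein n.+1 (sample phi n.+1)).[x]| <= M.
Proof.
move=> x01 phiM.
have cst_ a : (bernstein n.+1 (fun=> a)).[x] = a.
  transitivity ((bernstein n.+1 (fun i => a + 0 * (i%:R - 0) ^+ 2)).[x]).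
    by congr (_.[_]); congr bernstein; apply/funext => i; rewrite mul0r addr0.
  by rewrite bernstein_variance mul0r addr0.
have b i : (i <= n.+1)%N -> `|sample phi n.+1 i| <= M.
  move=> ni; apply: phiM; rewrite divr_ge0//= ler_pdivrMr ?ltr0n//.
  by rewrite mul1r ler_nat.
rewrite ler_norml -[X in X <= _]cst_ -[X in _ && (_ <= X)]cst_.
by rewrite !le_bernstein// => i /b; rewrite ler_norml => /andP[].
Qed.

(** Chebyshev's inequality: grid points within [d] of [x] deviate by at most [e / 2], the others by
    at most 2 M <= K (i / (n + 1) - x)^2, whose binomial mean is K x (1 - x) / (n + 1). Convergence
    is pointwise, as the test function used later may jump at 0 and 1. *)
Lemma bernstein_cvg (phi : R -> R) (M : R) x : 0 < x < 1 ->
  (forall y, 0 <= y <= 1 -> `|phi y| <= M) -> {for x, continuous phi} ->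
  (bernstein n.+1 (sample phi n.+1)).[x] @[n --> \oo] --> phi x.
Proof.
move=> /andP[x0 x1] phiM /cvgrPdist_le cphi.
have M0 : 0 <= M by rewrite (le_trans _ (phiM 0 _)) ?normr_ge0// lexx ler01.
have x01 : 0 <= x <= 1 by rewrite !ltW.
apply/cvgrPdist_le => e e0.
have /cphi : 0 < e / 2 by rewrite divr_gt0.
rewrite -filter_from_norm_nbhs => -[d /= d0 cd].
pose K := 2 * M / d ^+ 2.
have K0 : 0 <= K by rewrite divr_ge0 ?sqr_ge0 ?mulr_ge0.
near=> n.
have n0 : (0 : R) < n.+1%:R by rewrite ltr0n.
have key i : (i <= n.+1)%N -> `|phi x - sample phi n.+1 i| <=
    e / 2 + K / n.+1%:R ^+ 2 * (i%:R - n.+1%:R * x) ^+ 2.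
  move=> ni; have i01 : 0 <= (i%:R / n.+1%:R : R) <= 1.
    by rewrite divr_ge0//= ler_pdivrMr// mul1r ler_nat.
  have E : K / n.+1%:R ^+ 2 * (i%:R - n.+1%:R * x) ^+ 2 =
      K * (i%:R / n.+1%:R - x) ^+ 2.
    by field; rewrite gt_eqF// ltr_wpDl.
  rewrite E; have [xd|xd] := ltP `|x - i%:R / n.+1%:R| d.
    apply: (@le_trans _ _ (e / 2)); first exact: cd.
    by rewrite lerDl mulr_ge0// sqr_ge0.
  apply: (@le_trans _ _ (2 * M)).
    rewrite (le_trans (ler_normB _ _))// mulr_natl mulr2n lerD// phiM//.
  rewrite (@le_trans _ _ (K * d ^+ 2))//.
    by rewrite /K mulfVK// gt_eqF// exprn_gt0.
  rewrite (@le_trans _ _ (K * (i%:R / n.+1%:R - x) ^+ 2))//; last first.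
    by rewrite lerDr divr_ge0 ?ltW.
  apply: ler_wpM2l => //; rewrite -[leRHS]real_normK ?num_real//.
  by rewrite lerXn2r ?nnegrE ?(ltW d0)// distrC.
have bnd : K / n.+1%:R ^+ 2 * (n.+1%:R * x * (1 - x)) <= e / 2.
  have -> : K / n.+1%:R ^+ 2 * (n.+1%:R * x * (1 - x)) =
      (K * x * (1 - x)) / n.+1%:R by field; rewrite gt_eqF// ltr_wpDl.
  rewrite ler_pdivrMr// -ler_pdivrMl ?divr_gt0//.
  apply/ltW/(@lt_le_trans _ _ n%:R); last by rewrite ler_nat.
  near: n; exact: nbhs_infty_gtr.
rewrite ler_norml; apply/andP; split.
  rewrite -[X in X <= _]opprK lerNl opprB lerBlDl.
  (* This majorant has the quadratic form whose Bernstein sum [bernstein_variance] evaluates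
     exactly. *)
  pose g i : R := (phi x + e / 2) + K / n.+1%:R ^+ 2 * (i%:R - n.+1%:R * x) ^+ 2.
  apply: (@le_trans _ _ (bernstein n.+1 g).[x]).
    apply: le_bernstein => // i /key; rewrite ler_norml /g => /andP[+ _].
    by set A := _ / _ * _; move=> h; lra.
  by rewrite bernstein_variance subrr expr0n /= addr0; move: bnd;
    set A := _ * (_ * _ * _); lra.
rewrite lerBlDl.
pose g i : R := (phi x - e / 2) + (- (K / n.+1%:R ^+ 2)) * (i%:R - n.+1%:R * x) ^+ 2.
rewrite -lerBlDr; apply: (@le_trans _ _ (bernstein n.+1 g).[x]).
  by rewrite bernstein_variance subrr expr0n /= addr0 mulNr; move: bnd;
    set A := _ * (_ * _ * _); lra.
apply: le_bernstein => // i /key; rewrite ler_norml /g => /andP[_].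
by rewrite mulNr; set A := _ / _ * _; move=> h; lra.
Unshelve. all: by end_near. Qed.

End Bernstein.

(** * Moments of exp(-X) under a weighted measure *)

Section LaplaceMoments.
Context {R : realType} {d : measure_display} {T : measurableType d}.
Variables (mu : {measure set T -> \bar R}) (D : set T) (w X : T -> R).
Hypotheses (mD : measurable D) (iw : mu.-integrable D (EFin \o w)).
Hypotheses (w0 : forall t, D t -> 0 <= w t).
Hypotheses (mX : measurable_fun D X) (X0 : forall t, D t -> 0 < X t).

Let mw : measurable_fun D w.
Proof. by move/measurable_int : iw => /measurable_EFinP. Qed.

Let expX01 t : D t -> 0 < expR (- X t) < 1.
Proof. by move=> Dt; rewrite expR_gt0 expR_lt1 oppr_lt0 X0. Qed.

Let mexpX : measurable_fun D (fun t => expR (- X t)).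
Proof. apply: measurableT_comp => //; exact: measurableT_comp. Qed.

(** The Laplace transform at [n] of the image of w dmu under [X]; equivalently the [n]-th moment of
    its image under exp(-X), a measure on ]0, 1[. *)
Definition laplace_moment (n : nat) : \bar R :=
  (\int[mu]_(t in D) (w t * expR (- X t) ^+ n)%:E)%E.

Lemma integrable_weighted (g : T -> R) (M : R) : measurable_fun D g ->
  (forall t, D t -> `|g t| <= M) ->
  mu.-integrable D (fun t => (w t * g t)%:E).
Proof.
move=> mg gM; apply: (@le_integrable _ _ _ _ _ mD _ (fun t => (M * w t)%:E)).
- by apply/measurable_EFinP; exact: measurable_funM.
- move=> t Dt; rewrite lee_fin normrM mulrC (ger0_norm (w0 Dt)).
  by rewrite (le_trans _ (ler_norm _))// ler_wpM2r ?w0// gM.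
- by under eq_fun do rewrite EFinM; exact: integrableZl.
Qed.

Lemma integral_horner_laplace (p : {poly R}) :
  (\int[mu]_(t in D) (w t * p.[expR (- X t)])%:E =
   \sum_(i < size p) (p`_i)%:E * laplace_moment i)%E.
Proof.
transitivity (\int[mu]_(t in D)
    \sum_(i < size p) ((p`_i)%:E * (w t * expR (- X t) ^+ i)%:E))%E.
  apply: eq_integral => t _; rewrite horner_coef mulr_sumr sumEFin.
  by congr (_%:E); apply: eq_bigr => i _; rewrite mulrCA.
have iX (i : nat) : mu.-integrable D (fun t => (w t * expR (- X t) ^+ i)%:E).
  apply: (@integrable_weighted _ 1); first exact: measurable_funX.
  move=> t /expX01 /andP[e0 e1].
  by rewrite normrX ger0_norm ?(ltW e0)// exprn_ile1 ?ltW.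
rewrite integral_sum//; last by move=> i; exact: integrableZl.
by apply: eq_bigr => i _; rewrite integralZl.
Qed.

(** Since exp(-X) stays in ]0, 1[, the polynomials converge at every point of [D], and the bound on
    [phi] makes [M * w] a dominating function. *)
Lemma bounded_laplace_cvg (phi : R -> R) (M : R) :
  measurable_fun setT phi ->
  (forall y, `|phi y| <= M) ->
  (forall x, 0 < x < 1 -> {for x, continuous phi}) ->
  (\int[mu]_(t in D) (w t * (bernstein n.+1
      (fun i => phi (i%:R / n.+1%:R))).[expR (- X t)])%:E @[n --> \oo]
   --> \int[mu]_(t in D) (w t * phi (expR (- X t)))%:E)%E.
Proof.
move=> mphi phiM cphi.
apply: (@dominated_cvg _ _ _ mu D mD _ _ (fun t => (M * w t)%:E)).
- move=> n; apply/measurable_EFinP/measurable_funM => //.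
  apply: (measurableT_comp (continuous_measurable_fun _)) => //.
  exact: continuous_horner.
- move=> t Dt; apply: cvg_EFin; first exact: nearW.
  apply: cvgMr; apply: (bernstein_cvg (M := M)) => //; first exact: expX01.
  exact/cphi/expX01.
- by [].
- by under eq_fun do rewrite EFinM; exact: integrableZl.
- move=> n t Dt; rewrite lee_fin normrM mulrC (ger0_norm (w0 Dt)).
  rewrite ler_wpM2r ?w0//; apply: (bernstein_bounded (phi := phi)) => //.
  by have /andP[/ltW -> /ltW ->] := expX01 Dt.
Qed.

(** Monotone convergence along the truncations of [h], so that the limit is also correct when it is
    infinite. *)
Lemma ge0_laplace_cvg (h : R -> R) : measurable_fun setT h ->
  (forall s, 0 < s -> 0 <= h s) ->
  (\int[mu]_(t in D) (w t * Num.min (h (X t)) n%:R)%:E @[n --> \oo]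
   --> \int[mu]_(t in D) (w t * h (X t))%:E)%E.
Proof.
move=> mh h0.
have mhX : measurable_fun D (fun t => h (X t)) by exact: measurableT_comp.
apply: cvg_toP.
  apply: ereal_nondecreasing_is_cvgn => m n mn; apply: ge0_le_integral => //.
  - by move=> t Dt; rewrite lee_fin mulr_ge0 ?w0// le_min h0 ?X0/=.
  - apply/measurable_EFinP/measurable_funM => //; exact: measurable_minr.
  - apply/measurable_EFinP/measurable_funM => //; exact: measurable_minr.
  - move=> t Dt; rewrite lee_fin ler_wpM2l ?w0//.
    by rewrite le_min ge_min lexx/= ge_min ler_nat mn orbT.
rewrite -monotone_convergence//.
- apply: eq_integral => t; rewrite inE => Dt; apply/cvg_lim => //.
  apply: cvg_near_cst; near=> n; congr (w t * _)%:E; apply/min_idPl.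
  by near: n; exact: nbhs_infty_ger.
- move=> n; apply/measurable_EFinP/measurable_funM => //.
  exact: measurable_minr.
- by move=> n t Dt; rewrite lee_fin mulr_ge0 ?w0// le_min h0 ?X0/=.
- move=> t Dt m n mn; rewrite lee_fin ler_wpM2l ?w0//.
  by rewrite le_min ge_min lexx/= ge_min ler_nat mn orbT.
Unshelve. all: by end_near. Qed.

End LaplaceMoments.

(* The substitution [x = exp(-X)] reduces this to the moment problem on
   [0, 1], solved by Bernstein polynomials. *)
Lemma laplace_unique {R : realType} {d1 d2 : measure_display}
    {T1 : measurableType d1} {T2 : measurableType d2}
    (mu1 : {measure set T1 -> \bar R}) (mu2 : {measure set T2 -> \bar R})
    (D1 : set T1) (D2 : set T2) (w1 X1 : T1 -> R) (w2 X2 : T2 -> R) (h : R -> R) :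
  measurable D1 -> mu1.-integrable D1 (EFin \o w1) ->
  (forall t, D1 t -> 0 <= w1 t) ->
  measurable_fun D1 X1 -> (forall t, D1 t -> 0 < X1 t) ->
  measurable D2 -> mu2.-integrable D2 (EFin \o w2) ->
  (forall t, D2 t -> 0 <= w2 t) ->
  measurable_fun D2 X2 -> (forall t, D2 t -> 0 < X2 t) ->
  (forall n, laplace_moment mu1 D1 w1 X1 n = laplace_moment mu2 D2 w2 X2 n) ->
  measurable_fun setT h -> (forall s, 0 < s -> 0 <= h s) ->
  (forall s, 0 < s -> {for s, continuous h}) ->
  (\int[mu1]_(t in D1) (w1 t * h (X1 t))%:E =
   \int[mu2]_(t in D2) (w2 t * h (X2 t))%:E)%E.
Proof.
move=> mD1 iw1 w10 mX1 X10 mD2 iw2 w20 mX2 X20 mom mh h0 ch.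
have bdd (N : nat) :
    (\int[mu1]_(t in D1) (w1 t * Num.min (h (X1 t)) N%:R)%:E =
     \int[mu2]_(t in D2) (w2 t * Num.min (h (X2 t)) N%:R)%:E)%E.
  (* [h] is known to be nonnegative at positive arguments only. The [max] with 0 keeps [phi] bounded
     also where [- ln x <= 0], and leaves its value at exp(-s) unchanged for s > 0. *)
  pose phi x := Num.min (Num.max (h (- ln x)) 0) N%:R : R.
  have mphi : measurable_fun setT phi.
    apply: measurable_minr => //; apply: measurable_maxr => //.
    by apply: measurableT_comp => //; apply: measurableT_comp => //.
  have phiN y : `|phi y| <= N%:R.
    by rewrite ger0_norm /phi ?ge_min ?lexx ?orbT// le_min le_max lexx orbT/=.
  have cphi x : 0 < x < 1 -> {for x, continuous phi}.
    move=> /andP[x0 x1].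
    have c1 : {for x, continuous (fun x => h (- ln x))}.
      apply: (@continuous_comp _ _ _ (fun x => - ln x) h).
        by apply: continuousN; exact: continuous_ln.
      by apply: ch; rewrite oppr_gt0 ln_lt0// x0.
    apply: continuous_min; last exact: cvg_cst.
    by apply: continuous_max => //; exact: cvg_cst.
  have phiE s : 0 < s -> phi (expR (- s)) = Num.min (h s) N%:R.
    by move=> s0; rewrite /phi expRK opprK; congr Num.min; apply/max_idPl/h0.
  have e1 : (\int[mu1]_(t in D1) (w1 t * Num.min (h (X1 t)) N%:R)%:E =
      \int[mu1]_(t in D1) (w1 t * phi (expR (- X1 t)))%:E)%E.
    by apply: eq_integral => t; rewrite inE => Dt; rewrite phiE// X10.
  have e2 : (\int[mu2]_(t in D2) (w2 t * Num.min (h (X2 t)) N%:R)%:E =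
      \int[mu2]_(t in D2) (w2 t * phi (expR (- X2 t)))%:E)%E.
    by apply: eq_integral => t; rewrite inE => Dt; rewrite phiE// X20.
  rewrite e1 e2.
  have l1 := bounded_laplace_cvg mD1 iw1 w10 mX1 X10 mphi phiN cphi.
  have l2 := bounded_laplace_cvg mD2 iw2 w20 mX2 X20 mphi phiN cphi.
  rewrite -(cvg_lim _ l1)// -(cvg_lim _ l2)//; congr (limn _).
  apply/funext => n; rewrite !integral_horner_laplace//.
  by apply: eq_bigr => i _; rewrite mom.
have l1 := ge0_laplace_cvg mD1 iw1 w10 mX1 X10 mh h0.
have l2 := ge0_laplace_cvg mD2 iw2 w20 mX2 X20 mh h0.
rewrite -(cvg_lim _ l1)// -(cvg_lim _ l2)//; congr (limn _).
exact/funext.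
Qed.

(** * Gamma integrals *)

Section SubstitutionOnPositiveHalfLine.
Context {R : realType}.
Notation mu := (@lebesgue_measure R).

Let K n : set R := `[n.+1%:R^-1, n.+1%:R]%classic.

Let K_gt0 n x : K n x -> 0 < x.
Proof.
by rewrite /K /= in_itv/= => /andP[h _]; rewrite (lt_le_trans _ h)// invr_gt0.
Qed.

Let K_mono : nondecreasing_seq K.
Proof.
move=> m n mn; rewrite subsetEset => x; rewrite /K /= !in_itv/= => /andP[h1 h2].
rewrite (le_trans _ h1) ?lef_pV2 ?posrE ?ltr0n// ?ler_nat//=.
by rewrite (le_trans h2)// ler_nat.
Qed.

Let K_cover : \bigcup_n K n = `]0, +oo[%classic.
Proof.
apply/seteqP; split => [x [n _ /K_gt0 x0]|x]; first by rewrite /= in_itv/= x0.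
rewrite /= in_itv/= andbT => x0.
near \oo => n; exists n => //; rewrite /K /= in_itv/=; apply/andP; split.
  rewrite invf_ple ?posrE ?ltr0n// (@le_trans _ _ n%:R)//.
    by near: n; exact: nbhs_infty_ger.
  by rewrite ler_nat.
rewrite (@le_trans _ _ n%:R)//; last by rewrite ler_nat.
by near: n; exact: nbhs_infty_ger.
Unshelve. all: by end_near. Qed.

(** The segments [K n] exhaust ]0, +oo[ and their images [L n] exhaust [J]; the change of variables
    on a segment passes to the limit by monotone convergence. The image [J] may be bounded or not,
    and the common value may be infinite. *)
Lemma ge0_integration_by_substitution_decreasing_oy (F G : R -> R) (J : set R) :
  (forall x y, 0 < x -> x < y -> F y < F x) ->
  (forall x, 0 < x -> derivable F x 1) ->
  (forall x, 0 < x -> {for x, continuous (derive1 F)}) ->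
  J = F @` `]0, +oo[%classic ->
  (forall y, J y -> {for y, continuous G}) ->
  (forall y, J y -> 0 <= G y) ->
  (\int[mu]_(y in J) (G y)%:E =
   \int[mu]_(x in `]0%R, +oo[) (G (F x) * - derive1 F x)%:E)%E.
Proof.
move=> decF dF cF' JE cG G0.
have cF x : 0 < x -> {for x, continuous F}.
  by move=> /dF /derivable1_diffP/differentiable_continuous.
have F'_le0 x : 0 < x -> derive1 F x <= 0.
  move=> x0; apply: (@decr_derive1_le0_itvy _ F false 0) => [z|z y|].
  - by rewrite inE/= in_itv/= andbT; exact: dF.
  - by rewrite !in_itv/= !andbT => z0 y0; exact: decF.
  - by rewrite in_itv/= x0.
pose L n : set R := `[F n.+1%:R, F n.+1%:R^-1]%classic.
have leV n : n.+1%:R^-1 <= n.+1%:R :> R.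
  by rewrite (@le_trans _ _ 1)// ?invf_le1 ?ler1n// ltr0n.
have V0 n : 0 < n.+1%:R^-1 :> R by rewrite invr_gt0.
have leF x y : 0 < x -> x <= y -> F y <= F x.
  by move=> x0; rewrite le_eqVlt => /predU1P[->//|xy]; exact/ltW/decF.
have LJ n y : L n y -> J y.
  rewrite /L /= => Ly.
  have [//||x xK <-] := @IVT R F n.+1%:R^-1 n.+1%:R y (leV n).
  - by apply: continuous_in_subspaceT => z; rewrite inE => /K_gt0; exact: cF.
  - rewrite min_r ?max_l ?leF//.
  - by rewrite JE; exists x => //=; rewrite in_itv/= (K_gt0 xK).
have L_mono : nondecreasing_seq L.
  move=> m n mn; rewrite subsetEset => x; rewrite /L /= !in_itv/= => /andP[h1 h2].
  rewrite (le_trans _ h1) ?leF ?ltr0n ?ler_nat//=.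
  by rewrite (le_trans h2)// leF// lef_pV2 ?posrE ?ltr0n// ?ler_nat.
have L_cover : \bigcup_n L n = J.
  apply/seteqP; split => [y [n _ /LJ//]|]; rewrite JE => _ [x + <-].
  rewrite -K_cover => -[n _]; rewrite /K /= in_itv/= => /andP[h1 h2].
  by exists n => //=; rewrite /L /= in_itv/= !leF// (lt_le_trans _ h1).
have step n : (\int[mu]_(y in L n) (G y)%:E =
    \int[mu]_(x in K n) (G (F x) * - derive1 F x)%:E)%E.
  rewrite /L integration_by_substitution_decreasing//.
  - by move=> x y _ yK; apply: decF; exact: (K_gt0 yK).
  - move=> x; rewrite in_itv/= => /andP[h _]; apply: cF'.
    exact: lt_trans h.
  - by apply/cvg_ex; exists (derive1 F n.+1%:R^-1); apply/cvg_at_right_filter/cF'.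
  - by apply/cvg_ex; exists (derive1 F n.+1%:R); apply/cvg_at_left_filter/cF'.
  - split.
    + by move=> x; rewrite in_itv/= => /andP[h _]; exact/dF/(lt_trans _ h).
    + exact/cvg_at_right_filter/cF.
    + exact/cvg_at_left_filter/cF.
  - by apply: continuous_in_subspaceT => z; rewrite inE => /LJ; exact: cG.
have mL n : measurable_fun (L n) (fun y => (G y)%:E).
  apply/measurable_EFinP; apply: subspace_continuous_measurable_fun.
    exact: measurable_itv.
  by apply: continuous_in_subspaceT => z; rewrite inE => /LJ; exact: cG.
have mK n : measurable_fun (K n) (fun x => (G (F x) * - derive1 F x)%:E).
  apply/measurable_EFinP; apply: subspace_continuous_measurable_fun.
    exact: measurable_itv.
  apply: continuous_in_subspaceT => z; rewrite inE => /K_gt0 z0.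
  apply: cvgM; last by apply: cvgN; exact: cF'.
  apply: (@continuous_comp _ _ _ F G); first exact: cF.
  by apply: cG; rewrite JE; exists z => //=; rewrite in_itv/= z0.
rewrite -L_cover -K_cover.
have l1 : (\int[mu]_(y in L n) (G y)%:E @[n --> \oo] -->
    \int[mu]_(y in \bigcup_n L n) (G y)%:E)%E.
  apply: ge0_nondecreasing_set_cvg_integral => // n.
    exact: measurable_itv.
  by move=> y /LJ /G0; rewrite lee_fin.
have l2 : (\int[mu]_(x in K n) (G (F x) * - derive1 F x)%:E @[n --> \oo] -->
    \int[mu]_(x in \bigcup_n K n) (G (F x) * - derive1 F x)%:E)%E.
  apply: ge0_nondecreasing_set_cvg_integral => // n.
    exact: measurable_itv.
  move=> x /K_gt0 x0; rewrite lee_fin mulr_ge0 ?oppr_ge0 ?F'_le0// G0// JE.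
  by exists x => //=; rewrite in_itv/= x0.
rewrite -(cvg_lim _ l1)// -(cvg_lim _ l2)//; congr (limn _).
exact/funext.
Unshelve. all: by end_near. Qed.

End SubstitutionOnPositiveHalfLine.

Lemma continuous_powR {R : realType} (a x : R) : 0 < x ->
  {for x, continuous (fun y : R => y `^ a)}.
Proof.
move=> x0; apply: (@differentiable_continuous _ R^o R^o).
by apply/derivable1_diffP; apply: derivable_powR; rewrite in_itv/= x0.
Qed.

Lemma eq_continuous_gt0 {R : realType} (f g : R -> R) (x : R) : 0 < x ->
  (forall z, 0 < z -> f z = g z) -> {for x, continuous g} -> {for x, continuous f}.
Proof.
move=> x0 fg; rewrite /prop_for /continuous_at (fg _ x0); apply: cvg_trans.
by apply: near_eq_cvg; near=> z; rewrite fg//; near: z; exact: lt_nbhsr.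
Unshelve. all: by end_near. Qed.

Lemma powR_lt1 {R : realType} (z b : R) : 0 < z < 1 -> 0 < b -> z `^ b < 1.
Proof.
move=> /andP[z0 z1] b0.
have : z `^ b < 1 `^ b by rewrite gt0_ltr_powR// nnegrE ltW.
by rewrite powR1.
Qed.

Section GammaIntegral.
Context {R : realType}.
Notation mu := (@lebesgue_measure R).

Let measurable_gamma (a v : R) (D : set R) :
  measurable_fun D (fun r : R => r `^ a * expR (- (v * r))).
Proof.
apply: measurable_funTS; apply: measurable_funM; first exact: measurable_powR.
by apply: measurableT_comp => //; apply: measurableT_comp => //; exact: measurable_funM.
Qed.

Let measurable_gamma1 (a : R) (D : set R) :
  measurable_fun D (fun r : R => r `^ a * expR (- r)).
Proof.
have -> : (fun r : R => r `^ a * expR (- r)) = (fun r => r `^ a * expR (- (1 * r))).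
  by apply/funext => r; rewrite mul1r.
exact: measurable_gamma.
Qed.

Let continuous_gamma (a v r : R) : 0 < r ->
  {for r, continuous (fun r : R => r `^ a * expR (- (v * r)))}.
Proof.
move=> r0; apply: cvgM; first exact: continuous_powR.
apply: (@continuous_comp _ _ _ (fun r => - (v * r)) expR).
  by apply: cvgN; apply: cvgM; [exact: cvg_cst|exact: cvg_id].
exact: continuous_expR.
Qed.

(** Gamma(a) written in the variable x = 1 / r. *)
Let kernel (a : R) : \bar R :=
  (\int[mu]_(x in `]0%R, +oo[) (x `^ (- a - 1) * expR (- x `^ (-1)))%:E)%E.

(** The substitution r = 1 / (v x), decreasing where r = x / v would be increasing, extracts v^(-a)
    and leaves a factor free of [v], which v = 1 then identifies as Gamma(a). *)
Let gamma_integral_inv (a v : R) : 0 < v ->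
  (\int[mu]_(r in `]0%R, +oo[) (r `^ (a - 1) * expR (- (v * r)))%:E =
   (v `^ (- a))%:E * kernel a)%E.
Proof.
move=> v0; pose F (x : R) : R := v^-1 * x `^ (-1).
have dF (x : R) : 0 < x -> is_derive x (1:R) F (- (v^-1 * x `^ (-2))).
  move=> x0; have x0' : x \in `]0, +oo[ by rewrite in_itv/= x0.
  have dp : is_derive x (1:R) (fun x : R => x `^ (-1)) (- x `^ (-2)).
    apply: DeriveDef; first exact: derivable_powR.
    by rewrite -derive1E powR_derive1// mulN1r; congr (- (_ `^ _)); ring.
  by rewrite -mulrN; apply: is_deriveZ.
have F'E (x : R) : 0 < x -> derive1 F x = - (v^-1 * x `^ (-2)).
  by move=> /dF h; rewrite derive1E derive_val.
have JE : (`]0%R, +oo[%classic : set R) = F @` `]0, +oo[%classic.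
  apply/seteqP; split => [y|_ [x + <-]]; rewrite /= !in_itv/= !andbT => y0.
    exists (v^-1 * y `^ (-1)).
      by rewrite /= in_itv/= mulr_gt0 ?invr_gt0 ?powR_gt0.
    rewrite /F (powR_inv1 (ltW y0)) powR_inv1; last first.
      by rewrite mulr_ge0 ?invr_ge0 ?ltW.
    by rewrite invfM !invrK mulrA mulVf ?mul1r// gt_eqF.
  by rewrite /F mulr_gt0 ?invr_gt0 ?powR_gt0.
rewrite (@ge0_integration_by_substitution_decreasing_oy _ F
  (fun r => r `^ (a - 1) * expR (- (v * r))) _ _ _ _ JE); last 5 first.
- move=> x y x0 xy; rewrite ltr_pM2l ?invr_gt0//.
  have y0 := lt_trans x0 xy.
  by rewrite !powR_inv1 ?ltW// ltf_pV2 ?posrE.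
- by move=> x /dF [].
- move=> x x0; apply: (eq_continuous_gt0 x0 F'E).
  apply: cvgN; apply: cvgM; first exact: cvg_cst.
  exact: continuous_powR.
- by move=> y; rewrite /= in_itv/= andbT; exact: continuous_gamma.
- by move=> y _; rewrite mulr_ge0 ?powR_ge0 ?expR_ge0.
rewrite -ge0_integralZl_EFin ?powR_ge0//.
- apply: eq_integral => x; rewrite inE/= in_itv/= andbT => x0.
  rewrite F'E// opprK -EFinM; congr (_%:E).
  rewrite /F powRM ?invr_ge0 ?powR_ge0 ?(ltW v0)// -powRrM.
  rewrite mulVKf ?gt_eqF//.
  rewrite -(powR_inv1 (ltW v0)) -powRrM.
  have -> : v `^ (- a) = v `^ (-1 * (a - 1)) * v `^ (-1).
    by rewrite -powRD ?(gt_eqF v0)//= ?implybT//; congr (_ `^ _); ring.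
  have -> : x `^ (- a - 1) = x `^ (-1 * (a - 1)) * x `^ (-2).
    by rewrite -powRD ?(gt_eqF x0)//= ?implybT//; congr (_ `^ _); ring.
  by ring.
- by move=> x _; rewrite lee_fin mulr_ge0 ?powR_ge0 ?expR_ge0.
- apply: measurable_funTS; apply/measurable_EFinP.
  apply: measurable_funM; first exact: measurable_powR.
  by apply: measurableT_comp => //; apply: measurableT_comp.
Unshelve. all: by end_near. Qed.

(** Since 1 - exp(-r) <= r and a - 1 <= 0, the integrand is at most (1 - exp(-r))^(a-1) exp(-r), the
    derivative of (1 - exp(-r))^a / a, whose integral is 1 / a. The sign in [F] makes it decreasing,
    as the substitution requires; its image is ]-1, 0[. *)
Lemma gamma_integral_lty (a : R) : 0 < a <= 1 ->
  (\int[mu]_(r in `]0%R, +oo[) (r `^ (a - 1) * expR (- r))%:E < +oo)%E.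
Proof.
move=> /andP[a0 a1]; pose F (r : R) : R := - (1 - expR (- r)) `^ a.
pose F' (r : R) : R := - (a * (1 - expR (- r)) `^ (a - 1) * expR (- r)).
have e_gt0 (r : R) : 0 < r -> 0 < 1 - expR (- r).
  by move=> r0; rewrite subr_gt0 expR_lt1 oppr_lt0.
have dF (r : R) : 0 < r -> is_derive r (1:R) F (F' r).
  move=> r0; apply: is_deriveN.
  apply: (@is_derive1_comp _ (fun y : R => y `^ a) (fun r : R => 1 - expR (- r))).
    exact: is_derive1_powR (e_gt0 _ r0).
  have : is_derive r (1:R) (cst (1:R) - (@expR R \o -%R)) (0 - expR (- r) * -1).
    by apply: is_deriveB; apply: is_derive1_comp.
  by rewrite sub0r mulrN1 opprK.
have F'E (r : R) : 0 < r -> derive1 F r = F' r.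
  by move=> /dF h; rewrite derive1E derive_val.
have JE : (`]-1, 0[%classic : set R) = F @` `]0, +oo[%classic.
  apply/seteqP; split => [y|_ [x + <-]]; rewrite /= !in_itv/=.
    move=> /andP[y1 y0]; have y'0 : 0 < - y by rewrite oppr_gt0.
    have z1 : (- y) `^ a^-1 < 1.
      by rewrite powR_lt1 ?invr_gt0// y'0/= ltrNl.
    have z0 : 0 < (- y) `^ a^-1 by rewrite powR_gt0.
    exists (- ln (1 - (- y) `^ a^-1)).
      by rewrite /= in_itv/= andbT oppr_gt0 ln_lt0//; lra.
    rewrite /F opprK lnK ?posrE ?subr_gt0// opprB addrC subrK.
    by rewrite -powRrM mulVf ?gt_eqF// powRr1 ?opprK// ltW.
  rewrite andbT => x0; rewrite oppr_lt0 powR_gt0 ?e_gt0// andbT ltrN2.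
  by rewrite powR_lt1// e_gt0//= ltrBlDr ltrDl expR_gt0.
have F'1 : (\int[mu]_(x in `]0%R, +oo[) (- F' x)%:E = 1)%E.
  transitivity (\int[mu]_(x in `]0%R, +oo[) (cst 1 (F x) * - derive1 F x)%:E)%E.
    apply: eq_integral => x; rewrite inE/= in_itv/= andbT => x0.
    by rewrite mul1r F'E.
  rewrite -(@ge0_integration_by_substitution_decreasing_oy _ F (cst 1) _ _ _ _ JE)//.
  - rewrite (_ : (\int[mu]_(y in _) _)%E = (\int[mu]_(y in `](-1)%R, 0%R[) cst 1 y)%E)//.
    rewrite integral_cst//= lebesgue_measure_itv/= lte_fin ltrN10 mul1e -EFinB.
    by rewrite sub0r opprK.
  - move=> x y x0 xy; rewrite ltrN2 gt0_ltr_powR ?nnegrE ?(ltW (e_gt0 _ _))//.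
      exact: lt_trans xy.
    by rewrite ltrD2l ltrN2 ltr_expR ltrN2.
  - by move=> x /dF [].
  - move=> x x0; apply: (eq_continuous_gt0 x0 F'E).
    have ce : {for x, continuous (fun z : R => expR (- z))}.
      by apply: (@continuous_comp _ _ _ -%R expR); [exact: opp_continuous|exact: continuous_expR].
    apply: cvgN; apply: cvgM => //; apply: cvgM; first exact: cvg_cst.
    apply: (@continuous_comp _ _ _ (fun z => 1 - expR (- z)) (fun y : R => y `^ (a - 1))).
      by apply: cvgB => //; exact: cvg_cst.
    by apply: continuous_powR; exact: e_gt0.
  - by move=> y _; exact: cvg_cst.
have F'm (D : set R) : measurable_fun D (fun x => (- F' x)%:E).
  apply: measurable_funTS; apply/measurable_EFinP; apply: measurable_funN.
  apply: measurable_funN; apply: measurable_funM; last first.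
    by apply: measurableT_comp.
  apply: measurable_funM => //.
  apply: (@measurableT_comp _ _ _ _ _ _ (fun y : R => y `^ (a - 1))).
    exact: measurable_powR.
  by apply: measurable_funB => //; apply: measurableT_comp.
apply: (@le_lt_trans _ _ (a^-1%:E * 1)%E); last by rewrite mule1 ltry.
have F'0 (x : R) : `]0, +oo[%classic x -> (0 <= (- F' x)%:E)%E.
  rewrite /= in_itv/= andbT => x0; rewrite lee_fin opprK.
  by rewrite !mulr_ge0 ?powR_ge0 ?expR_ge0 ?ltW.
rewrite -F'1 -ge0_integralZl_EFin ?invr_ge0 ?(ltW a0)//.
apply: ge0_le_integral => //.
- by move=> x _; rewrite lee_fin mulr_ge0 ?powR_ge0 ?expR_ge0.
- by apply/measurable_EFinP; exact: measurable_gamma1.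
- by apply: emeasurable_funM => //; exact: F'm.
- move=> x; rewrite /= in_itv/= andbT => x0; rewrite lee_fin opprK.
  rewrite !mulrA mulVf ?gt_eqF// mul1r ler_wpM2r ?expR_ge0//.
  have -> : a - 1 = - (1 - a) by rewrite opprB.
  rewrite !powRN lef_pV2 ?posrE ?powR_gt0 ?e_gt0//.
  apply: ge0_ler_powR; rewrite ?nnegrE ?subr_ge0//; try exact: ltW.
    by rewrite expR_le1 oppr_le0 ltW.
  by have := expR_ge1Dx (- x); lra.
- exact: F'm.
Unshelve. all: by end_near. Qed.

Lemma gamma_integral_scale (a v : R) : 0 < a <= 1 -> 0 < v ->
  (\int[mu]_(r in `]0%R, +oo[) (r `^ (a - 1) * expR (- (v * r)))%:E =
   (v `^ (- a) * Gamma a)%:E)%E.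
Proof.
move=> a0 v0; rewrite gamma_integral_inv// EFinM; congr (_ * _)%E.
have := gamma_integral_inv a ltr01; rewrite powR1 mul1e => <-.
under eq_integral do rewrite mul1r.
rewrite /Gamma /Rintegral fineK// ge0_fin_numE ?gamma_integral_lty//.
by apply: integral_ge0 => x _; rewrite lee_fin mulr_ge0 ?powR_ge0 ?expR_ge0.
Qed.

(** For a <= 1 the integrand decreases, so on ]1, 2[ it is at least its value [c] at 2. Finiteness
    matters too: [Gamma] would read an infinite integral as 0. *)
Lemma Gamma_gt0 (a : R) : 0 < a <= 1 -> 0 < Gamma a :> R.
Proof.
move=> /andP[a0 a1]; pose c : R := 2 `^ (a - 1) * expR (- 2).
have c0 : 0 < c by rewrite mulr_gt0 ?powR_gt0 ?expR_gt0.
rewrite -lte_fin /Gamma /Rintegral fineK; last first.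
  rewrite ge0_fin_numE ?gamma_integral_lty ?a0//.
  by apply: integral_ge0 => x _; rewrite lee_fin mulr_ge0 ?powR_ge0 ?expR_ge0.
apply: (@lt_le_trans _ _ (\int[mu]_(r in `]1%R, 2%R[) c%:E)%E).
  rewrite integral_cst//= lebesgue_measure_itv/= lte_fin ltr1n/= -EFinB -EFinM.
  by rewrite lte_fin mulr_gt0// subr_gt0 ltr1n.
apply: (@le_trans _ _ (\int[mu]_(r in `]1%R, 2%R[) (r `^ (a - 1) * expR (- r))%:E)%E).
  apply: ge0_le_integral => //.
  - by move=> x _; rewrite lee_fin ltW.
  - by apply/measurable_EFinP; exact: measurable_gamma1.
  - move=> x; rewrite /= in_itv/= => /andP[x1 x2]; rewrite lee_fin /c.
    have x0 : 0 < x by rewrite (lt_trans _ x1).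
    apply: ler_pM; rewrite ?powR_ge0 ?expR_ge0//; last by rewrite ler_expR lerN2 ltW.
    have -> : a - 1 = - (1 - a) by rewrite opprB.
    rewrite !powRN lef_pV2 ?posrE ?powR_gt0//.
    by apply: ge0_ler_powR; rewrite ?nnegrE ?subr_ge0//; exact: ltW.
apply: ge0_subset_integral => //.
- by apply/measurable_EFinP; exact: measurable_gamma1.
- by move=> x _; rewrite lee_fin mulr_ge0 ?powR_ge0 ?expR_ge0.
- by move=> x; rewrite /= !in_itv/= andbT => /andP[x1 _]; rewrite (lt_trans _ x1).
Qed.

End GammaIntegral.

(** * Stable random variables *)

Lemma is_derive_expRN_powR {R : realType} (a x : R) : 0 < x ->
  is_derive x (1:R) (@expR R \o (- (fun y : R => y `^ a)))
    (expR (- x `^ a) * - (a * x `^ (a - 1))).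
Proof.
move=> x0; have h := is_deriveN (is_derive1_powR a x0).
exact: (@is_derive1_comp _ _ _ _ _ _ (is_derive_expR _) h).
Qed.

Section PositiveVariable.
Context {R : realType} {d : measure_display} {T : measurableType d}.
Variable P : probability T R.

Definition laplace_transform (S : T -> R) (v : R) : \bar R :=
  (\int[P]_w (expR (- (v * S w)))%:E)%E.

Lemma measurable_laplace (S : T -> R) (v : R) (D : set T) :
  measurable_fun setT S -> measurable_fun D (fun w => expR (- (v * S w))).
Proof.
move=> mS; apply: measurable_funTS; apply: measurableT_comp => //.
by apply: measurableT_comp => //; exact: measurable_funM.
Qed.

Lemma measurable_gt0 (S : T -> R) : measurable_fun setT S ->
  measurable [set w | 0 < S w].
Proof.
move=> mS; rewrite -[X in measurable X]setTI.
rewrite (_ : [set w | 0 < S w] = S @^-1` `]0, +oo[%classic).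
  exact: mS.
by apply/seteqP; split => w /=; rewrite in_itv/= andbT.
Qed.

Lemma set_le0E (S : T -> R) : [set w | S w <= 0] = ~` [set w | 0 < S w].
Proof.
apply/seteqP; split => w /=; first by rewrite leNgt => /negP.
by move=> h; rewrite leNgt; exact/negP.
Qed.

Lemma integral_gt0E (S : T -> R) (f : T -> \bar R) :
  measurable_fun setT S -> P [set w | (S w <= 0)%R] = 0%E ->
  measurable_fun setT f -> (forall w, 0 <= f w)%E ->
  (\int[P]_(w in [set w | (0 < S w)%R]) f w = \int[P]_w f w)%E.
Proof.
move=> mS S0 mf f0.
have mD := measurable_gt0 mS.
have E : [set w | 0 < S w] = setT `\` [set w | S w <= 0].
  by rewrite set_le0E setTD setCK.
have mN : measurable [set w | S w <= 0] by rewrite set_le0E; exact: measurableC.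
by rewrite E; apply/esym; apply: ge0_negligible_integral.
Qed.

(** On {S <= 0} the variable vanishes, so P(S <= 0) <= E[exp(-v S)] for every v > 0. If this
    probability were p > 0, the choice c v^nu = 1 - ln p would give p <= p / e. *)
Lemma laplace_null (S : T -> R) (c nu : R) : 0 < c -> 0 < nu ->
  measurable_fun setT S -> (forall w, 0 <= S w) ->
  (forall v, 0 < v -> laplace_transform S v = (expR (- (c * v `^ nu)))%:E) ->
  P [set w | S w <= 0] = 0%E.
Proof.
move=> c0 nu0 mS S0 lS; set N := [set w | S w <= 0].
have mN : measurable N.
  by rewrite /N set_le0E; apply: measurableC; exact: measurable_gt0.
have le v : 0 < v -> (P N <= (expR (- (c * v `^ nu)))%:E)%E.
  move=> v0; rewrite -lS// -[leLHS]mul1e -(integral_cst P mN).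
  apply: (@le_trans _ _ (\int[P]_(w in N) (expR (- (v * S w)))%:E)%E).
    apply: ge0_le_integral => //.
    - by apply/measurable_EFinP; exact: measurable_laplace.
    - move=> w; rewrite /N/= => Sw; have -> : S w = 0.
        by apply/eqP; rewrite eq_le Sw S0.
      by rewrite mulr0 oppr0 expR0.
  apply: ge0_subset_integral => //.
  - by apply/measurable_EFinP; exact: measurable_laplace.
apply/eqP; rewrite eq_le measure_ge0 andbT leNgt; apply/negP => PN0.
have [p PNp] : exists p, P N = p%:E.
  by exists (fine (P N)); rewrite fineK// fin_num_measure.
have p0 : 0 < p by rewrite -lte_fin -PNp.
have p1 : p <= 1 by rewrite -lee_fin -PNp probability_le1.
have lnp : ln p <= 0 by rewrite ln_le0.
pose y := (1 - ln p) / c.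
have y0 : 0 < y by rewrite divr_gt0//; lra.
have := le (y `^ nu^-1); rewrite powR_gt0// => /(_ isT).
rewrite -powRrM mulVf ?gt_eqF// powRr1 ?(ltW y0)//.
rewrite /y mulrCA mulfV ?gt_eqF// mulr1 opprB PNp lee_fin.
rewrite -{1}(lnK (x := p)) ?posrE// ler_expR; lra.
Qed.

Lemma laplace_moment_transform (X : T -> R) (n : nat) :
  measurable_fun setT X -> P [set w | X w <= 0] = 0%E ->
  laplace_moment P [set w | 0 < X w] (cst 1) X n = laplace_transform X n%:R.
Proof.
move=> mX X0; rewrite /laplace_moment.
have E w : 1 * expR (- X w) ^+ n = expR (- (n%:R * X w)).
  by rewrite mul1r -expRM_natl mulrN.
under eq_integral do rewrite E.
apply: (integral_gt0E mX X0); last by move=> w; rewrite lee_fin expR_ge0.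
by apply/measurable_EFinP; exact: measurable_laplace.
Qed.

(** The ramps [h m] are continuous and increase to the indicator of ]t, +oo[, so the equality of
    their integrals, given by uniqueness of Laplace transforms, passes to the limit. The inequality
    is strict because this indicator is approached from below. *)
Lemma laplace_eq_law (X1 X2 : T -> R) (t : R) : 0 <= t ->
  measurable_fun setT X1 -> P [set w | X1 w <= 0] = 0%E ->
  measurable_fun setT X2 -> P [set w | X2 w <= 0] = 0%E ->
  (forall v, 0 < v -> laplace_transform X1 v = laplace_transform X2 v) ->
  P [set w | t < X1 w] = P [set w | t < X2 w].
Proof.
move=> t0 mX1 X10 mX2 X20 lE.
pose h m s : R := Num.min 1 (m%:R * Num.max (s - t) 0).
have mh m : measurable_fun setT (h m).
  apply: measurable_minr => //; apply: measurable_funM => //.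
  by apply: measurable_maxr => //; exact: measurable_funB.
have h_ge0 m s : 0 <= h m s.
  by rewrite le_min ler01 mulr_ge0// le_max lexx orbT.
have ch m s : {for s, continuous (h m)}.
  apply: continuous_min; first exact: cvg_cst.
  apply: cvgM; first exact: cvg_cst.
  have : {for s, continuous (fun s => Num.max (s - t) 0)} => //.
  apply: continuous_max; last exact: cvg_cst.
  by apply: cvgB; [exact: cvg_id|exact: cvg_cst].
have h_mono s m n : (m <= n)%N -> h m s <= h n s.
  move=> mn; rewrite le_min ge_min lexx/= ge_min; apply/orP; right.
  by rewrite ler_wpM2r ?ler_nat// le_max lexx orbT.
have key (X : T -> R) : measurable_fun setT X ->
    (\int[P]_w (h m (X w))%:E @[m --> \oo] --> P [set w | (t < X w)%R])%E.
  move=> mX; have mA : measurable [set w | t < X w].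
    have -> : [set w | t < X w] = [set w | 0 < X w - t].
      by apply/seteqP; split => w /=; rewrite subr_gt0.
    by apply: measurable_gt0; exact: measurable_funB.
  rewrite -[P _]mul1e -(integral_cst P mA) integral_mkcond/=.
  have mhX m : measurable_fun setT (fun w => (h m (X w))%:E).
    by apply/measurable_EFinP; exact: measurableT_comp.
  rewrite (_ : (\int[P]_x _)%E =
      (\int[P]_w limn (fun m => (h m (X w))%:E))%E); last first.
    apply: eq_integral => w _; apply/esym/cvg_lim => //.
    rewrite patchE; case: ifPn => [|]; rewrite ?inE ?notin_setE/= => tX.
      apply: cvg_near_cst; near=> m; congr (_%:E); apply/min_idPl.
      rewrite max_l ?subr_ge0 ?(ltW tX)// -ler_pdivrMr ?subr_gt0// .
      by near: m; exact: nbhs_infty_ger.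
    apply: cvg_near_cst; near=> m; congr (_%:E).
    rewrite /h max_r ?mulr0; last by rewrite subr_le0 leNgt; exact/negP.
    by apply/min_idPr.
  apply: cvg_monotone_convergence => //.
  - by move=> m w _; rewrite lee_fin.
  - by move=> w _ m n mn; rewrite lee_fin; exact: h_mono.
have eqh m : (\int[P]_w (h m (X1 w))%:E = \int[P]_w (h m (X2 w))%:E)%E.
  have mD1 := measurable_gt0 mX1; have mD2 := measurable_gt0 mX2.
  have mhX (X : T -> R) : measurable_fun setT X ->
      measurable_fun setT (fun w => (h m (X w))%:E).
    by move=> mX; apply/measurable_EFinP; exact: measurableT_comp.
  rewrite -(integral_gt0E mX1 X10 (mhX _ mX1)); last by move=> w; rewrite lee_fin.
  rewrite -(integral_gt0E mX2 X20 (mhX _ mX2)); last by move=> w; rewrite lee_fin.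
  have E1 (X : T -> R) : (\int[P]_(w in [set w | (0 < X w)%R]) (h m (X w))%:E =
      \int[P]_(w in [set w | (0 < X w)%R]) (cst 1 w * h m (X w))%:E)%E.
    by apply: eq_integral => w _; rewrite mul1r.
  rewrite !E1; apply: (@laplace_unique R _ _ _ _ P P _ _ (cst 1) X1 (cst 1) X2).
  - exact: mD1.
  - exact: finite_measure_integrable_cst.
  - by move=> w _; exact: ler01.
  - exact: measurable_funTS.
  - by [].
  - exact: mD2.
  - exact: finite_measure_integrable_cst.
  - by move=> w _; exact: ler01.
  - exact: measurable_funTS.
  - by [].
  - move=> n; rewrite (laplace_moment_transform n mX1 X10).
    rewrite (laplace_moment_transform n mX2 X20).
    have [->|n0] := posnP n; last by apply: lE; rewrite ltr0n.
    by apply: eq_integral => w _; rewrite !mul0r.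
  - exact: mh.
  - by move=> s _; exact: h_ge0.
  - by move=> s _; exact: ch.
apply: (cvg_unique (@ereal_hausdorff R) (key _ mX1)).
by rewrite (funext eqh); exact: key.
Unshelve. all: by end_near. Qed.

(** Differentiation under the expectation. On ]v/2, 2v[ the derivative S exp(-x S) is dominated by
    the constant 2/v, because y exp(-y) <= 1 for y = v S / 2; [S] itself may have infinite mean. *)
Lemma laplace_derivative (S : T -> R) (nu v : R) : 0 < v ->
  measurable_fun setT S -> (forall w, 0 <= S w) ->
  (forall v, 0 < v -> laplace_transform S v = (expR (- v `^ nu))%:E) ->
  (\int[P]_w (S w * expR (- (v * S w)))%:E =
   (nu * v `^ (nu - 1) * expR (- v `^ nu))%:E)%E.
Proof.
move=> v0 mS S0 lS.
pose f x w : R := expR (- (x * S w)).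
have dfE x w : is_derive x (1:R) (f ^~ w) (- (S w * f x w)).
  have -> : f ^~ w = @expR R \o ((- S w) *: (@id R)).
    apply/funext => y; rewrite /f/=; congr expR.
    by transitivity (- S w * y) => //; rewrite mulNr mulrC.
  apply: is_derive_eq; transitivity (expR (- S w * x) * (- S w * 1)) => //.
  by rewrite mulr1 mulrN mulrC /f mulNr (mulrC (S w) x).
have d1f x w : partial1of2 f x w = - (S w * f x w).
  by rewrite partial1of2E; have [_ ->] := dfE x w.
pose I : set R := `]v / 2, 2 * v[%classic.
have Iv : I v by rewrite /I /= in_itv/=; lra.
have I0 x : I x -> 0 < x by rewrite /I /= in_itv/=; lra.
have intf x : I x -> P.-integrable setT (EFin \o f x).
  move=> /I0 x0; apply: measurable_bounded_integrable => //.
  - by rewrite (le_lt_trans (probability_le1 _ _)) ?ltry.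
  - exact: measurable_laplace.
  - exists 1; split => // M M1 w _ /=.
    rewrite ger0_norm ?expR_ge0// (le_trans _ (ltW M1))//.
    by rewrite expR_le1 oppr_le0 mulr_ge0// ltW.
pose G (w : T) : R := 2 / v.
have SE x w : I x -> S w * f x w <= 2 / v.
  rewrite /I /= in_itv/= => /andP[x1 _].
  have h : v / 2 * S w * expR (- (v / 2 * S w)) <= 1.
    by rewrite expRN ler_pdivrMr ?expR_gt0// mul1r; have := expR_ge1Dx (v / 2 * S w); lra.
  have -> : 2 / v = (v / 2)^-1 * 1 by field; rewrite gt_eqF.
  have -> : S w * f x w = (v / 2)^-1 * (v / 2 * S w * f x w).
    by field; rewrite gt_eqF.
  apply: ler_wpM2l; first by rewrite invr_ge0 divr_ge0// ltW.
  apply: (le_trans _ h); apply: ler_wpM2l; first by rewrite mulr_ge0// divr_ge0// ltW.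
  by rewrite ler_expR lerN2 ler_wpM2r// ltW.
have df x w : I x -> setT w -> derivable (f ^~ w) x 1 by move=> _ _; have [] := dfE x w.
have Gub x w : I x -> setT w -> `|partial1of2 f x w| <= G w.
  by move=> Ix _; rewrite d1f normrN ger0_norm ?mulr_ge0 ?expR_ge0//; exact: SE.
have G0 w : 0 <= G w by rewrite divr_ge0// ltW.
have iG : P.-integrable setT (EFin \o G) by exact: finite_measure_integrable_cst.
have := @differentiation_under_integral R d T P f setT measurableT v _ _ Iv intf df G G0 iG Gub.
have FE x : 0 < x -> \int[P]_w f x w = expR (- x `^ nu).
  by move=> x0; rewrite /Rintegral -/(laplace_transform S x) lS.
rewrite derive1E (@near_eq_derive _ _ _ _ (@expR R \o (- (fun x : R => x `^ nu)))); last first.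
  near=> x; rewrite /= FE//; near: x; exact: lt_nbhsr.
have [_ ->] := is_derive_expRN_powR nu v0.
under eq_Rintegral do rewrite d1f.
move=> E.
have iSf : P.-integrable setT (fun w => (S w * f v w)%:E).
  apply: (le_integrable measurableT _ _ iG) => //.
    by apply/measurable_EFinP/measurable_funM => //; exact: measurable_laplace.
  move=> w _; rewrite /= lee_fin (ger0_norm (mulr_ge0 (S0 w) (expR_ge0 _))).
  by rewrite (ger0_norm (G0 w)); exact: SE Iv.
rewrite -[LHS]fineK; last exact: integrable_fin_num.
congr (_%:E); apply: oppr_inj.
have -> : - (nu * v `^ (nu - 1) * expR (- v `^ nu)) =
    expR (- v `^ nu) * - (nu * v `^ (nu - 1)) by ring.
rewrite E -[LHS]mulN1r -/(Rintegral _ _ _) -RintegralZl//.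
by apply: eq_Rintegral => w _; rewrite mulN1r.
Unshelve. all: by end_near. Qed.

End PositiveVariable.

(** * Tonelli's theorem on measurable rectangles *)

Section ProductSets.
Context {R : realType} {d1 d2 : measure_display}.
Context {T1 : measurableType d1} {T2 : measurableType d2}.
Variables (m1 : {sigma_finite_measure set T1 -> \bar R}).
Variables (m2 : {sigma_finite_measure set T2 -> \bar R}).
Variables (D1 : set T1) (D2 : set T2) (f : T1 * T2 -> \bar R).
Hypotheses (mD1 : measurable D1) (mD2 : measurable D2).
Hypothesis mf : measurable_fun (D1 `*` D2) f.
Hypothesis f0 : forall z, (D1 `*` D2) z -> (0 <= f z)%E.

(** Extension by zero, which turns integrals over the rectangle and its sections into integrals over
    whole spaces. *)
Let g := f \_ (D1 `*` D2).

Let mD : measurable (D1 `*` D2). Proof. exact: measurableX. Qed.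

Let mg : measurable_fun setT g. Proof. exact/(measurable_restrictT f mD). Qed.

Let g0 z : (0 <= g z)%E.
Proof. by apply: erestrict_ge0 => y Dy; exact: f0. Qed.

Let gE1 x : (\int[m2]_y g (x, y) =
  ((fun x => \int[m2]_(y in D2) f (x, y)) \_ D1) x)%E.
Proof.
rewrite patchE; case: ifPn => [|]; rewrite ?inE ?notin_setE => D1x.
  rewrite [RHS]integral_mkcond; apply: eq_integral => y _.
  by rewrite /g !patchE in_setX mem_set.
by apply: integral0_eq => y _; rewrite /g patchE in_setX memNset.
Qed.

Let gE2 y : (\int[m1]_x g (x, y) =
  ((fun y => \int[m1]_(x in D1) f (x, y)) \_ D2) y)%E.
Proof.
rewrite patchE; case: ifPn => [|]; rewrite ?inE ?notin_setE => D2y.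
  rewrite [RHS]integral_mkcond; apply: eq_integral => x _.
  by rewrite /g !patchE in_setX (mem_set D2y) andbT.
by apply: integral0_eq => x _; rewrite /g patchE in_setX (memNset D2y) andbF.
Qed.

Lemma ge0_integral_setX :
  (\int[m1 \x m2]_(z in D1 `*` D2) f z =
   \int[m1]_(x in D1) \int[m2]_(y in D2) f (x, y))%E.
Proof.
rewrite integral_mkcond fubini_tonelli1// [RHS]integral_mkcond.
by apply: eq_integral => x _; rewrite -gE1.
Qed.

Lemma ge0_integral_exchange :
  (\int[m1]_(x in D1) \int[m2]_(y in D2) f (x, y) =
   \int[m2]_(y in D2) \int[m1]_(x in D1) f (x, y))%E.
Proof.
rewrite -ge0_integral_setX integral_mkcond fubini_tonelli2// [RHS]integral_mkcond.
by apply: eq_integral => y _; rewrite -gE2.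
Qed.

Lemma measurable_integral_setX :
  measurable_fun D2 (fun y => \int[m1]_(x in D1) f (x, y))%E.
Proof.
apply/(measurable_restrictT _ mD2).
rewrite (_ : _ \_ _ = fun y => \int[m1]_x g (x, y))%E; last exact/funext.
exact: (measurable_fun_fubini_tonelli_G (m1 := m1) g mg g0).
Qed.

End ProductSets.

Section StableVariable.
Context {R : realType} {d : measure_display} {T : measurableType d}.
Variables (P : probability T R) (nu : R) (S : T -> R).
Hypotheses (nu01 : 0 < nu < 1) (mS : measurable_fun setT S).
Hypothesis S0 : forall w, 0 <= S w.
Hypothesis lS : forall v, 0 < v -> laplace_transform P S v = (expR (- v `^ nu))%:E.
Notation mu := (@lebesgue_measure R).

Let D1 : set T := [set w | 0 < S w].
Let D2 : set R := `]0, +oo[%classic.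
Let c : R := nu / Gamma (1 - nu).

Let nu_gt0 : 0 < nu. Proof. by case/andP : nu01. Qed.
Let a01 : 0 < 1 - nu <= 1. Proof. by case/andP : nu01 => h1 h2; lra. Qed.
Let c_ge0 : 0 <= c. Proof. by rewrite divr_ge0 ?ltW ?Gamma_gt0. Qed.
Let mD1 : measurable D1. Proof. exact: measurable_gt0. Qed.
Let mD2 : measurable D2. Proof. exact: measurable_itv. Qed.
Let D2E r : D2 r = (0 < r) :> Prop.
Proof. by rewrite /D2/= in_itv/= andbT. Qed.

Lemma stable_null : P [set w | S w <= 0] = 0%E.
Proof.
by apply: (@laplace_null _ _ _ _ _ 1 nu) => // v v0; rewrite lS// mul1r.
Qed.

(** The measure c r^(-nu) dr dP is infinite. The factor exp(-(r + S)) makes it finite and turns its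
    [n]-th moment into a Laplace transform at n + 1, which is positive even for n = 0. *)
Let w2 (z : T * R) : R := c * z.2 `^ (- nu) * expR (- (z.2 + S z.1)).
Let X2 (z : T * R) : R := z.2 + S z.1.

Let mX2 : measurable_fun (D1 `*` D2) X2.
Proof.
apply: measurable_funTS; apply: measurable_funD => //.
exact: measurableT_comp.
Qed.

Let mw2 : measurable_fun (D1 `*` D2) w2.
Proof.
apply: measurable_funM.
  apply: measurable_funTS; apply: measurable_funM => //.
  by apply: (measurableT_comp (measurable_powR _)).
by apply: measurableT_comp => //; exact: measurableT_comp.
Qed.

Let w2_ge0 z : 0 <= w2 z.
Proof. by rewrite /w2 mulr_ge0 ?expR_ge0// mulr_ge0 ?powR_ge0. Qed.

(** With v = n + 1, the integral over [r] is Gamma(1 - nu) v^(nu-1), and the remaining factor exp(-v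
    S) has expectation exp(-v^nu); the denominator of [c] cancels Gamma(1 - nu). *)
Let moment2 n : laplace_moment (P \x mu)%E (D1 `*` D2) w2 X2 n =
  (nu * n.+1%:R `^ (nu - 1) * expR (- n.+1%:R `^ nu))%:E.
Proof.
set v : R := n.+1%:R; have v0 : 0 < v by rewrite ltr0n.
rewrite /laplace_moment ge0_integral_setX//; last 2 first.
- apply/measurable_EFinP; apply: measurable_funM => //.
  apply: measurable_funX; apply: measurableT_comp => //; exact: measurableT_comp.
- by move=> z _; rewrite lee_fin mulr_ge0 ?exprn_ge0 ?expR_ge0.
transitivity (\int[P]_(w in D1)
    ((c * (v `^ (nu - 1) * Gamma (1 - nu)))%:E * (expR (- (v * S w)))%:E))%E.
  apply: eq_integral => w _.
  transitivity (\int[mu]_(r in D2) ((c * expR (- (v * S w)))%:E *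
      (r `^ (1 - nu - 1) * expR (- (v * r)))%:E))%E.
    apply: eq_integral => r _; rewrite -EFinM; congr (_%:E).
    rewrite /w2 /X2/= -expRM_natl.
    have -> : 1 - nu - 1 = - nu by ring.
    have -> : expR (- (r + S w)) = expR (- r) * expR (- S w) by rewrite -expRD opprD.
    have -> : expR (n%:R * - (r + S w)) = expR (- (n%:R * r)) * expR (- (n%:R * S w)).
      by rewrite -expRD; congr expR; ring.
    have -> : expR (- (v * S w)) = expR (- S w) * expR (- (n%:R * S w)).
      by rewrite -expRD; congr expR; rewrite /v -natr1; ring.
    have -> : expR (- (v * r)) = expR (- r) * expR (- (n%:R * r)).
      by rewrite -expRD; congr expR; rewrite /v -natr1; ring.
    by ring.
  rewrite ge0_integralZl_EFin//; last 3 first.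
  - by move=> r _; rewrite lee_fin mulr_ge0 ?powR_ge0 ?expR_ge0.
  - apply/measurable_EFinP; apply: measurable_funTS; apply: measurable_funM.
      exact: measurable_powR.
    by apply: measurableT_comp => //; apply: measurableT_comp => //; exact: measurable_funM.
  - by rewrite mulr_ge0 ?expR_ge0.
  rewrite gamma_integral_scale// -!EFinM; congr (_%:E).
  by rewrite opprB; ring.
rewrite ge0_integralZl_EFin//; last 2 first.
- by apply/measurable_EFinP; exact: measurable_laplace.
- by rewrite mulr_ge0// mulr_ge0 ?powR_ge0// ltW ?Gamma_gt0.
rewrite integral_gt0E ?stable_null//; last first.
  by apply/measurable_EFinP; exact: measurable_laplace.
rewrite -/(laplace_transform P S v) lS// -EFinM; congr (_%:E).
by rewrite /c; field; rewrite gt_eqF// Gamma_gt0.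
Qed.

(** The same exponential factor on S dP, as E[S] is infinite. *)
Let w1 w : R := S w * expR (- S w).

Let moment1 n : laplace_moment P D1 w1 S n =
  (nu * n.+1%:R `^ (nu - 1) * expR (- n.+1%:R `^ nu))%:E.
Proof.
rewrite -(laplace_derivative _ mS S0 lS) ?ltr0n// /laplace_moment.
rewrite -[RHS](integral_gt0E mS stable_null).
- apply: eq_integral => w _; rewrite /w1 -mulrA -expRM_natl -expRD.
  by congr ((_ * expR _)%:E); rewrite -natr1; ring.
- by apply/measurable_EFinP; apply: measurable_funM => //; exact: measurable_laplace.
- by move=> w; rewrite lee_fin mulr_ge0 ?expR_ge0.
Qed.

(* Both sides integrate [h] against a measure whose Laplace transform is
   [nu v^(nu-1) exp(-v^nu)], minus the derivative of [exp(-v^nu)]. *)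
Lemma stable_size_bias (h : R -> R) : measurable_fun setT h ->
  (forall s, 0 < s -> 0 <= h s) -> (forall s, 0 < s -> {for s, continuous h}) ->
  (\int[P]_(w in [set w | (0 < S w)%R]) (S w * h (S w))%:E =
   \int[P]_(w in [set w | (0 < S w)%R]) \int[mu]_(r in `]0%R, +oo[)
     (nu / Gamma (1 - nu) * r `^ (- nu) * h (r + S w))%:E)%E.
Proof.
move=> mh h0 ch.
have mom0 : ((nu * 1%:R `^ (nu - 1) * expR (- 1%:R `^ nu))%:E < +oo)%E by rewrite ltry.
have iw1 : P.-integrable D1 (EFin \o w1).
  apply/integrableP; split.
    by apply/measurable_EFinP; apply: measurable_funTS; apply: measurable_funM => //;
      apply: measurableT_comp => //; exact: measurableT_comp.
  rewrite (le_lt_trans _ mom0)// -moment1 /laplace_moment le_eqVlt; apply/orP; left.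
  apply/eqP; apply: eq_integral => w _.
  by rewrite /= expr0 mulr1 ger0_norm// /w1 mulr_ge0 ?expR_ge0.
have iw2 : (P \x mu)%E.-integrable (D1 `*` D2) (EFin \o w2).
  apply/integrableP; split; first exact/measurable_EFinP.
  rewrite (le_lt_trans _ mom0)// -moment2 /laplace_moment le_eqVlt; apply/orP; left.
  apply/eqP; apply: eq_integral => w _.
  by rewrite /= expr0 mulr1 ger0_norm.
(* Uniqueness is applied to exp(s) h(s), which undoes the factor exp(-s) in [w1] and [w2]. *)
have meh : measurable_fun setT (fun s => expR s * h s) by exact: measurable_funM.
transitivity (\int[P]_(w in D1) (w1 w * (expR (S w) * h (S w)))%:E)%E.
  apply: eq_integral => w _; rewrite /w1 mulrA -(mulrA (S w)) -expRD.
  by rewrite addNr expR0 mulr1.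
rewrite (@laplace_unique R _ _ _ _ P (P \x mu)%E D1 (D1 `*` D2) w1 S w2 X2
  (fun s => expR s * h s) mD1 iw1 _ _ _ _ iw2 _ mX2 _ _ meh).
- rewrite ge0_integral_setX//.
  + apply: eq_integral => w _; apply: eq_integral => r _; congr (_%:E).
    by rewrite /w2 /X2/= -[LHS]mulrA (mulrA (expR _)) -expRD addNr expR0 mul1r.
  + apply/measurable_EFinP; apply: measurable_funM => //.
    exact: (measurableT_comp meh).
  + move=> z [/= Sz]; rewrite D2E => z2.
    have X20 : 0 < X2 z by rewrite /X2 addr_gt0.
    by rewrite lee_fin mulr_ge0// mulr_ge0 ?expR_ge0// h0.
- by move=> w _; rewrite /w1 mulr_ge0 ?expR_ge0.
- exact: measurable_funTS.
- by [].
- exact: measurableX.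
- by move=> z _; exact: w2_ge0.
- by move=> z [/= Sz]; rewrite D2E => z2; rewrite /X2 addr_gt0.
- by move=> n; rewrite moment1 moment2.
- by move=> s s0; rewrite mulr_ge0 ?expR_ge0 ?h0.
- by move=> s s0; apply: cvgM; [exact: continuous_expR|exact: ch].
Qed.

End StableVariable.

(** * The Caputo derivative of a subordinated function *)

Section FractionalIntegral.
Context {R : realType} {d : measure_display} {T : measurableType d}.
Variables (P : probability T R) (nu : R) (S : T -> R).
Hypotheses (nu01 : 0 < nu < 1) (mS : measurable_fun setT S).
Hypothesis S0 : forall w, 0 <= S w.
Hypothesis lS : forall v, 0 < v -> laplace_transform P S v = (expR (- v `^ nu))%:E.
Notation mu := (@lebesgue_measure R).

Let D : set T := [set w | 0 < S w].
(** Powers of 0 with nonzero exponent are 0 by convention, so [Z] vanishes where [S] does. *)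
Let Z (w : T) : R := S w `^ (- nu).

Let nu_gt0 : 0 < nu. Proof. by case/andP : nu01. Qed.
Let nu_lt1 : nu < 1. Proof. by case/andP : nu01. Qed.
Let mD : measurable D. Proof. exact: measurable_gt0. Qed.
Let mZ (E : set T) : measurable_fun E Z.
Proof. by apply: measurable_funTS; apply: (measurableT_comp (measurable_powR _)). Qed.
Let Z_ge0 w : 0 <= Z w. Proof. exact: powR_ge0. Qed.

(** Exponential tail: Z > r forces v S <= 1 with v = r^(1/nu), hence 1 <= e exp(-v S), and taking
    expectations gives P(Z > r) <= e exp(-v^nu) = e exp(-r). The mean is the integral of the
    tail. *)
Lemma integrable_stable_inv : P.-integrable D (EFin \o Z).
Proof.
apply: (@integrableS _ _ _ P setT) => //.
pose X : {RV P >-> R} := HB.pack Z (@isMeasurableFun.Build _ _ _ _ Z (@mZ setT)).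
apply/integrableP; split; first exact/measurable_EFinP.
have -> : (\int[P]_x `|(EFin \o Z) x| = 'E_P[X])%E.
  by rewrite unlock; apply: eq_integral => w _; rewrite /= ger0_norm.
rewrite ge0_expectation_ccdf//.
have tail (r : R) : `[0, +oo[%classic r -> (ccdf X r <= (expR 1 * expR (- r))%:E)%E.
  rewrite /= in_itv/= andbT le_eqVlt => /predU1P[<-|r0].
    rewrite oppr0 expR0 mulr1 (le_trans (probability_le1 _ _))//.
    by rewrite lee_fin; have := expR_ge1Dx (1 : R); lra.
  have v0 : 0 < r `^ nu^-1 by rewrite powR_gt0.
  have E0 : laplace_transform P S (r `^ nu^-1) = (expR (- r))%:E.
    by rewrite lS// -powRrM mulVf ?gt_eqF// powRr1// ltW.
  rewrite EFinM -E0 /laplace_transform -ge0_integralZl_EFin ?expR_ge0//; last first.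
    by apply/measurable_EFinP; exact: measurable_laplace.
  have mA : measurable [set w | r < Z w].
    have -> : [set w | r < Z w] = [set w | 0 < Z w - r].
      by apply/seteqP; split => w /=; rewrite subr_gt0.
    by apply: measurable_gt0; exact: measurable_funB.
  have -> : ccdf X r = P [set w | r < Z w].
    by congr (P _); apply/seteqP; split => w /=; rewrite in_itv/= andbT.
  rewrite -[leLHS]mul1e -(integral_cst P mA) integral_mkcond/=.
  apply: ge0_le_integral => //.
  - by move=> w _; apply: erestrict_ge0.
  - by apply/(measurable_restrictT _ mA).
  - by apply/measurable_EFinP; apply: measurable_funM => //; exact: measurable_laplace.
  - move=> w _; rewrite patchE; case: ifPn => [|_]; last first.
      by rewrite lee_fin mulr_ge0 ?expR_ge0.
    rewrite inE/= => rZ; suff : 1 <= expR 1 * expR (- (r `^ nu^-1 * S w)).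
      by rewrite -EFinM -lee_fin.
    rewrite -expRD.
    suff : r `^ nu^-1 * S w <= 1.
      by move=> h; have := expR_ge1Dx (1 - r `^ nu^-1 * S w); lra.
    have Sw0 : 0 < S w.
      rewrite lt_neqAle S0 andbT; apply/eqP => Sw; move: rZ.
      by rewrite /Z -Sw powR0 ?oppr_eq0 ?gt_eqF// ltNge ltW.
    move: rZ; rewrite /Z powRN => rZ.
    have : r * S w `^ nu <= 1 by rewrite -ler_pdivlMr ?powR_gt0// mul1r ltW.
    move=> h; have -> : r `^ nu^-1 * S w = (r * S w `^ nu) `^ nu^-1.
      by rewrite powRM ?powR_ge0 ?(ltW r0)// -powRrM mulfV ?gt_eqF// powRr1.
    have <- : 1 `^ nu^-1 = 1 :> R by rewrite powR1.
    by apply: ge0_ler_powR; rewrite ?nnegrE ?invr_ge0 ?mulr_ge0 ?powR_ge0// ltW.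
have lty : (\int[mu]_(r in `]0%R, +oo[) (r `^ (1 - 1) * expR (- r))%:E < +oo)%E.
  by apply: gamma_integral_lty; rewrite ltr01 lexx.
apply: (@le_lt_trans _ _ ((expR 1)%:E *
    \int[mu]_(r in `]0%R, +oo[) (r `^ (1 - 1) * expR (- r))%:E)%E); last first.
  by rewrite lte_mul_pinfty// lee_fin expR_ge0.
have mg (E : set R) : measurable_fun E (fun r : R => (expR (- r))%:E).
  apply: measurable_funTS; apply/measurable_EFinP.
  by apply: measurableT_comp.
under [X in (_ <= _ * X)%E]eq_integral do rewrite subrr powRr0 mul1r.
rewrite -ge0_integralZl_EFin ?expR_ge0//.
rewrite integral_itv_obnd_cbnd; last by apply: emeasurable_funM => //; exact: mg.
apply: ge0_le_integral => //.
- by apply: measurable_funTS; exact: ccdf_measurable.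
- by apply: emeasurable_funM => //; exact: mg.
- exact: mg.
Qed.

Let iZ (c : R) : P.-integrable D (EFin \o (fun w => c * Z w)).
Proof.
have -> : EFin \o (fun w => c * Z w) = (fun w => c%:E * (EFin \o Z) w)%E by [].
by apply: integrableZl => //; exact: integrable_stable_inv.
Qed.

Variables (f F : R -> R) (C : R).
Hypotheses (mf : measurable_fun setT f) (mF : measurable_fun setT F).
Hypotheses (f0 : forall s, 0 < s -> 0 <= f s) (fC : forall s, 0 < s -> f s <= C).
Hypothesis cf : forall s, 0 < s -> {for s, continuous f}.
Hypothesis dF : forall s : R, 0 < s -> is_derive s (1:R) F (f s).
Hypothesis FC : forall s, 0 <= s -> `|F s| <= C * s.

Let C_ge0 : 0 <= C.
Proof. exact: le_trans (f0 ltr01) (fC ltr01). Qed.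

Let Z_gt0 w : D w -> 0 < Z w. Proof. by move=> Dw; rewrite powR_gt0. Qed.

(** The restriction to [D], an event of probability 1, keeps the argument t^nu Z positive for t > 0,
    where [f] is controlled. *)
Definition subordinated (g : R -> R) (t : R) : R :=
  \int[P]_(w in D) g (t `^ nu * Z w).

Let mcomp (g : R -> R) (t : R) (E : set T) : measurable_fun setT g ->
  measurable_fun E (fun w => g (t `^ nu * Z w)).
Proof.
by move=> mg; apply: measurableT_comp => //; exact: measurable_funM.
Qed.

Lemma integrable_subordinated t : P.-integrable D (fun w => (F (t `^ nu * Z w))%:E).
Proof.
apply: (@le_integrable _ _ _ _ _ mD _ (EFin \o (fun w => C * t `^ nu * Z w))).
- by apply/measurable_EFinP; exact: mcomp.
- move=> w _; rewrite /= lee_fin (ger0_norm (mulr_ge0 _ _)) ?mulr_ge0 ?powR_ge0//.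
  by rewrite -mulrA; apply: FC; rewrite mulr_ge0 ?powR_ge0.
- exact: iZ.
Qed.

Let G' (u : R) (w : T) : R := nu * u `^ (nu - 1) * Z w * f (u `^ nu * Z w).

Let dFt (u : R) (w : T) : 0 < u -> D w ->
  is_derive u (1:R) (fun x => F (x `^ nu * Z w)) (G' u w).
Proof.
move=> u0 Dw; pose g := Z w *: (fun x : R => x `^ nu).
have gE : g = fun x => x `^ nu * Z w by apply/funext => x; rewrite mulrC.
have dg := is_deriveZ (Z w) (is_derive1_powR nu u0).
have s0 : 0 < g u by rewrite gE mulr_gt0 ?powR_gt0 ?Z_gt0.
have := @is_derive1_comp _ F g u _ _ (dF s0) dg.
have -> : f (g u) * (Z w *: (nu * u `^ (nu - 1))) = G' u w.
  by rewrite -[_ *: _]/(_ * _) gE /G'; ring.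
by rewrite gE.
Qed.

Let pow_itv t : 0 < t -> forall x, `]t / 2, 2 * t[%classic x ->
  0 < x /\ x `^ (nu - 1) <= (t / 2) `^ (nu - 1).
Proof.
move=> t0 x; rewrite /= in_itv/= => /andP[x1 x2].
have th0 : 0 < t / 2 by rewrite divr_gt0.
have x0 : 0 < x by rewrite (lt_trans _ x1).
split => //; have -> : nu - 1 = - (1 - nu) by rewrite opprB.
rewrite !powRN lef_pV2 ?posrE ?powR_gt0//.
by apply: ge0_ler_powR; rewrite ?nnegrE ?subr_ge0//; exact: ltW.
Qed.

(** The derivative [G'] carries the factor u^(nu-1), unbounded near 0; on ]t/2, 2t[ it is at most
    its value at t/2, so [K], a multiple of the integrable variable [Z], dominates. *)
Let subordinated_derive t : 0 < t -> derivable (subordinated F) t 1 /\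
  derive1 (subordinated F) t = \int[P]_(w in D) G' t w.
Proof.
move=> t0; pose I : set R := `]t / 2, 2 * t[%classic.
have It : I t by rewrite /I /= in_itv/=; lra.
pose K w : R := (C * (nu * (t / 2) `^ (nu - 1))) * Z w.
have K0 w : 0 <= K w by rewrite mulr_ge0// mulr_ge0// mulr_ge0 ?powR_ge0// ltW.
have iK : P.-integrable D (EFin \o K) by exact: iZ.
pose g x w : R := F (x `^ nu * Z w).
have d1g x w : I x -> D w -> partial1of2 g x w = G' x w.
  move=> /(pow_itv t0)[x0 _] Dw; rewrite partial1of2E.
  by have [_ ->] := dFt x0 Dw.
have intg x : I x -> P.-integrable D (EFin \o g x) by move=> _; exact: integrable_subordinated.
have derg x w : I x -> D w -> derivable (g ^~ w) x 1.
  by move=> /(pow_itv t0)[x0 _] Dw; have [] := dFt x0 Dw.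
have gK x w : I x -> D w -> `|partial1of2 g x w| <= K w.
  move=> Ix Dw; rewrite d1g//; have [x0 xt] := pow_itv t0 Ix.
  have s0 : 0 < x `^ nu * Z w by rewrite mulr_gt0 ?powR_gt0 ?Z_gt0.
  rewrite ger0_norm; last first.
    by rewrite /G' !mulr_ge0 ?powR_ge0 ?f0// ltW.
  have -> : G' x w = f (x `^ nu * Z w) * (nu * x `^ (nu - 1)) * Z w.
    by rewrite /G'; ring.
  apply: ler_wpM2r => //.
  apply: ler_pM; [exact: f0|by rewrite mulr_ge0 ?powR_ge0// ltW|exact: fC|].
  by apply: ler_wpM2l => //; exact: ltW.
split.
  exact: (@derivable_under_integral R d T P g D mD t _ _ It intg derg K K0 iK gK).
rewrite (@differentiation_under_integral R d T P g D mD t _ _ It intg derg K K0 iK gK).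
by apply: eq_Rintegral => w; rewrite inE => Dw; rewrite d1g.
Qed.

Let iG' t : 0 < t -> P.-integrable D (EFin \o G' t).
Proof.
move=> t0.
apply: (@le_integrable _ _ _ _ _ mD _ (EFin \o (fun w => C * (nu * t `^ (nu - 1)) * Z w))).
- apply/measurable_EFinP; apply: measurable_funM; last exact: mcomp.
  exact: measurable_funM.
- move=> w Dw; rewrite /= lee_fin.
  have s0 : 0 < t `^ nu * Z w by rewrite mulr_gt0 ?powR_gt0 ?Z_gt0.
  have n0 : 0 <= nu * t `^ (nu - 1) by rewrite mulr_ge0 ?powR_ge0// ltW.
  rewrite !ger0_norm; [|by rewrite mulr_ge0// mulr_ge0|by rewrite /G' mulr_ge0 ?f0// mulr_ge0].
  have -> : G' t w = f (t `^ nu * Z w) * (nu * t `^ (nu - 1)) * Z w.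
    by rewrite /G'; ring.
  apply: ler_wpM2r => //; apply: ler_wpM2r => //.
  exact: fC.
- exact: iZ.
Qed.

Let subordinated0 : subordinated F 0 = 0.
Proof.
have F0 : F 0 = 0 by apply/eqP; rewrite -normr_le0 (le_trans (FC (lexx _)))// mulr0.
rewrite /subordinated; under eq_Rintegral do rewrite powR0 ?gt_eqF// mul0r F0.
by rewrite Rintegral_cst// mul0r.
Qed.

(** Derivability settles the positive times. At 0, where the derivative may blow up, continuity
    comes from |F(s)| <= C s and the finiteness of E[Z], which bound the function by C t^nu E[Z]. *)
Let subordinated_continuous : {within `[0, +oo[, continuous (subordinated F)}.
Proof.
apply/continuous_within_itvcyP; split.
  move=> t; rewrite in_itv/= andbT => t0.
  have [dG _] := subordinated_derive t0.
  by apply: (@differentiable_continuous _ R^o R^o); exact/derivable1_diffP.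
rewrite subordinated0.
pose EZ := \int[P]_(w in D) Z w.
have EZ0 : 0 <= EZ by apply: Rintegral_ge0.
have bound t : 0 <= t -> `|subordinated F t| <= C * t `^ nu * EZ.
  move=> t_ge0; rewrite /subordinated.
  rewrite (le_trans (le_normr_Rintegral _ _))//; first exact: integrable_subordinated.
  rewrite -RintegralZl//; last exact: integrable_stable_inv.
  apply: le_Rintegral => //.
  - exact/integrable_norm/integrable_subordinated.
  - move=> w _; rewrite -mulrA; apply: FC; rewrite mulr_ge0 ?powR_ge0//.
apply/norm_cvg0P.
have lim0 : (fun t : R => C * t `^ nu * EZ) t @[t --> 0^'+] --> C * 0 * EZ.
  by apply: cvgMl; apply: cvgMr; exact: powR_cvg0.
rewrite mulr0 mul0r in lim0.
apply: (@squeeze_cvgr _ _ _ _ (cst 0)); [|exact: cvg_cst|exact: lim0].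
near=> t; rewrite normr_ge0/= bound//.
Unshelve. all: by end_near. Qed.

Let g_ : R := Gamma (1 - nu).

Let g_gt0 : 0 < g_.
Proof. by apply: Gamma_gt0; case/andP : nu01 => h1 h2; lra. Qed.

(** The integrand of the Caputo derivative once the derivative is written as an expectation. It is
    nonnegative for 0 < u < t on [D], so Tonelli's theorem applies before any integrability is
    known. *)
Let q (t : R) (z : T * R) : R := g_^-1 * (G' z.2 z.1 * (t - z.2) `^ (- nu)).

Let mq t E : measurable_fun E (q t).
Proof.
apply: measurable_funTS; apply: measurable_funM => //; apply: measurable_funM; last first.
  apply: (measurableT_comp (measurable_powR _)) => //.
  exact: measurable_funB.
have mZ1 : measurable_fun setT (fun z : T * R => Z z.1).
  exact: (measurableT_comp (@mZ setT)).
have mpow a : measurable_fun setT (fun z : T * R => z.2 `^ a).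
  exact: (measurableT_comp (measurable_powR _)).
apply: measurable_funM; last first.
  by apply: (measurableT_comp mf); exact: measurable_funM.
by apply: measurable_funM => //; exact: measurable_funM.
Qed.

Let G'_ge0 u w : 0 < u -> D w -> 0 <= G' u w.
Proof.
move=> u0 Dw; rewrite /G' mulr_ge0//; last by rewrite f0// mulr_gt0 ?powR_gt0 ?Z_gt0.
by rewrite mulr_ge0// mulr_ge0 ?powR_ge0// ltW.
Qed.

Let q_ge0 t z : (D `*` `]0, t[%classic) z -> 0 <= q t z.
Proof.
move=> [Dz]; rewrite /= in_itv/= => /andP[z0 zt].
rewrite /q mulr_ge0 ?invr_ge0 ?(ltW g_gt0)//.
by rewrite mulr_ge0 ?powR_ge0// G'_ge0.
Qed.

Let ciE t u : 0 < u ->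
  ((g_^-1 * caputo_integrand nu (subordinated F) t u)%:E =
   \int[P]_(w in D) (q t (w, u))%:E)%E.
Proof.
move=> u0; rewrite /caputo_integrand (subordinated_derive u0).2 -powRN.
set I := \int[P]_(w in D) G' u w.
have -> : g_^-1 * (I * (t - u) `^ (- nu)) = g_^-1 * (t - u) `^ (- nu) * I by ring.
rewrite EFinM /I /Rintegral fineK; last by apply: integrable_fin_num => //; exact: iG'.
rewrite -ge0_integralZl_EFin//.
- by apply: eq_integral => w _; rewrite -EFinM; congr (_%:E); rewrite /q/=; ring.
- by move=> w Dw; rewrite lee_fin G'_ge0.
- by apply: measurable_int; exact: iG'.
- by rewrite mulr_ge0 ?powR_ge0// invr_ge0 ltW.
Qed.

Let powRV (x a : R) : 0 <= x -> x^-1 `^ a = (x `^ a)^-1.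
Proof. by move=> x0; rewrite -powR_inv1// -powRrM mulN1r powRN. Qed.

(** Under u = t S / (r + S) one has t - u = t r / (r + S) and u^nu S^(-nu) = t^nu (r + S)^(-nu).
    Outside [f] all powers of [t] and of [S] cancel, leaving r^(-nu) times a function of r + S, the
    form required by [stable_size_bias]. *)
Let substE t w : 0 < t -> D w ->
  (\int[mu]_(u in `]0%R, t[) (q t (w, u))%:E =
   \int[mu]_(r in `]0%R, +oo[) (nu / g_ * r `^ (- nu) *
     ((r + S w) `^ (-1) * f (t `^ nu * (r + S w) `^ (- nu))))%:E)%E.
Proof.
move=> t0 Dw; have Sw0 : 0 < S w by [].
pose Phi (r : R) : R := t * S w * (r + S w) `^ (-1).
have s0 (r : R) : 0 < r -> 0 < r + S w by move=> r0; rewrite addr_gt0.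
have dPhi (r : R) : 0 < r -> is_derive r (1:R) Phi (- (t * S w * (r + S w) `^ (-2))).
  move=> r0.
  have h1 := @is_derive1_powR R (-1) _ (s0 _ r0).
  have h2 : is_derive r (1:R) (fun r : R => r + S w) 1.
    have := is_deriveD (is_derive_id r (1:R)) (is_derive_cst (S w) r (1:R)).
    by rewrite addr0.
  have := is_deriveZ (t * S w) (@is_derive1_comp _ _ _ r _ _ h1 h2).
  have -> : (t * S w) *: (-1 * (r + S w) `^ (-1 - 1) * 1) =
      - (t * S w * (r + S w) `^ (-2)) :> R.
    rewrite -[_ *: _]/(_ * _).
    have -> : -1 - 1 = -2 :> R by ring.
    by ring.
  by [].
have Phi'E (r : R) : 0 < r -> derive1 Phi r = - (t * S w * (r + S w) `^ (-2)).
  by move=> /dPhi h; rewrite derive1E derive_val.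
have PhiE (r : R) : 0 < r -> Phi r = t * S w / (r + S w).
  by move=> r0; rewrite /Phi powR_inv1// ltW ?s0.
have JE : (`]0%R, t[%classic : set R) = Phi @` `]0%R, +oo[%classic.
  apply/seteqP; split => [y|_ [r + <-]]; rewrite /= !in_itv/= ?andbT.
    move=> /andP[y0 yt]; have r0 : 0 < t * S w / y - S w.
      by rewrite subr_gt0 ltr_pdivlMr// mulrC ltr_pM2r.
    exists (t * S w / y - S w); first by rewrite /= in_itv/= r0.
    by rewrite PhiE// subrK; field; rewrite !gt_eqF.
  move=> r0; rewrite PhiE// divr_gt0 ?mulr_gt0 ?s0//=.
  by rewrite ltr_pdivrMr ?s0// ltr_pM2l// ltrDr.
rewrite (@ge0_integration_by_substitution_decreasing_oy _ Phi
  (fun u => q t (w, u)) _ _ _ _ JE); last 5 first.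
- move=> x y x0 xy; have y0 := lt_trans x0 xy.
  rewrite !PhiE// ltr_pM2l ?mulr_gt0// ltf_pV2 ?posrE ?s0//.
  by rewrite ltrD2r.
- by move=> x /dPhi [].
- move=> x x0; apply: (eq_continuous_gt0 x0 Phi'E).
  apply: cvgN; apply: cvgM; first exact: cvg_cst.
  apply: (@continuous_comp _ _ _ (fun r => r + S w) (fun y : R => y `^ (-2))).
    by apply: cvgD; [exact: cvg_id|exact: cvg_cst].
  by apply: continuous_powR; exact: s0.
- move=> u; rewrite /= in_itv/= => /andP[u0 ut].
  suff : {for u, continuous (fun u => g_^-1 * (nu * u `^ (nu - 1) * Z w *
      f (u `^ nu * Z w) * (t - u) `^ (- nu)))} by [].
  apply: cvgM; first exact: cvg_cst.
  apply: cvgM; last first.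
    apply: (@continuous_comp _ _ _ (fun u => t - u) (fun y : R => y `^ (- nu))).
      by apply: cvgB; [exact: cvg_cst|exact: cvg_id].
    by apply: continuous_powR; rewrite subr_gt0.
  apply: cvgM.
    apply: cvgM; last exact: cvg_cst.
    by apply: cvgM; [exact: cvg_cst|exact: continuous_powR].
  apply: (@continuous_comp _ _ _ (fun u : R => u `^ nu * Z w) f).
    by apply: cvgM; [exact: continuous_powR|exact: cvg_cst].
  by apply: cf; rewrite mulr_gt0 ?powR_gt0 ?Z_gt0.
- by move=> u ut; apply: q_ge0.
apply: eq_integral => r; rewrite inE/= in_itv/= andbT => r0; congr (_%:E).
rewrite Phi'E// opprK PhiE// /q /G'/=.
set s := r + S w; have s_gt0 : 0 < s by exact: s0.
have sn0 : s != 0 by rewrite gt_eqF.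
have tn0 : t != 0 by rewrite gt_eqF.
have Sn0 : S w != 0 by rewrite gt_eqF.
have rn0 : r != 0 by rewrite gt_eqF.
have powE a : (t * S w / s) `^ a = t `^ a * S w `^ a / s `^ a.
  by rewrite powRM ?invr_ge0 ?mulr_ge0 ?ltW// powRM ?ltW// powRV// ltW.
have -> : t - t * S w / s = t * r / s by rewrite /s; field; exact: sn0.
have -> : (t * r / s) `^ (- nu) = s `^ nu / (t `^ nu * r `^ nu).
  by rewrite powRN powRM ?invr_ge0 ?mulr_ge0 ?ltW// powRM ?ltW// powRV ?ltW// invfM invrK mulrC.
rewrite !powE /Z !powRN.
have pn0 (x : R) : 0 < x -> x `^ nu != 0 by move=> x0; rewrite gt_eqF// powR_gt0.
have -> : t `^ nu * S w `^ nu / s `^ nu * (S w `^ nu)^-1 = t `^ nu / s `^ nu.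
  by field; rewrite !pn0.
have powB (x : R) : 0 < x -> x `^ (nu - 1) = x `^ nu / x.
  by move=> x0; rewrite powRB ?powRr1 ?(ltW x0)// (gt_eqF x0) implybT.
rewrite !powB// powRr1 ?(ltW s_gt0)//.
have -> : s `^ 2 = s ^+ 2 by rewrite -powR_mulrn// ltW.
by field; rewrite ?pn0//= ?rn0 ?sn0 ?tn0 ?Sn0 ?(gt_eqF g_gt0).
Qed.

Let main t : 0 < t ->
  (\int[mu]_(u in `]0%R, t[) (g_^-1 * caputo_integrand nu (subordinated F) t u)%:E =
   \int[P]_(w in D) (f (t `^ nu * Z w))%:E)%E.
Proof.
move=> t0.
transitivity (\int[mu]_(u in `]0%R, t[) \int[P]_(w in D) (q t (w, u))%:E)%E.
  by apply: eq_integral => u; rewrite inE/= in_itv/= => /andP[u0 _]; exact: ciE.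
rewrite -(@ge0_integral_exchange _ _ _ _ _ P mu D _ (EFin \o q t))//; last 2 first.
- by apply/measurable_EFinP; exact: mq.
- by move=> z /q_ge0; rewrite lee_fin.
pose h (s : R) := s `^ (-1) * f (t `^ nu * s `^ (- nu)).
transitivity (\int[P]_(w in D) \int[mu]_(r in `]0%R, +oo[)
     (nu / g_ * r `^ (- nu) * h (r + S w))%:E)%E.
  by apply: eq_integral => w; rewrite inE => Dw; exact: substE.
rewrite -(stable_size_bias nu01 mS S0 lS (h := h)).
- apply: eq_integral => w; rewrite inE => Dw; congr (_%:E).
  by rewrite /h powR_inv1 ?S0// mulrA mulfV ?mul1r// gt_eqF.
- apply: measurable_funM; first exact: measurable_powR.
  by apply: (measurableT_comp mf); apply: measurable_funM.
- by move=> s s0; rewrite mulr_ge0 ?powR_ge0 ?f0// mulr_gt0 ?powR_gt0.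
- move=> s s0; apply: cvgM; first exact: continuous_powR.
  apply: (@continuous_comp _ _ _ (fun s : R => t `^ nu * s `^ (- nu)) f).
    by apply: cvgM; [exact: cvg_cst|exact: continuous_powR].
  by apply: cf; rewrite mulr_gt0 ?powR_gt0.
Qed.

Let if_ t : 0 < t -> P.-integrable D (fun w => (f (t `^ nu * Z w))%:E).
Proof.
move=> t0; apply: (@le_integrable _ _ _ _ _ mD _ (EFin \o cst C)).
- by apply/measurable_EFinP; exact: mcomp.
- move=> w Dw; have s0 : 0 < t `^ nu * Z w by rewrite mulr_gt0 ?powR_gt0 ?Z_gt0.
  by rewrite /= lee_fin !ger0_norm ?f0// fC.
- exact: finite_measure_integrable_cst.
Qed.

(** The integrand is nonnegative and by [main] its integral is E[f(t^nu Z)], finite since 0 <= f <=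
    C. *)
Let ig_ t : 0 < t -> mu.-integrable `]0, t[
  (EFin \o (fun u => g_^-1 * caputo_integrand nu (subordinated F) t u)).
Proof.
move=> t0.
have E u : `]0, t[%classic u ->
    (g_^-1 * caputo_integrand nu (subordinated F) t u)%:E =
     (\int[P]_(w in D) (q t (w, u))%:E)%E.
  by rewrite /= in_itv/= => /andP[u0 _]; exact: ciE.
apply/integrableP; split.
  apply: (eq_measurable_fun (fun u => \int[P]_(w in D) (q t (w, u))%:E)%E).
    by move=> u; rewrite inE => /E.
  apply: (@measurable_integral_setX _ _ _ _ _ P D _ (EFin \o q t)) => //.
  - by apply/measurable_EFinP; exact: mq.
  - by move=> z /q_ge0; rewrite lee_fin.
rewrite (_ : (\int[mu]_(x in _) _)%E = (\int[P]_(w in D) (f (t `^ nu * Z w))%:E)%E).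
  by apply: integrable_lty => //; exact: if_.
rewrite -main//; apply: eq_integral => u; rewrite inE => /[dup] ut /E.
rewrite /= => Eu; rewrite ger0_norm// -lee_fin Eu.
by apply: integral_ge0 => w Dw; rewrite lee_fin q_ge0.
Qed.

Let integrable_caputo_integrand t : 0 < t ->
  mu.-integrable `]0, t[ (EFin \o caputo_integrand nu (subordinated F) t).
Proof.
move=> t0; have h : mu.-integrable `]0, t[ (fun u => g_%:E *
    (EFin \o (fun u => g_^-1 * caputo_integrand nu (subordinated F) t u)%R) u)%E.
  by apply: integrableZl; [exact: measurable_itv|exact: ig_].
move: h; apply: eq_integrable; first exact: measurable_itv.
by move=> u _; rewrite /= -EFinM mulrA mulfV ?mul1r// gt_eqF.
Qed.

Lemma subordinated_solution :
  caputo_cauchy_solution nu (subordinated f) 0 (subordinated F).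
Proof.
split; last exact: subordinated0.
- exact: subordinated_continuous.
- by move=> t /subordinated_derive[].
- exact: integrable_caputo_integrand.
- move=> t t0; rewrite /caputo -/g_.
  rewrite -RintegralZl//; last exact: integrable_caputo_integrand.
  by rewrite /Rintegral main.
Qed.

End FractionalIntegral.

(** * The inverse stable subordinator *)

Section EqualLaws.
Context {R : realType} {d : measure_display} {T : measurableType d}.
Variable P : probability T R.

(** The rays [u, +oo[ are stable under intersection and generate the Borel sets, so they determine
    the law; by nonnegativity the rays with u <= 0 have mass 1 under both laws. *)
Lemma eq_tail_integral (X1 X2 : T -> R) (phi : R -> \bar R) :
  measurable_fun setT X1 -> measurable_fun setT X2 ->
  (forall w, 0 <= X1 w) -> (forall w, 0 <= X2 w) ->
  (forall u, 0 < u -> P [set w | u <= X1 w] = P [set w | u <= X2 w]) ->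
  measurable_fun setT phi -> (forall s, (0 <= phi s)%E) ->
  (\int[P]_w phi (X1 w) = \int[P]_w phi (X2 w))%E.
Proof.
move=> mX1 mX2 X10 X20 tail mphi phi0.
pose V1 : {RV P >-> R} := HB.pack X1 (@isMeasurableFun.Build _ _ _ _ X1 mX1).
pose V2 : {RV P >-> R} := HB.pack X2 (@isMeasurableFun.Build _ _ _ _ X2 mX2).
rewrite -[LHS](@ge0_integral_distribution _ _ _ _ _ P V1)//.
rewrite -[RHS](@ge0_integral_distribution _ _ _ _ _ P V2)//.
apply: eq_measure_integral => A mA _.
have distE (X : {RV P >-> R}) (u : R) :
    distribution P X `[u, +oo[%classic = P [set w | u <= X w].
  by congr (P _); apply/seteqP; split => w /=; rewrite in_itv/= andbT.
have dist0 (X : {RV P >-> R}) (u : R) : (forall w, 0 <= X w) -> u <= 0 ->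
    distribution P X `[u, +oo[%classic = 1%E.
  move=> X0 u0; rewrite distE -(@probability_setT _ _ _ P); congr (P _).
  by apply/seteqP; split => w //= _; rewrite (le_trans u0).
apply: (measure_unique (@RGenCInfty.G R) (fun n => `[- n%:R, +oo[%classic)) => //.
- exact: RGenCInfty.measurableE.
- move=> _ _ [x ->] [y ->]; exists (Num.max x y).
  apply/seteqP; split => z /=; rewrite !in_itv/= !andbT ge_max.
    by move=> [-> ->].
  by move=> /andP[].
- by move=> n; exists (- n%:R).
- apply/seteqP; split => // z _; near \oo => n; exists n => //=.
  rewrite in_itv/= andbT lerNl (le_trans (ler_norm _))// normrN.
  by near: n; exact: nbhs_infty_ger.
- move=> _ [u ->]; transitivity (distribution P V1 `[u, +oo[%classic) => //.
  transitivity (distribution P V2 `[u, +oo[%classic) => //.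
  have [u0|u0] := ltP 0 u; last by rewrite !dist0.
  by rewrite !distE tail.
- by move=> n; rewrite (le_lt_trans (probability_le1 _ _))// ltry.
Unshelve. all: by end_near. Qed.

End EqualLaws.

Section SigmaGenerated.
Context {R : realType} {d d' : measure_display} {T : measurableType d}.
Context {E : measurableType d'} (P : probability T R).
Variables (I : set R) (X : R -> {RV P >-> E}).

Lemma sigma_generated_measurable A : sigma_generated I X A -> measurable A.
Proof.
apply: smallest_sub; first exact: sigma_algebra_measurable.
move=> B [t It [C mC <-]]; exact: measurable_funP.
Qed.

Lemma sigma_generated_preimage t B : I t -> measurable B ->
  sigma_generated I X (X t @^-1` B).
Proof.
move=> It mB; apply: sub_sigma_algebra; exists t => //.
by exists B => //; rewrite setTI.
Qed.

End SigmaGenerated.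

Lemma inverse_process_ge0 {R : realType} {T : Type} (sigma : R -> T -> R) t w :
  0 <= inverse_process sigma t w.
Proof.
have [[s hs]|h] := pselect ([set s | 0 <= s /\ t < sigma s w] !=set0).
  by apply: lb_le_inf; [exists s|move=> r []].
rewrite /inverse_process (_ : [set s | _] = set0) ?inf0//.
by apply/seteqP; split => // s hs; apply: h; exists s.
Qed.

Section InverseSubordinator.
Context {R : realType} {d : measure_display} {T : measurableType d}.
Variables (P : probability T R) (nu : R) (sigma : R -> {RV P >-> R}).
Hypotheses (nu01 : 0 < nu < 1) (Hs : stable_subordinator nu sigma).

Let S : T -> R := sigma 1.

Let nu_gt0 : 0 < nu. Proof. by case/andP : nu01. Qed.

Lemma subordinator_ge0 s w : 0 <= s -> 0 <= sigma s w.
Proof. by move=> s0; rewrite -(sub_init Hs w); apply: (sub_nondecreasing Hs). Qed.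

Lemma subordinator_laplace s v : 0 <= s -> 0 < v ->
  laplace_transform P (sigma s) v = (expR (- (s * v `^ nu)))%:E.
Proof.
by move=> s0 v0; rewrite -(sub_laplace Hs v0 s0) unlock.
Qed.

Let lS v : 0 < v -> laplace_transform P S v = (expR (- v `^ nu))%:E.
Proof. by move=> v0; rewrite subordinator_laplace// mul1r. Qed.

Let S0 w : 0 <= S w. Proof. exact: subordinator_ge0. Qed.

Let S_null : P [set w | S w <= 0] = 0%E.
Proof. by apply: (@stable_null _ _ _ P nu) => //; exact: measurable_funP. Qed.

(** Self-similarity at a fixed time: both variables have Laplace transform exp(-u v^nu). Uniqueness
    compares strict upper tails, hence the passage to complements. *)
Lemma subordinator_scaling u t : 0 < u -> 0 <= t ->
  P [set w | sigma u w <= t] = P [set w | u `^ nu^-1 * S w <= t].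
Proof.
move=> u0 t0; have v0 : 0 < u `^ nu^-1 by rewrite powR_gt0.
have mV : measurable_fun setT (fun w => u `^ nu^-1 * S w).
  by apply: measurable_funM => //; exact: measurable_funP.
have le_C (X : T -> R) : [set w | X w <= t] = ~` [set w | t < X w].
  apply/seteqP; split => w /=; first by rewrite leNgt => /negP.
  by move=> h; rewrite leNgt; exact/negP.
have mlt (X : T -> R) : measurable_fun setT X -> measurable [set w | t < X w].
  move=> mX; have -> : [set w | t < X w] = [set w | 0 < X w - t].
    by apply/seteqP; split => w /=; rewrite subr_gt0.
  by apply: measurable_gt0; exact: measurable_funB.
rewrite !le_C !probability_setC ?mlt//.
congr (1 - _)%E; apply: laplace_eq_law => //.
- apply: (@laplace_null _ _ _ P _ u nu) => //.
    by move=> w; exact/subordinator_ge0/ltW.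
  by move=> v v_gt0; rewrite subordinator_laplace// ltW.
- rewrite (_ : [set w | _] = [set w | S w <= 0])//.
  by apply/seteqP; split => w /=; rewrite pmulr_rle0.
- move=> v v_gt0; transitivity (laplace_transform P S (v * u `^ nu^-1)).
    rewrite (subordinator_laplace (ltW u0) v_gt0) (lS (mulr_gt0 v_gt0 v0)).
    have -> : (v * u `^ nu^-1) `^ nu = u * v `^ nu; last by [].
    rewrite powRM ?powR_ge0 ?(ltW v_gt0)// -powRrM mulVf ?(gt_eqF nu_gt0)//.
    by rewrite powRr1 ?(ltW u0)// mulrC.
  by apply: eq_integral => w _; rewrite mulrA.
- exact: mlt.
- exact: mlt.
Qed.

Variable t : R.
Hypothesis t0 : 0 <= t.

Let Y : T -> R := inverse_process sigma t.

Let N : set T := \bigcap_n [set w | sigma n%:R w <= t].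

Let G : set (set T) := sigma_generated [set t | 0 <= t] sigma.

(** Presents the generated family as the measurable sets of a type, so that closure lemmas for
    measurable sets apply to it. *)
Let GE : G = @measurable _ (g_sigma_algebraType
  [set A | exists2 t, [set t : R | 0 <= t] t &
     preimage_set_system setT (sigma t) measurable A]).
Proof. by []. Qed.

Let G_le s : 0 <= s -> G [set w | sigma s w <= t].
Proof.
move=> s0; rewrite (_ : [set w | _] = sigma s @^-1` `]-oo, t]%classic).
  by apply: sigma_generated_preimage => //; exact: measurable_itv.
by apply/seteqP; split => w /=; rewrite in_itv.
Qed.

Let GN : G N.
Proof. by rewrite GE; apply: bigcapT_measurable => n; rewrite -GE; exact: G_le. Qed.

(** Exponential Markov inequality: [N] lies in {sigma(n) <= t}, of probability at most e^t
    E[exp(-sigma(n))] = exp(t - n). *)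
Let N_null : P N = 0%E.
Proof.
have mN := sigma_generated_measurable GN.
apply/eqP; rewrite eq_le measure_ge0 andbT.
have le (n : nat) : (P N <= (expR (t - n%:R))%:E)%E.
  have mA : measurable [set w | sigma n%:R w <= t].
    exact: sigma_generated_measurable (G_le (ler0n _ _)).
  apply: (@le_trans _ _ (P [set w | sigma n%:R w <= t])).
    by apply: le_measure; rewrite ?inE// => w; exact.
  rewrite -[leLHS]mul1e -(integral_cst P mA).
  have -> : expR (t - n%:R) = expR t * expR (- (n%:R * 1 `^ nu)).
    by rewrite powR1 mulr1 expRD.
  rewrite EFinM -subordinator_laplace// -ge0_integralZl_EFin ?expR_ge0//; last first.
    by apply/measurable_EFinP; apply: measurable_laplace; exact: measurable_funP.
  apply: (@le_trans _ _ (\int[P]_(w in [set w | (sigma n%:R w <= t)%R])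
      ((expR t)%:E * (expR (- (1 * sigma n%:R w)))%:E))%E).
    apply: ge0_le_integral => //.
    - apply: emeasurable_funM => //; apply/measurable_EFinP.
      by apply: measurable_laplace; exact: measurable_funP.
    - move=> w /= h; rewrite -EFinM lee_fin -expRD mul1r.
      by have := expR_ge1Dx (t - sigma n%:R w); lra.
  apply: ge0_subset_integral => //.
  apply: emeasurable_funM => //; apply/measurable_EFinP.
  by apply: measurable_laplace; exact: measurable_funP.
have lim0 : (expR (t - n%:R))%:E @[n --> \oo] --> (0%:E : \bar R).
  have h : expR t * expR (- n%:R) @[n --> \oo] --> expR t * 0.
    by apply: cvgMr; exact: cvgn_expR.
  rewrite mulr0 in h; under eq_fun do rewrite expRD.
  by apply: cvg_EFin; [exact: nearW|exact: h].
apply: (cvge_to_ge lim0); exact: nearW.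
Qed.

Let Y_ge0 w : 0 <= Y w.
Proof.
exact: inverse_process_ge0.
Qed.

(* Off the null event [N] on which [sigma] never exceeds [t] (there the junk
   value [inf set0 = 0] is used), [u <= Y] iff [sigma <= t] on [[0, u[]. *)
Let tailE u : 0 < u ->
  [set w | u <= Y w] = \bigcap_n [set w | sigma (u * n.+1%:R / n.+2%:R) w <= t] `\` N.
Proof.
move=> u0; apply/seteqP; split => w /=.
  move=> uY.
  have below s : 0 <= s -> s < u -> sigma s w <= t.
    move=> s0 su; rewrite leNgt; apply/negP => h.
    have : Y w <= s by apply: ge_inf => //; exists 0 => r [].
    by rewrite leNgt (lt_le_trans su uY).
  split; last first.
    move=> Nw; move: uY; rewrite /Y /inverse_process (_ : [set s | _] = set0).
      by rewrite inf0 leNgt u0.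
    apply/seteqP; split => // s [s0 hs].
    near \oo => n; have := Nw n Logic.I => /=; rewrite leNgt => /negP; apply.
    rewrite (lt_le_trans hs)// (sub_nondecreasing Hs)//.
    by near: n; exact: nbhs_infty_ger.
  move=> n _ /=; apply: below; first by rewrite !mulr_ge0 ?invr_ge0// ltW.
  by rewrite ltr_pdivrMr// ltr_pM2l// ltr_nat.
move=> [h nN]; have [n /= sn] : exists n, t < sigma n%:R w.
  apply: contrapT => hn; apply: nN => n _ /=; rewrite leNgt; apply/negP => tn.
  by apply: hn; exists n.
apply: lb_le_inf; first by exists n%:R.
move=> s [s0 ts]; rewrite leNgt; apply/negP => su.
have us0 : 0 < u - s by rewrite subr_gt0.
(* As s < u, large [m] make u (m + 1) / (m + 2) at least [s]. *)
near \oo => m; have := h m Logic.I => /=; rewrite leNgt => /negP; apply.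
rewrite (lt_le_trans ts)// (sub_nondecreasing Hs)//.
rewrite ler_pdivlMr// -subr_ge0.
have -> : u * m.+1%:R - s * m.+2%:R = (u - s) * m.+1%:R - s.
  by rewrite -[in m.+2%:R]natr1; ring.
rewrite subr_ge0 mulrC -ler_pdivrMr//.
rewrite (@le_trans _ _ m%:R)//; last by rewrite ler_nat.
by near: m; exact: nbhs_infty_ger.
Unshelve. all: by end_near. Qed.

(** Membership in the sigma-algebra generated by [sigma], stronger than measurability, is what
    independence from the chain will use. *)
Lemma inverse_process_sigma u : G [set w | u <= Y w].
Proof.
have [u0|u0] := ltP 0 u; last first.
  rewrite (_ : [set w | _] = setT); first by rewrite GE; exact: measurableT.
  by apply/seteqP; split => w //= _; rewrite (le_trans u0).
rewrite tailE// GE; apply: measurableD; last by rewrite -GE.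
apply: bigcapT_measurable => n; rewrite -GE; apply: G_le.
by rewrite !mulr_ge0 ?invr_ge0// ltW.
Qed.

Lemma measurable_inverse_process : measurable_fun setT Y.
Proof.
apply: (measurability (@RGenCInfty.G R)); first exact: RGenCInfty.measurableE.
move=> _ [_ [x ->] <-]; rewrite setTI.
have -> : Y @^-1` `[x, +oo[%classic = [set w | x <= Y w].
  by apply/seteqP; split => w /=; rewrite in_itv/= andbT.
exact: (sigma_generated_measurable (inverse_process_sigma x)).
Qed.

Let V (w : T) : R := t `^ nu * S w `^ (- nu).

(** Up to null events, {u <= Y} is the decreasing intersection of the {sigma(u_n) <= t}, and {u <=
    V} that of the {u_n^(1/nu) S <= t}, with u_n increasing to u. [subordinator_scaling] equates the
    probabilities for each n, and continuity from above concludes. *)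
Let tail_law u : 0 < u -> P [set w | u <= Y w] = P [set w | u <= V w].
Proof.
move=> u0; pose un (n : nat) : R := u * n.+1%:R / n.+2%:R.
have un0 n : 0 < un n by rewrite /un divr_gt0// mulr_gt0.
have un_le n : un n <= u by rewrite /un ler_pdivrMr// ler_pM2l// ler_nat.
have un_mono m n : (m <= n)%N -> un m <= un n.
  move=> mn; rewrite /un ler_pdivrMr// mulrAC ler_pdivlMr//.
  rewrite -!mulrA ler_pM2l// -!natrM ler_nat.
  nia.
have un_cvg s : s < u -> exists n, s <= un n.
  move=> su; have us0 : 0 < u - s by rewrite subr_gt0.
  near \oo => m; exists m; rewrite /un ler_pdivlMr// -subr_ge0.
  have -> : u * m.+1%:R - s * m.+2%:R = (u - s) * m.+1%:R - s.
    by rewrite -[in m.+2%:R]natr1; ring.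
  rewrite subr_ge0 mulrC -ler_pdivrMr//.
  rewrite (@le_trans _ _ m%:R)//; last by rewrite ler_nat.
  by near: m; exact: nbhs_infty_ger.
pose A n := [set w | sigma (un n) w <= t].
pose B n := [set w | un n `^ nu^-1 * S w <= t].
have mA n : measurable (A n) by exact: (sigma_generated_measurable (G_le (ltW (un0 n)))).
have mB n : measurable (B n).
  have -> : B n = ~` [set w | 0 < un n `^ nu^-1 * S w - t].
    apply/seteqP; split => w; rewrite /B/= subr_gt0; first by rewrite leNgt => /negP.
    by move=> h; rewrite leNgt; exact/negP.
  apply/measurableC/measurable_gt0/measurable_funB => //.
  by apply: measurable_funM => //; exact: measurable_funP.
have P1 (E : set T) : measurable E -> (P E < +oo)%E.
  by move=> mE; rewrite (le_lt_trans (probability_le1 _ _))// ltry.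
have AB : P (\bigcap_n A n) = P (\bigcap_n B n).
  have cA : (P \o A) n @[n --> \oo] --> P (\bigcap_n A n).
    apply: nonincreasing_cvg_mu => //; [exact: P1|exact: bigcapT_measurable|].
    move=> m n mn; rewrite subsetEset => w; rewrite /A/=; apply: le_trans.
    by apply: (sub_nondecreasing Hs); [exact: ltW|exact: un_mono].
  have cB : (P \o B) n @[n --> \oo] --> P (\bigcap_n B n).
    apply: nonincreasing_cvg_mu => //; [exact: P1|exact: bigcapT_measurable|].
    move=> m n mn; rewrite subsetEset => w; rewrite /B/=; apply: le_trans.
    apply: ler_wpM2r => //; apply: ge0_ler_powR; last exact: un_mono.
    - by rewrite invr_ge0 ltW.
    - by rewrite nnegrE ltW.
    - by rewrite nnegrE ltW.
  apply: (cvg_unique (@ereal_hausdorff R) cA).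
  have -> : P \o A = P \o B by apply/funext => n; exact: subordinator_scaling.
  exact: cB.
have mbA : measurable (\bigcap_n A n) by exact: bigcapT_measurable.
have mN := sigma_generated_measurable GN.
have mbB : measurable (\bigcap_n B n) by exact: bigcapT_measurable.
have mS0 : measurable [set w | S w <= 0].
  rewrite set_le0E; apply: measurableC; apply: measurable_gt0.
  exact: measurable_funP.
have -> : P [set w | u <= Y w] = P (\bigcap_n A n).
  have -> : [set w | u <= Y w] = \bigcap_n A n `\` N := tailE u0.
  rewrite measureD//; last exact: P1.
  rewrite [X in (_ - X)%E](_ : _ = 0%E) ?sube0//.
  apply: (@subset_measure0 _ _ _ P _ N) => //; exact: measurableI.
rewrite AB.
(* On {S <= 0} every [B n] holds, whereas [V] is 0 by the convention for powers of 0, so this null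
   event has to be removed. *)
have -> : [set w | u <= V w] = \bigcap_n B n `\` [set w | S w <= 0].
  apply/seteqP; split => w /=.
    move=> uV; have Sw0 : 0 < S w.
      rewrite lt_neqAle S0 andbT; apply/eqP => Sw; move: uV.
      by rewrite /V -Sw powR0 ?oppr_eq0 ?gt_eqF// mulr0 leNgt u0.
    split; last by rewrite leNgt Sw0.
    move=> n _; rewrite /B/=.
    have h : un n * S w `^ nu <= t `^ nu.
      rewrite -ler_pdivlMr ?powR_gt0// -powRN.
      by rewrite (le_trans (un_le n)).
    have -> : un n `^ nu^-1 * S w = (un n * S w `^ nu) `^ nu^-1.
      by rewrite powRM ?powR_ge0 ?(ltW (un0 n))// -powRrM mulfV ?gt_eqF// powRr1.
    have -> : t = (t `^ nu) `^ nu^-1 by rewrite -powRrM mulfV ?gt_eqF// powRr1.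
    by apply: ge0_ler_powR; rewrite ?nnegrE ?invr_ge0 ?mulr_ge0 ?powR_ge0// ltW.
  move=> [h /negP]; rewrite -ltNge => Sw0; rewrite leNgt; apply/negP => Vu.
  have [n hn] : exists n, (V w + u) / 2 <= un n by apply: un_cvg; lra.
  have : un n <= V w.
    rewrite /V powRN ler_pdivlMr ?powR_gt0//.
    have -> : un n * S w `^ nu = (un n `^ nu^-1 * S w) `^ nu.
      by rewrite powRM ?powR_ge0// -powRrM mulVf ?gt_eqF// powRr1 ?ltW.
    apply: ge0_ler_powR; rewrite ?nnegrE ?mulr_ge0 ?powR_ge0 ?(ltW nu_gt0)//.
    exact: h.
  by move=> unV; lra.
rewrite measureD//; last exact: P1.
rewrite [X in (_ - X)%E](_ : _ = 0%E) ?sube0//.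
apply: (@subset_measure0 _ _ _ P _ [set w | S w <= 0]) => //; exact: measurableI.
Unshelve. all: by end_near. Qed.

Lemma integral_inverse_process (phi : R -> \bar R) :
  measurable_fun setT phi -> (forall s, (0 <= phi s)%E) ->
  (\int[P]_w phi (Y w) =
   \int[P]_(w in [set w | (0 < sigma 1 w)%R]) phi (t `^ nu * sigma 1 w `^ (- nu))%R)%E.
Proof.
move=> mphi phi0; have mV : measurable_fun setT V.
  apply: measurable_funM => //; apply: (measurableT_comp (measurable_powR _)).
  exact: measurable_funP.
rewrite (eq_tail_integral (X2 := V))//.
- by rewrite (@integral_gt0E _ _ _ P S)//; exact: measurableT_comp.
- exact: measurable_inverse_process.
- by move=> w; rewrite /V mulr_ge0 ?powR_ge0.
Qed.

End InverseSubordinator.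

(** * Chains jumping up by k and down by 1 *)

Lemma cvg_to_at_right {R : realType} {T : Type} (F : set_system T) (f : T -> R) (a : R) :
  Filter F -> f x @[x --> F] --> a -> (\forall x \near F, a < f x) ->
  f x @[x --> F] --> a^'+.
Proof.
move=> FF fa fp A aA.
have h : \forall x \near F, a < f x -> A (f x) := fa _ aA.
by apply: filterS2 h fp => x; exact.
Qed.

Lemma cvg_sum_nat {R : realType} {T : Type} (F : set_system T) (n : nat)
    (f : nat -> T -> R) (a : nat -> R) : Filter F ->
  (forall i, f i x @[x --> F] --> a i) ->
  \sum_(0 <= i < n) f i x @[x --> F] --> \sum_(0 <= i < n) a i.
Proof. by move=> FF fa; apply: cvg_big => //; exact: add_continuous. Qed.

Section SkipFreeChain.
Context {R : realType}.
Notation mu := (@lebesgue_measure R).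
Variables (k : nat) (lambda beta : R) (p : R -> nat -> nat -> R).
Hypotheses (k_gt0 : (0 < k)%N) (lambda_ge0 : 0 <= lambda) (beta_ge0 : 0 <= beta).

Let exit_rate (i : nat) : R := lambda + beta *+ (0 < i)%N.
Let rate (i j : nat) : R :=
  lambda *+ (j == i + k)%N + beta *+ ((0 < i)%N && (j == i.-1)).

Hypothesis p_ge0 : forall t i j, 0 <= t -> 0 <= p t i j.
Hypothesis p_sum1 : forall t i, 0 <= t ->
  \sum_(0 <= j < n) p t i j @[n --> \oo] --> (1 : R).
Hypothesis p_init : forall i j, p 0 i j = (i == j)%:R.
Hypothesis p_ck : forall s t i j, 0 <= s -> 0 <= t ->
  \sum_(0 <= z < n) (p s i z * p t z j) @[n --> \oo] --> p (s + t) i j.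
Hypothesis p_rate : forall i j, i != j -> p h i j / h @[h --> 0^'+] --> rate i j.
Hypothesis p_exit : forall i, (1 - p h i i) / h @[h --> 0^'+] --> exit_rate i.

(** Bounds all exit rates at once; it will be the common Lipschitz constant of the occupation
    probabilities. *)
Let Lam : R := lambda + beta.
Let Lam_ge0 : 0 <= Lam. Proof. by rewrite addr_ge0. Qed.
Let exit_le i : exit_rate i <= Lam.
Proof. by rewrite /exit_rate lerD2l; case: (0 < i)%N. Qed.

Let partial_le (a : nat -> R) (l : R) (n : nat) : (forall i, 0 <= a i) ->
  \sum_(0 <= i < n) a i @[n --> \oo] --> l -> \sum_(0 <= i < n) a i <= l.
Proof.
move=> a0 al; rewrite -(cvg_lim _ al)//.
apply: (@nondecreasing_cvgn_le _ (fun n => \sum_(0 <= i < n) a i)).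
  apply/nondecreasing_seqP => m; rewrite big_nat_recr//=.
  by rewrite lerDl.
by apply/cvg_ex; exists l.
Qed.

Let term_le (a : nat -> R) (l : R) (i : nat) : (forall i, 0 <= a i) ->
  \sum_(0 <= i < n) a i @[n --> \oo] --> l -> a i <= l.
Proof.
move=> a0 al; apply: le_trans (partial_le i.+1 a0 al).
by rewrite big_nat_recr//= lerDr sumr_ge0.
Qed.

Let term2_le (a : nat -> R) (l : R) (i j : nat) : (forall i, 0 <= a i) ->
  \sum_(0 <= i < n) a i @[n --> \oo] --> l -> i != j -> a i + a j <= l.
Proof.
move=> a0 al; wlog ij : i j / (i < j)%N.
  by move=> H; rewrite neq_ltn => /orP[ij|ij]; [|rewrite addrC];
    apply: H => //; rewrite ?ltn_eqF// neq_ltn ij ?orbT.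
move=> _; apply: le_trans (partial_le j.+1 a0 al).
rewrite big_nat_recr//= lerD2r (@big_cat_nat _ _ _ i.+1)//=.
have h1 : 0 <= \sum_(0 <= x < i) a x by rewrite sumr_ge0.
have h2 : 0 <= \sum_(i.+1 <= x < j) a x by rewrite sumr_ge0.
by rewrite big_nat_recr//=; lra.
Qed.

Let p_le1 t i j : 0 <= t -> p t i j <= 1.
Proof. by move=> t0; apply: (term_le _ (fun j => p_ge0 i j t0)); exact: p_sum1. Qed.

Let p_offdiag t i j : 0 <= t -> i != j -> p t i j <= 1 - p t i i.
Proof.
move=> t0 ij; rewrite lerBrDr.
by apply: (term2_le (fun j => p_ge0 i j t0) (p_sum1 i t0)); rewrite eq_sym.
Qed.

Let p_ck_ge s t i z j : 0 <= s -> 0 <= t -> p s i z * p t z j <= p (s + t) i j.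
Proof.
move=> s0 t0; apply: (term_le _ (a := fun z => p s i z * p t z j)); last exact: p_ck.
by move=> x; rewrite mulr_ge0 ?p_ge0.
Qed.

(* Iterating [p_h i i p_t i i <= p_(h+t) i i] and letting the step tend to 0
   bounds [1 - p_t i i] by [t] times the exit rate. *)
Let exit_iter i h n : 0 <= h -> 1 - p (n%:R * h) i i <= n%:R * (1 - p h i i).
Proof.
move=> h0; elim: n => [|n IH]; first by rewrite !mul0r p_init eqxx subrr.
rewrite -natr1 !mulrDl !mul1r.
have := p_ck_ge i i i (mulr_ge0 (ler0n R n) h0) h0.
have := p_le1 i i (mulr_ge0 (ler0n R n) h0); have := p_le1 i i h0.
have := p_ge0 i i h0; have := p_ge0 i i (mulr_ge0 (ler0n R n) h0).
by move: IH; set a := p (n%:R * h) i i; set b := p h i i; nra.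
Qed.

Let exit_bound i t : 0 <= t -> 1 - p t i i <= Lam * t.
Proof.
rewrite le_eqVlt => /predU1P[<-|t0]; first by rewrite p_init eqxx subrr mulr0.
have h0 : t / n.+1%:R @[n --> \oo] --> (0 : R)^'+.
  apply: cvg_to_at_right; last by apply: nearW => n; rewrite divr_gt0.
  rewrite -(mulr0 t); apply: cvgMr.
  exact: (@cvg_harmonic R).
have lim : (t * ((1 - p (t / n.+1%:R) i i) / (t / n.+1%:R))) @[n --> \oo] -->
    t * exit_rate i.
  apply: cvgMr.
  apply: (@cvg_comp _ _ _ (fun n : nat => t / n.+1%:R) (fun h => (1 - p h i i) / h)).
    exact: h0.
  exact: p_exit.
rewrite (@le_trans _ _ (t * exit_rate i))//; last first.
  by rewrite mulrC ler_wpM2r// ltW.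
apply: (cvgr_to_ge lim); apply: nearW => n.
have -> : t * ((1 - p (t / n.+1%:R) i i) / (t / n.+1%:R)) =
    n.+1%:R * (1 - p (t / n.+1%:R) i i).
  by field; rewrite (gt_eqF t0)/=; rewrite gt_eqF// ltr_wpDl.
have := exit_iter i n.+1 (divr_ge0 (ltW t0) (ler0n R n.+1)).
by rewrite mulrCA mulfV ?mulr1.
Qed.

Let dev_bound h i j : 0 <= h -> `|p h i j - (i == j)%:R| <= Lam * h.
Proof.
move=> h0; have [->|ij] := eqVneq i j.
  by rewrite distrC ger0_norm ?subr_ge0 ?p_le1// exit_bound.
rewrite subr0 ger0_norm ?p_ge0//.
exact: le_trans (p_offdiag h0 ij) (exit_bound i h0).
Qed.

(* Extending by the value at time 0 makes this continuous on all of R. *)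
Definition occupation (j : nat) (t : R) : R := p (Num.max t 0) 0%N j.
Notation occ := occupation.

Let max_ge0 (t : R) : 0 <= Num.max t 0. Proof. by rewrite le_max lexx orbT. Qed.

Let occE j t : 0 <= t -> occ j t = p t 0%N j.
Proof. by move=> t0; rewrite /occ max_l. Qed.

Lemma occupation_ge0 j t : 0 <= occ j t. Proof. exact: p_ge0. Qed.
Let occ_ge0 := occupation_ge0.

Definition occupation_below (n : nat) (t : R) : R := \sum_(0 <= j < n) occ j t.
Notation cum := occupation_below.

Lemma occupation_below_ge0 n t : 0 <= cum n t. Proof. by rewrite sumr_ge0. Qed.

Lemma occupation_below_le1 n t : cum n t <= 1.
Proof. by apply: (partial_le n (fun j => occ_ge0 j t)); exact: p_sum1. Qed.

Lemma occupation_below_cvg t : cum n t @[n --> \oo] --> (1 : R).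
Proof. exact: p_sum1. Qed.

Lemma occupation_le1 j t : occ j t <= 1. Proof. exact: p_le1. Qed.

(* Truncating the Chapman-Kolmogorov sum at [K > j] costs at most
   [Lam h P(length >= K)]. *)
Let ck_trunc K j s h : (j < K)%N -> 0 <= s -> 0 <= h ->
  `|occ j (s + h) - occ j s -
    \sum_(0 <= x < K) occ x s * (p h x j - (x == j)%:R)| <=
  Lam * h * (1 - cum K s).
Proof.
move=> jK s0 h0.
have -> : occ j (s + h) - occ j s -
    \sum_(0 <= x < K) occ x s * (p h x j - (x == j)%:R) =
    occ j (s + h) - \sum_(0 <= x < K) occ x s * p h x j.
  under eq_bigr do rewrite mulrBr.
  rewrite sumrB [X in _ - X = _](_ : _ = \sum_(0 <= x < K) occ x s * p h x j - occ j s).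
    by ring.
  congr (_ - _); rewrite (bigD1_seq j)/= ?mem_index_iota ?iota_uniq// eqxx mulr1.
  by rewrite big1 ?addr0// => x /negPf ->; rewrite mulr0.
have ck : \sum_(0 <= x < n) (occ x s * p h x j) @[n --> \oo] --> occ j (s + h).
  rewrite occE ?addr_ge0//; under eq_fun do under eq_bigr do rewrite occE//.
  exact: p_ck.
have a0 x : 0 <= occ x s * p h x j by rewrite mulr_ge0 ?p_ge0.
rewrite ger0_norm ?subr_ge0; last exact: (partial_le K a0 ck).
rewrite lerBlDr; apply: (cvgr_to_le ck); near=> n.
have Kn : (K <= n)%N by near: n; exact: nbhs_infty_ge.
rewrite (@big_cat_nat _ _ _ K)//= addrC lerD2r.
apply: (@le_trans _ _ (Lam * h * \sum_(K <= x < n) occ x s)).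
  rewrite mulr_sumr !big_nat; apply: ler_sum => x /andP[Kx _].
  rewrite mulrC ler_wpM2r//.
  have xj : x != j by rewrite gtn_eqF// (leq_trans jK).
  by have := dev_bound x j h0; rewrite (negPf xj) subr0; apply: le_trans; exact: ler_norm.
rewrite ler_wpM2l ?mulr_ge0// lerBrDl.
have := occupation_below_le1 n s; rewrite {1}/cum (@big_cat_nat _ _ _ K)//=.
Unshelve. all: by end_near. Qed.

(** Split the Chapman-Kolmogorov sum at j + 1: the part below contributes at most Lam h P(length <=
    j), the rest at most Lam h P(length > j), and the two add up to Lam h. *)
Let occ_lip j s h : 0 <= s -> 0 <= h -> `|occ j (s + h) - occ j s| <= Lam * h.
Proof.
move=> s0 h0; have := ck_trunc (ltnSn j) s0 h0.
set A := occ j (s + h) - occ j s; set B := \sum_(0 <= x < j.+1) _ => AB.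
have BW : `|B| <= Lam * h * cum j.+1 s.
  rewrite (le_trans (ler_norm_sum _ _ _))// /cum mulr_sumr; apply: ler_sum => x _.
  by rewrite normrM ger0_norm// mulrC ler_wpM2r// dev_bound.
have -> : A = (A - B) + B by ring.
by rewrite (le_trans (ler_normD _ _))// (le_trans (lerD AB BW))// -mulrDr subrK mulr1.
Qed.

Lemma occupation_lipschitz j s t : `|occ j s - occ j t| <= Lam * `|s - t|.
Proof.
have occM u : occ j u = occ j (Num.max u 0) by rewrite /occ (max_l (max_ge0 u)).
wlog st : s t / t <= s.
  move=> H; have [/H//|/ltW/H] := leP t s.
  by rewrite distrC (distrC t).
rewrite (ger0_norm (x := s - t)) ?subr_ge0// (occM s) (occM t).
have mm : Num.max t 0 <= Num.max s 0 by rewrite ge_max !le_max st lexx !orbT.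
have -> : Num.max s 0 = Num.max t 0 + (Num.max s 0 - Num.max t 0) by rewrite addrC subrK.
rewrite (le_trans (occ_lip j (max_ge0 t) _)) ?subr_ge0// ler_wpM2l//.
have [t0|t0] := leP 0 t.
  by rewrite !max_l// (le_trans t0).
by rewrite subr0 ge_max; apply/andP; split; lra.
Qed.

Lemma continuous_occupation j : continuous (occ j).
Proof.
move=> t; apply/cvgrPdist_le => e e0.
have L1 : 0 < Lam + 1 by rewrite ltr_wpDl.
near=> u; rewrite (le_trans (occupation_lipschitz _ _ _))//.
rewrite (@le_trans _ _ ((Lam + 1) * `|t - u|))//.
  by rewrite ler_wpM2r// lerDl.
rewrite -ler_pdivlMl// mulrC; near: u.
by apply: cvgr_dist_le; [exact: cvg_id|rewrite divr_gt0].
Unshelve. all: by end_near. Qed.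

Lemma continuous_occupation_below n : continuous (cum n).
Proof.
move=> t; suff : (fun t => \sum_(0 <= j < n) occ j t) x @[x --> t] -->
  \sum_(0 <= j < n) occ j t by [].
by apply: cvg_sum_nat => i; exact: continuous_occupation.
Qed.

(** The generator matrix of the chain. *)
Let drift (x j : nat) : R := if x == j then - exit_rate x else rate x j.

Let drift_cvg x j : (p h x j - (x == j)%:R) / h @[h --> 0^'+] --> drift x j.
Proof.
rewrite /drift; have [->|xj] := eqVneq x j.
  rewrite -[X in _ --> X]opprK; under eq_fun do rewrite -[p _ _ _ - _]opprB mulNr.
  by rewrite opprK; apply: cvgN; exact: p_exit.
by under eq_fun do rewrite subr0; exact: p_rate.
Qed.

(** Right-hand side of the Kolmogorov forward equation for P(length = j). *)
Let inflow (j : nat) (t : R) : R :=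
  - exit_rate j * occ j t + (lambda * occ (j - k)%N t) *+ (k <= j)%N +
  beta * occ j.+1 t.

Let sum_single (c : nat -> R) (a K : nat) : (a < K)%N ->
  \sum_(0 <= x < K) c x *+ (x == a) = c a.
Proof.
move=> aK; rewrite (bigD1_seq a)/= ?mem_index_iota ?iota_uniq// eqxx mulr1n.
by rewrite big1 ?addr0// => x /negPf ->; rewrite mulr0n.
Qed.

(** Column [j] of the generator is supported on j, j - k and j + 1, so a truncation beyond j + 1
    already gives the whole forward equation. *)
Let sum_drift K j t : (j.+1 < K)%N ->
  \sum_(0 <= x < K) occ x t * drift x j = inflow j t.
Proof.
move=> jK.
transitivity (\sum_(0 <= x < K) (((- exit_rate x * occ x t) *+ (x == j) +
    (lambda * occ x t) *+ (k <= j)%N *+ (x == j - k)%N) +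
    (beta * occ x t) *+ (x == j.+1))).
  apply: eq_bigr => x _; rewrite /drift /rate.
  have -> : (j == x + k)%N = (k <= j)%N && (x == j - k)%N by lia.
  have -> : (0 < x)%N && (j == x.-1) = (x == j.+1) by lia.
  have [->|xj] := eqVneq x j.
    have -> : lambda * occ j t *+ (k <= j)%N *+ (j == j - k)%N = 0.
      have [kj|kj] := leqP k j; last by rewrite mulr0n mul0rn.
      by rewrite gtn_eqF// ltn_subrL k_gt0 (leq_trans k_gt0 kj).
    by rewrite addr0 ltn_eqF// mulr0n addr0 mulr1n mulrC.
  rewrite mulr0n add0r mulrDr !mulrnAr !(mulrC (occ x t)).
  by rewrite -mulrnA mulnb.
rewrite !big_split/=; congr (_ + _ + _).
- by apply: (sum_single (fun x => - exit_rate x * occ x t)); lia.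
- by apply: (sum_single (fun x => (lambda * occ x t) *+ (k <= j)%N)); lia.
- exact: (sum_single (fun x => beta * occ x t)).
Qed.

(** The limit is taken through a truncated sum, whose finitely many terms converge; [ck_trunc]
    bounds the error by Lam P(length >= K), small for large [K] because the masses sum to 1. *)
Lemma is_derive_occupation j (t : R) : 0 < t -> is_derive t (1:R) (occ j) (inflow j t).
Proof.
move=> t0.
have absr : `|h : R| @[h --> (0 : R)^'] --> (0 : R)^'+.
  apply: (@cvg_to_at_right R R _ (fun h => `|h|)).
    have h : `|x : R| @[x --> (0 : R)] --> `|0 : R| by apply: cvg_norm; exact: cvg_id.
    by rewrite normr0 in h; apply: cvg_within_filter; exact: h.
  near=> h; rewrite normr_gt0; near: h; exact: nbhs_dnbhs_neq.
suff H : h^-1 *: ((occ j \o shift t) (h *: 1) - occ j t) @[h --> 0^'] --> inflow j t.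
  by apply: DeriveDef; [apply/cvg_ex; exists (inflow j t)|apply/cvg_lim].
apply/cvgrPdist_le => e e0.
(* Chosen so that Lam eps <= e / 2; the added 1 avoids a division by 0. *)
pose eps := e / 2 / (Lam + 1).
have L1 : 0 < Lam + 1 by rewrite ltr_wpDl.
have eps0 : 0 < eps by rewrite !divr_gt0.
have [K jK WK] : exists2 K, (j.+1 < K)%N & 1 - cum K t < eps.
  near \oo => n; exists n; first by near: n; exact: nbhs_infty_gt.
  rewrite ltrBlDr -ltrBlDl; near: n; apply: (cvgr_gt _ (occupation_below_cvg t)).
  by rewrite ltrBlDr ltrDl.
(* Transition probabilities only run forward in time: for either sign of [h] the difference quotient
   is the forward one from min(t, t + h) with step |h|. *)
pose m h := Num.min t (t + h).
have cth : t + h @[h --> (0 : R)^'] --> t.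
  apply: cvg_within_filter; rewrite -{2}(addr0 t).
  by apply: cvgD; [exact: cvg_cst|exact: cvg_id].
have cm : m h @[h --> 0^'] --> t.
  have h : {for t, continuous (fun y => Num.min t y)}.
    by apply: continuous_min; [exact: cvg_cst|exact: cvg_id].
  rewrite /prop_for /continuous_at minxx in h.
  by apply: (@cvg_comp _ _ _ (fun h => t + h) (fun y => Num.min t y)); [exact: cth|exact: h].
pose Fin h := \sum_(0 <= x < K) occ x (m h) * ((p `|h| x j - (x == j)%:R) / `|h|).
have cFin : Fin h @[h --> 0^'] --> inflow j t.
  rewrite -(sum_drift t jK) /Fin; apply: cvg_sum_nat => x; apply: cvgM.
    exact: (cvg_comp _ _ cm (@continuous_occupation x t)).
  apply: (@cvg_comp _ _ _ (fun h : R => `|h|) (fun h => (p h x j - (x == j)%:R) / h)).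
    exact: absr.
  exact: drift_cvg.
have cW : cum K (m h) @[h --> 0^'] --> cum K t.
  exact: (cvg_comp _ _ cm (@continuous_occupation_below K t)).
have e20 : 0 < e / 2 by rewrite divr_gt0.
near=> h.
have h0 : h != 0 by near: h; exact: nbhs_dnbhs_neq.
have th0 : 0 < t + h by near: h; exact: (cvgr_gt _ cth).
have ah0 : 0 < `|h| by rewrite normr_gt0.
have close : `|h^-1 *: ((occ j \o shift t) (h *: 1) - occ j t) - Fin h| <=
    Lam * (1 - cum K (m h)).
  have m0 : 0 <= m h by rewrite le_min !ltW.
  have quot : h^-1 *: ((occ j \o shift t) (h *: 1) - occ j t) =
      (occ j (m h + `|h|) - occ j (m h)) / `|h|.
    rewrite /= -[_ *: _]/(h^-1 * _) -[h *: 1]/(h * 1) mulr1 /m.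
    have [hp|hn] := ltP 0 h.
      by rewrite min_l ?lerDl ?ltW// gtr0_norm// (addrC t) mulrC.
    rewrite min_r; last by rewrite gerDl.
    by rewrite ler0_norm// addrK (addrC h) invrN mulrN -mulNr opprB mulrC.
  rewrite quot /Fin; under eq_bigr do rewrite mulrA.
  rewrite -mulr_suml -mulrBl normrM [X in _ * X]ger0_norm ?invr_ge0//.
  rewrite ler_pdivrMr// mulrAC; apply: ck_trunc => //.
  exact: ltnW.
have hFin : `|inflow j t - Fin h| <= e / 2.
  by near: h; move/cvgrPdist_le: cFin; exact.
have hW : 1 - cum K (m h) <= eps.
  rewrite lerBlDr -lerBlDl ltW//; near: h; apply: (cvgr_gt _ cW).
  by rewrite ltrBlDr -ltrBlDl.
rewrite -(subrK (Fin h) (inflow j t)) -addrA (le_trans (ler_normD _ _))//.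
rewrite (splitr e) lerD// distrC (le_trans close)//.
rewrite (@le_trans _ _ (Lam * eps))// ?ler_wpM2l//.
rewrite /eps mulrA ler_pdivrMr// mulrC ler_wpM2l ?lerDl// ltW//.
Unshelve. all: by end_near. Qed.

(** Net flow across the cut between n and n + 1: upward jumps come from the lengths n + 1 - k, ...,
    n, the only downward one from n + 1. When n + 1 <= k the truncated subtraction gives 0, as every
    length up to n then jumps across. *)
Let sum_inflow n t : \sum_(0 <= j < n.+1) inflow j t =
  - lambda * (cum n.+1 t - cum (n.+1 - k)%N t) + beta * occ n.+1 t.
Proof.
have cumS m : cum m.+1 t = cum m t + occ m t by rewrite /cum big_nat_recr.
have cum0 : cum 0 t = 0 by rewrite /cum big_nil.
elim: n => [|n IH].
  have -> : (1 - k)%N = 0%N by lia.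
  rewrite big_nat1 /inflow /exit_rate cumS cum0 ltnn leqn0 (gtn_eqF k_gt0) !mulr0n; ring.
rewrite big_nat_recr//= IH /inflow /exit_rate (cumS n.+1) mulr1n.
have [kn|kn] := leqP k n.+1.
  have -> : (n.+2 - k)%N = (n.+1 - k).+1 by lia.
  by rewrite (cumS (n.+1 - k)%N) [_ *+ true]mulr1n; ring.
have -> : (n.+2 - k)%N = (n.+1 - k)%N by lia.
by rewrite [_ *+ false]mulr0n; ring.
Qed.

Lemma is_derive_occupation_below n (t : R) : 0 < t -> is_derive t (1:R) (cum n.+1)
  (- lambda * (cum n.+1 t - cum (n.+1 - k)%N t) + beta * occ n.+1 t).
Proof.
move=> t0; rewrite -sum_inflow.
have -> : cum n.+1 = \sum_(0 <= j < n.+1) occ j.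
  by apply/funext => u; rewrite fct_sumE.
rewrite !big_mkord; apply: is_derive_sum => j; exact: is_derive_occupation.
Qed.

(* The mean of the length truncated at [M + k], as a sum of tails. *)
Let tmean (M : nat) (t : R) : R := \sum_(0 <= j < M + k) (1 - cum j.+1 t).

(** The drift of the truncated mean. As [M] grows the sum tends to [k], while
    [cum (M + k).+1 t - occ 0%N t] is P(1 <= length <= M + k) and tends to P(length > 0). *)
Let tdrift (M : nat) (t : R) : R :=
  lambda * (\sum_(0 <= i < k) cum (M + i).+1 t) -
  beta * (cum (M + k).+1 t - occ 0%N t).

(** The two shifted sums cancel except for the top [k] terms; cutting at [M + k] leaves exactly a
    window of that width. *)
Let sum_window M t :
  \sum_(0 <= j < M + k) (cum j.+1 t - cum (j.+1 - k)%N t) =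
  \sum_(0 <= i < k) cum (M + i).+1 t.
Proof.
elim: M => [|M IH].
  rewrite add0n; apply: eq_big_nat => j /andP[_ jk].
  have -> : (j.+1 - k)%N = 0%N by lia.
  by rewrite /cum big_nil subr0.
rewrite addSn big_nat_recr//= IH.
have -> : ((M + k).+1 - k)%N = M.+1 by lia.
have : \sum_(0 <= i < k.+1) cum (M + i).+1 t =
    cum M.+1 t + \sum_(0 <= i < k) cum (M.+1 + i).+1 t.
  rewrite big_nat_recl//= addn0; congr (_ + _); apply: eq_bigr => i _.
  by rewrite addnS.
by rewrite big_nat_recr//= => H; lra.
Qed.

Let is_derive_tmean M (t : R) : 0 < t -> is_derive t (1:R) (tmean M) (tdrift M t).
Proof.
move=> t0.
have -> : tdrift M t = \sum_(0 <= j < M + k)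
    (0 - (- lambda * (cum j.+1 t - cum (j.+1 - k)%N t) + beta * occ j.+1 t)).
  under eq_bigr do rewrite sub0r opprD mulNr opprK.
  rewrite big_split/= -mulr_sumr sum_window sumrN -mulr_sumr /tdrift.
  congr (_ - _ * _); rewrite /cum big_nat_recl//= addrAC subrr add0r.
  by [].
have -> : tmean M = \sum_(0 <= j < M + k) (cst 1 - cum j.+1).
  by apply/funext => u; rewrite /tmean fct_sumE.
rewrite !big_mkord; apply: is_derive_sum => j.
by apply: is_deriveB; exact: is_derive_occupation_below.
Qed.

Let continuous_tmean M : continuous (tmean M).
Proof.
move=> t; suff : (fun t => \sum_(0 <= j < M + k) (1 - cum j.+1 t)) x @[x --> t] -->
  \sum_(0 <= j < M + k) (1 - cum j.+1 t) by [].
apply: cvg_sum_nat => i; apply: cvgB; first exact: cvg_cst.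
exact: continuous_occupation_below.
Qed.

Let continuous_tdrift M : continuous (tdrift M).
Proof.
move=> t; apply: cvgB; apply: cvgM; try exact: cvg_cst.
  by apply: cvg_sum_nat => i; exact: continuous_occupation_below.
by apply: cvgB; [exact: continuous_occupation_below|exact: continuous_occupation].
Qed.

Let segment_lty (s : R) : (mu `[0%R, s]%classic < +oo)%E.
Proof. by rewrite /= lebesgue_measure_itv/=; case: ifP; rewrite -?EFinB ltry. Qed.

Lemma integrable_occupation (s : R) : mu.-integrable `[0, s] (EFin \o occ 0%N).
Proof.
apply: measurable_bounded_integrable => //; first exact: segment_lty.
  by apply: measurable_funTS; apply: continuous_measurable_fun; exact: continuous_occupation.
exists 1; split => // B B1 u _ /=.
by rewrite ger0_norm// (le_trans (occupation_le1 _ _))// ltW.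
Qed.

Definition mean_length (s : R) : R :=
  (lambda * k%:R - beta) * s + beta * \int[mu]_(u in `[0, s]) occ 0%N u.

Let tmean0 M : tmean M 0 = 0.
Proof.
rewrite /tmean big1// => j _; rewrite /cum big_nat_recl//= occE// p_init eqxx.
rewrite big1 ?addr0 ?subrr// => i _.
by rewrite occE// p_init.
Qed.

Let cum_shift m u : cum (M + m)%N u @[M --> \oo] --> (1 : R).
Proof. by rewrite (cvg_shiftn m (cum ^~ u)); exact: occupation_below_cvg. Qed.

Let tmean_cvg s : 0 < s -> tmean M s @[M --> \oo] --> mean_length s.
Proof.
move=> s0.
have mI : measurable (`[0, s]%classic : set R) by exact: measurable_itv.
have muI : (mu `[0%R, s]%classic < +oo)%E.
  by rewrite lebesgue_measure_itv/= lte_fin s0 -EFinB ltry.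
have mc (f : R -> R) : continuous f -> measurable_fun `[0, s] f.
  by move=> cf; apply: measurable_funTS; exact: continuous_measurable_fun.
have FTC M : (\int[mu]_(u in `[0%R, s]) (tdrift M u)%:E = (tmean M s)%:E)%E.
  rewrite (@continuous_FTC2 _ (tdrift M) (tmean M) 0 s)//.
  - by rewrite tmean0 sube0.
  - by apply: continuous_subspaceT; exact: continuous_tdrift.
  - split.
    + by move=> x; rewrite in_itv/= => /andP[x0 _]; have [] := is_derive_tmean M x0.
    + exact/cvg_at_right_filter/continuous_tmean.
    + exact/cvg_at_left_filter/continuous_tmean.
  - move=> x; rewrite in_itv/= => /andP[x0 _].
    by rewrite derive1E; have [_ ->] := is_derive_tmean M x0.
pose g u := (lambda * k%:R - beta) + beta * occ 0%N u.
have iocc := @integrable_occupation s.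
have lim : (\int[mu]_(u in `[0%R, s]) (tdrift M u)%:E @[M --> \oo] -->
    \int[mu]_(u in `[0%R, s]) (g u)%:E)%E.
  (* The drift is bounded by lambda k + beta uniformly in [M], each [cum] being a probability. *)
  apply: (@dominated_cvg _ _ _ mu _ mI _ _ (EFin \o cst (lambda * k%:R + beta))).
  - move=> M; apply/measurable_EFinP; apply: (mc (tdrift M)); exact: continuous_tdrift.
  - move=> u _; apply: cvg_EFin; first exact: nearW.
    have -> : g u = lambda * (\sum_(0 <= i < k) 1) - beta * (1 - occ 0%N u).
      by rewrite /g sumr_const_nat subn0; ring.
    apply: cvgB; apply: cvgM; try exact: cvg_cst.
      by apply: cvg_sum_nat => i; under eq_fun do rewrite -addnS; exact: cum_shift.
    apply: cvgB; last exact: cvg_cst.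
    by under eq_fun do rewrite -addnS; exact: cum_shift.
  - by [].
  - apply: measurable_bounded_integrable => //.
    exists (lambda * k%:R + beta); split; first exact: num_real.
    move=> B hB u _ /=.
    by rewrite ger0_norm ?addr_ge0 ?mulr_ge0// ltW.
  - move=> M u _; rewrite lee_fin /tdrift.
    have h1 : 0 <= \sum_(0 <= i < k) cum (M + i).+1 u.
      by rewrite sumr_ge0// => i _; exact: occupation_below_ge0.
    have h2 : \sum_(0 <= i < k) cum (M + i).+1 u <= k%:R.
      rewrite -[leRHS]mulr1 -[in leRHS](subn0 k) mulr_natl -sumr_const_nat.
      by apply: ler_sum => i _; exact: occupation_below_le1.
    have h3 : 0 <= cum (M + k).+1 u - occ 0%N u.
      by rewrite /cum big_nat_recl//= addrAC subrr add0r sumr_ge0.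
    have h4 : cum (M + k).+1 u - occ 0%N u <= 1.
      by rewrite lerBlDr (le_trans (occupation_below_le1 _ _))// lerDl.
    have h5 := ler_wpM2l lambda_ge0 h2; have h6 := ler_wpM2l beta_ge0 h4.
    have h7 := mulr_ge0 lambda_ge0 h1; have h8 := mulr_ge0 beta_ge0 h3.
    rewrite mulr1 in h6; rewrite ler_norml /cst/=.
    have h9 : 0 <= lambda * k%:R by rewrite mulr_ge0.
    move: h5 h6 h7 h8 h9 beta_ge0; set X := lambda * _; set Y := beta * _.
    by set Z := lambda * _ => *; apply/andP; split; lra.
have gE : (\int[mu]_(u in `[0%R, s]) (g u)%:E = (mean_length s)%:E)%E.
  rewrite -[LHS]fineK; last first.
    apply: integrable_fin_num => //.
    apply: measurable_bounded_integrable => //.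
      apply: mc => u; apply: cvgD; first exact: cvg_cst.
      by apply: cvgM; [exact: cvg_cst|exact: continuous_occupation].
    exists (`|lambda * k%:R - beta| + beta); split; first exact: num_real.
    move=> B hB u _ /=.
    rewrite (le_trans (ler_normD _ _))// (le_trans _ (ltW hB))// lerD2l.
    by rewrite ger0_norm ?mulr_ge0// ler_piMr// occupation_le1.
  congr (_%:E); rewrite -/(Rintegral mu _ g) /g RintegralD//; last 2 first.
  - apply: measurable_bounded_integrable => //.
    exists (`|lambda * k%:R - beta|); split; first exact: num_real.
    move=> B hB u _ /=.
    by rewrite ltW.
  - have -> : EFin \o (fun u => beta * occ 0%N u) =
        (fun u => beta%:E * (EFin \o occ 0%N) u)%E by [].
    exact: integrableZl.
  rewrite Rintegral_cst//= lebesgue_measure_itv/= lte_fin s0 -EFinB/= subr0.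
  by rewrite RintegralZl.
move: lim; under eq_fun do rewrite FTC.
by rewrite gE => /fine_cvg.
Qed.

Lemma tail_sum_cvg s : 0 <= s ->
  \sum_(0 <= j < n) (1 - cum j.+1 s) @[n --> \oo] --> mean_length s.
Proof.
rewrite le_eqVlt => /predU1P[<-|s0].
  rewrite /mean_length mulr0 set_itv1 Rintegral_set1 mulr0 addr0.
  apply: cvg_near_cst; apply: nearW => n; rewrite big1// => j _.
  rewrite /cum big_nat_recl//= occE// p_init eqxx.
  by rewrite big1 ?addr0 ?subrr// => i _; rewrite occE// p_init.
have := tmean_cvg s0; rewrite /tmean.
by rewrite (cvg_shiftn k (fun n => \sum_(0 <= j < n) (1 - cum j.+1 s))).
Qed.

Lemma is_derive_integral_occupation (s : R) : 0 < s ->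
  is_derive s (1:R) (fun s => \int[mu]_(u in `[0, s]) occ 0%N u) (occ 0%N s).
Proof.
move=> s0; have su : s < s + 1 by rewrite ltrDl.
have iocc := @integrable_occupation (s + 1).
have [d e] := continuous_FTC1_closed su iocc s0 (@continuous_occupation 0%N s).
rewrite derive1E in e; apply: DeriveDef; [exact: d|exact: e].
Qed.

Lemma integral_occupation_bound (s : R) : 0 <= s ->
  0 <= \int[mu]_(u in `[0, s]) occ 0%N u <= s.
Proof.
move=> s0; rewrite Rintegral_ge0//=.
have E : \int[mu]_(u in `[0, s]) 1 = s.
  rewrite Rintegral_cst//= lebesgue_measure_itv/= lte_fin mul1r.
  case: ltP => [_|h]; first by rewrite -EFinB/= subr0.
  by apply/eqP; rewrite eq_le s0 h.
rewrite -[leRHS]E; apply: le_Rintegral => //.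
- exact: integrable_occupation.
- apply: measurable_bounded_integrable => //; first exact: segment_lty.
  by exists 1; split => // B B1 u _ /=; rewrite normr1 ltW.
- by move=> u _; exact: occupation_le1.
Qed.

End SkipFreeChain.

(** * States numbered by their length in phases *)

Section StateOfLength.
Variable k : nat.
Hypothesis k_gt0 : (0 < k)%N.

(** Euclidean division by [k]: length m + 1 with m = k (n - 1) + (s - 1) corresponds to (n, s). For
    k > 0 these pairs are states, so the default of [insubd] is never taken. *)
Definition state_of_length (n : nat) : state k :=
  insubd (empty_state k)
    (if n is m.+1 then ((m %/ k).+1, (m %% k).+1)%N else (0, 0)%N).
Notation st := state_of_length.

Let val_st0 : val (st 0) = (0, 0)%N. Proof. by rewrite val_insubd. Qed.

Let val_stS m : val (st m.+1) = ((m %/ k).+1, (m %% k).+1)%N.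
Proof. by rewrite val_insubd /is_state/= ltn_pmod// orbT. Qed.

Let val_stMD q r : (r < k)%N -> val (st (q * k + r).+1) = (q.+1, r.+1)%N.
Proof.
by move=> rk; rewrite val_stS divnMDl// divn_small// addn0 modnMDl modn_small.
Qed.

Lemma state_of_lengthK : cancel st (@length_in_phases k).
Proof.
case=> [|m]; rewrite /length_in_phases ?val_st0// val_stS/= subn1/=.
by rewrite addnS mulnC -divn_eq.
Qed.

Lemma length_in_phasesK : cancel (@length_in_phases k) st.
Proof.
move=> x; apply: val_inj; case: x => -[n s] /=.
rewrite /length_in_phases/= /is_state/= => /orP[/eqP[-> ->]|/andP[n0 /andP[s0 sk]]].
  exact: val_st0.
case: n n0 => // n _; case: s s0 sk => // s _ sk /=.
by rewrite subn1/= addnS mulnC val_stMD.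
Qed.

Lemma state_of_length_eq i j : (st i == st j) = (i == j).
Proof. exact/(can_eq state_of_lengthK). Qed.

Lemma length_in_phases_eq0 x : (@length_in_phases k x == 0%N) = (x == empty_state k).
Proof.
have -> : empty_state k = st 0 by apply: val_inj; rewrite val_st0.
by rewrite -[in RHS](length_in_phasesK x) state_of_length_eq.
Qed.

Let after_arrival_st i : after_arrival k (val (st i)) = val (st (i + k)).
Proof.
case: i => [|m]; rewrite /after_arrival.
  rewrite val_st0/= add0n; have -> : st k = st (0 * k + k.-1).+1 by congr st; lia.
  by rewrite val_stMD prednK.
by rewrite val_stS/= addSn val_stS divnDr// divnn k_gt0 addn1 modnDr.
Qed.

Let after_phase_completion_st m :
  after_phase_completion k (val (st m.+1)) = val (st m).
Proof.
rewrite val_stS /after_phase_completion/=.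
have mk : (m %% k < k)%N by rewrite ltn_pmod.
rewrite [in RHS](divn_eq m k); case: (m %% k)%N mk => [|r] rk /=; last first.
  by rewrite addnS val_stMD// ltnW.
(* Remainder 0 is phase 1: completing it either brings the next customer in phase [k] or empties the
   queue. *)
case: (m %/ k)%N => [|q]/=; first by rewrite mul0n val_st0.
have -> : st (q.+1 * k + 0) = st (q * k + k.-1).+1 by congr st; lia.
by rewrite val_stMD prednK.
Qed.

Lemma erlang_rate_state_of_length {R : realType} (lambda mu : R) i j :
  erlang_rate lambda mu (st i) (st j) =
  lambda *+ (j == i + k)%N + (k%:R * mu) *+ ((0 < i)%N && (j == i.-1)).
Proof.
rewrite /erlang_rate after_arrival_st (inj_eq val_inj) state_of_length_eq.
congr (_ + _ *+ _); rewrite -length_in_phases_eq0 state_of_lengthK -lt0n.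
case: i => //= i.
by rewrite after_phase_completion_st (inj_eq val_inj) state_of_length_eq.
Qed.

Lemma esum_state_of_length {R : realType} (A : set (state k)) (a : state k -> \bar R) :
  \esum_(y in A) a y = \esum_(j in [set j | A (st j)]) a (st j).
Proof.
apply: reindex_esum; split.
- by move=> j.
- by move=> i j _ _ /(can_inj state_of_lengthK).
- move=> y Ay; exists (length_in_phases y); last exact: length_in_phasesK.
  by rewrite /= length_in_phasesK.
Qed.

End StateOfLength.

(** * The transition function in terms of lengths *)

Section TransitionOnLengths.
Context {R : realType}.
Variables (k : nat) (lambda mu : R) (p : R -> state k -> state k -> R).
Hypotheses (k_gt0 : (0 < k)%N) (lambda_ge0 : 0 <= lambda) (mu_ge0 : 0 <= mu).
Hypothesis Hp : transition_function (erlang_rate lambda mu) p.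
Notation st := (state_of_length k).

Definition length_transition (t : R) (i j : nat) : R := p t (st i) (st j).
Notation q := length_transition.

Lemma length_transition_ge0 t i j : 0 <= t -> 0 <= q t i j.
Proof. by move=> t0; apply: (tf_ge0 Hp). Qed.

(** Turns the unordered sums over states into limits of partial sums over lengths. *)
Let esum_nat_cvg (a : nat -> R) (l : R) : (forall j, 0 <= a j) ->
  (\esum_(y in [set: state k]) (a (length_in_phases y))%:E = l%:E)%E ->
  \sum_(0 <= j < n) a j @[n --> \oo] --> l.
Proof.
move=> a0; rewrite esum_state_of_length// => al.
have {}al : (\sum_(j <oo) (a j)%:E = l%:E)%E.
  rewrite -al nneseries_esumT; last by move=> n; rewrite lee_fin.
  by apply: eq_esum => j _; rewrite state_of_lengthK.
have := @is_cvg_nneseries R (fun j => (a j)%:E) xpredT 0 (fun n _ _ => a0 n).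
move=> /cvg_ex[/= L hL]; have E := cvg_lim _ hL; move: hL.
rewrite -(E (@ereal_hausdorff _)) al; under eq_fun do rewrite sumEFin.
by move=> /fine_cvg.
Qed.

Lemma length_transition_sum1 t i : 0 <= t ->
  \sum_(0 <= j < n) q t i j @[n --> \oo] --> (1 : R).
Proof.
move=> t0; apply: esum_nat_cvg => [j|]; first exact: length_transition_ge0.
rewrite -(tf_sum1 Hp (st i) t0); apply: eq_esum => y _.
by rewrite /q length_in_phasesK.
Qed.

Lemma length_transition_init i j : q 0 i j = (i == j)%:R.
Proof. by rewrite /q (tf_init Hp) state_of_length_eq. Qed.

Lemma length_transition_ck s t i j : 0 <= s -> 0 <= t ->
  \sum_(0 <= z < n) (q s i z * q t z j) @[n --> \oo] --> q (s + t) i j.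
Proof.
move=> s0 t0; apply: (esum_nat_cvg (a := fun z => q s i z * q t z j)) => [z|].
  by rewrite mulr_ge0// length_transition_ge0.
rewrite -(tf_chapman_kolmogorov Hp)//; apply: eq_esum => y _.
by rewrite /q length_in_phasesK.
Qed.

Lemma length_transition_rate i j : i != j ->
  q h i j / h @[h --> 0^'+] -->
  lambda *+ (j == i + k)%N + (k%:R * mu) *+ ((0 < i)%N && (j == i.-1)).
Proof.
move=> ij; rewrite -erlang_rate_state_of_length//; apply: (tf_rate Hp).
by rewrite state_of_length_eq.
Qed.

(** The unordered sum of the rates out of [i] reduces to the targets i + k and i - 1, both different
    from [i]; for i = 0 the Boolean factor removes the second. *)
Lemma length_transition_exit i :
  (1 - q h i i) / h @[h --> 0^'+] --> lambda + (k%:R * mu) *+ (0 < i)%N.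
Proof.
have := @tf_exit_rate _ _ _ _ Hp (st i); rewrite esum_state_of_length//=.
set E := (\esum_(j in _) _)%E.
suff -> : E = (lambda + (k%:R * mu) *+ (0 < i)%N)%:E by move=> /fine_cvg.
rewrite /E.
have -> : [set j | st j != st i] = [set j | j != i].
  by apply/seteqP; split => j /=; rewrite state_of_length_eq.
have mono (c : R) (b : bool) (m : nat) : 0 <= c -> (b -> m != i) ->
    (\esum_(j in [set j | j != i]) (c *+ (b && (j == m)))%:E = (c *+ b)%:E)%E.
  move=> c0; case: b => [/(_ isT) mi|_] /=; last by rewrite esum1.
  rewrite mulr1n -(@esum_set1 R nat m (fun=> c%:E)) ?lee_fin//.
  rewrite [LHS]esum_mkcond [RHS]esum_mkcond; apply: eq_esum => j _.
  have [->|jm] := eqVneq j m; first by rewrite !mem_set.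
  by rewrite if_same; case: ifPn => //; rewrite inE /= => /eqP; rewrite (negPf jm).
under eq_esum do rewrite erlang_rate_state_of_length// EFinD.
have kmu0 : 0 <= k%:R * mu by rewrite mulr_ge0.
rewrite esumD => [|j _|j _]; last 2 first.
- by rewrite lee_fin mulrn_wge0.
- by rewrite lee_fin mulrn_wge0.
rewrite (mono lambda true)//; last by move=> _; lia.
by rewrite mono// => i0; lia.
Qed.

End TransitionOnLengths.

(** * Evaluation at an independent random time *)

Section RandomTime.
Context {R : realType} {d : measure_display} {T : measurableType d}.
Variables (P : probability T R) (e : R -> set T) (Y : T -> R).
Hypothesis me : forall s, 0 <= s -> measurable (e s).
Hypothesis e_right : forall w s, 0 <= s -> \forall u \near s^'+, e u w <-> e s w.
Hypothesis mY : measurable_fun setT Y.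
Hypothesis Y0 : forall w, 0 <= Y w.

(* [next n w] is the first grid point strictly to the right of [Y w]: by right
   continuity [e] holds at it, for large [n], iff it holds at [Y w], and it
   takes countably many values, so that independence applies. *)
Let grid (n j : nat) : R := j%:R / n.+1%:R.
Let cell (n : nat) (w : T) : nat := Num.truncn (n.+1%:R * Y w).
Let next (n : nat) (w : T) : R := grid n (cell n w).+1.
Let block (n j : nat) : set T := [set w | cell n w = j].
Let approx (n : nat) : set T := [set w | e (next n w) w].

Let grid_ge0 n j : 0 <= grid n j. Proof. by rewrite divr_ge0. Qed.

Let blockE n j : block n j = [set w | grid n j <= Y w < grid n j.+1].
Proof.
apply/seteqP; split => w; rewrite /block/grid/cell/= ler_pdivrMr// ltr_pdivlMr// mulrC.
  by move=> <-; apply: truncn_itv; rewrite mulr_ge0.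
exact: truncn_def.
Qed.

Let mblock n j : measurable (block n j).
Proof.
rewrite blockE -[X in measurable X]setTI.
rewrite (_ : [set w | _] = Y @^-1` `[grid n j, grid n j.+1[%classic).
  by apply: mY => //; exact: measurable_itv.
by apply/seteqP; split => w /=; rewrite in_itv.
Qed.

Let block_cover n : \bigcup_j block n j = setT.
Proof. by apply/seteqP; split => w // _; exists (cell n w). Qed.

Let block_disjoint n : trivIset setT (block n).
Proof. by move=> i j _ _ [w [<- <-]]. Qed.

Let approxE n : approx n = \bigcup_j (e (grid n j.+1) `&` block n j).
Proof.
apply/seteqP; split => w; first by move=> h; exists (cell n w).
by move=> [j _ []]; rewrite /approx/block/next/= => h ->.
Qed.

Let mapprox n : measurable (approx n).
Proof.
rewrite approxE; apply: bigcupT_measurable => j.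
by apply: measurableI => //; exact: me.
Qed.

Let next_cvg w : next n w @[n --> \oo] --> (Y w)^'+.
Proof.
have lt_next n : Y w < next n w.
  rewrite /next/grid/cell ltr_pdivlMr// mulrC.
  by have /andP[] := truncn_itv (mulr_ge0 (ler0n R n.+1) (Y0 w)).
apply: cvg_to_at_right; last exact: nearW.
have hY : Y w + n.+1%:R^-1 @[n --> \oo] --> Y w.
  rewrite -[X in _ --> X](addr0 (Y w)); apply: cvgD; first exact: cvg_cst.
  exact: (@cvg_harmonic R).
apply: (squeeze_cvgr _ (cvg_cst (Y w)) hY); apply: nearW => n.
rewrite (ltW (lt_next n))/= /next/grid/cell ler_pdivrMr// mulrDl mulVf// -natr1.
rewrite lerD2r [leRHS]mulrC.
by have /andP[] := truncn_itv (mulr_ge0 (ler0n R n.+1) (Y0 w)).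
Qed.

Let indic_approx w : \1_(approx n) w @[n --> \oo] --> (\1_[set w | e (Y w) w] w : R).
Proof.
apply: cvg_near_cst.
have h : \forall n \near \oo, e (next n w) w <-> e (Y w) w.
  by have /(_ _ (e_right w (Y0 w))) := @next_cvg w.
apply: filterS h => n [h1 h2]; rewrite !indicE.
by congr ((nat_of_bool _)%:R); apply/idP/idP; rewrite !inE.
Qed.

Lemma measurable_random_time : measurable [set w | e (Y w) w].
Proof.
have mi : measurable_fun setT (\1_[set w | e (Y w) w] : T -> R).
  apply: (measurable_fun_cvg (h := fun n => \1_(approx n))) => [n|w _].
    exact: measurable_indic.
  exact: indic_approx.
rewrite -[X in measurable X]setTI.
rewrite (_ : [set w | _] = (\1_[set w | e (Y w) w] : T -> R) @^-1` [set 1]).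
  by apply: mi => //; exact: measurable_set1.
apply/seteqP; split => w /=; rewrite indicE; first by move=> h; rewrite mem_set.
by case: (boolP (w \in _)) => [|_ /eqP]; rewrite ?inE// eq_sym oner_eq0.
Qed.

Variables (F G : set (set T)) (f : R -> R).
Hypothesis FG : independent P F G.
Hypothesis Fe : forall s, 0 <= s -> F (e s).
Hypothesis GY : forall a b, G [set w | a <= Y w < b].
Hypothesis cf : continuous f.
Hypothesis ef : forall s, 0 <= s -> P (e s) = (f s)%:E.

Let f0 s : 0 <= s -> 0 <= f s.
Proof. by move=> s0; rewrite -lee_fin -ef. Qed.

Let f1 s : 0 <= s -> f s <= 1.
Proof. by move=> s0; rewrite -lee_fin -ef//; apply: probability_le1; exact: me. Qed.

Let mnext n : measurable_fun setT (next n).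
Proof.
apply: measurable_funM; last exact: measurable_cst.
have -> : (fun w => (cell n w).+1%:R : R) =
    (fun x : R => (Num.truncn x).+1%:R) \o (fun w => n.+1%:R * Y w) by [].
apply: measurableT_comp; last exact: measurable_funM.
apply: nondecreasing_measurable => // x y xy.
by rewrite ler_nat ltnS le_truncn.
Qed.

Let mf : measurable_fun setT f.
Proof. exact: continuous_measurable_fun. Qed.

(** On the block [j] the discretised time is the constant [grid n j.+1], so independence factorises
    each term and countable additivity sums them. *)
Let approx_law n : P (approx n) = (\int[P]_w (f (next n w))%:E)%E.
Proof.
rewrite approxE measure_semi_bigcup//=; last 3 first.
- by move=> j; apply: measurableI => //; exact: me.
- by move=> i j _ _ [w [[_ +] [_ +]]]; rewrite /block/= => <- <-.
- by apply: bigcupT_measurable => j; apply: measurableI => //; exact: me.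
rewrite -(block_cover n) ge0_integral_bigcup//=; last 2 first.
- rewrite block_cover; apply/measurable_EFinP; exact: measurableT_comp.
- by move=> w _; rewrite lee_fin; apply: f0; exact: grid_ge0.
apply: eq_eseriesr => j _.
rewrite (eq_integral (cst (f (grid n j.+1))%:E)); last first.
  by move=> w; rewrite inE => <-.
rewrite integral_cst// -ef//; apply: FG; first exact: Fe.
by rewrite blockE; exact: GY.
Qed.

(** Both expressions for P(approx n) converge, the indicators by right continuity of the event and
    [f (next n w)] by continuity of [f], with 1 as dominating function. *)
Lemma random_time_law : P [set w | e (Y w) w] = (\int[P]_w (f (Y w))%:E)%E.
Proof.
have m1 : P.-integrable setT (EFin \o cst (1 : R)).
  by apply: finite_measure_integrable_cst.
apply: (@cvg_unique _ (@ereal_hausdorff R) (P (approx n) @[n --> \oo])).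
  have -> : (fun n => P (approx n)) = (fun n => \int[P]_w (\1_(approx n) w)%:E)%E.
    by apply/funext => n; rewrite integral_indic ?setIT.
  have := measurable_random_time; set E := [set w | _] => mE.
  have -> : P E = (\int[P]_w (\1_E w)%:E)%E by rewrite integral_indic ?setIT.
  apply: (@dominated_cvg _ _ _ P setT measurableT _ _ (EFin \o cst 1)) => //.
  - by move=> n; apply/measurable_EFinP; exact: measurable_indic.
  - by move=> w _; apply: cvg_EFin; [exact: nearW|exact: indic_approx].
  - by move=> n w _; rewrite lee_fin ger0_norm indicE//; case: (_ \in _).
have -> : (fun n => P (approx n)) = (fun n => \int[P]_w (f (next n w))%:E)%E.
  by apply/funext => n; exact: approx_law.
apply: (@dominated_cvg _ _ _ P setT measurableT _ _ (EFin \o cst 1)) => //.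
- by move=> n; apply/measurable_EFinP; exact: measurableT_comp.
- move=> w _; apply: cvg_EFin; first exact: nearW.
  apply: (@cvg_comp _ _ _ (next ^~ w) f _ (nbhs (Y w))); last exact: cf.
  move=> A hA; have /(_ A) := @next_cvg w; apply.
  by apply: filterS hA => u Au _.
- by move=> n w _; rewrite lee_fin ger0_norm ?f0 ?f1 ?grid_ge0.
Qed.

End RandomTime.

(** * Congruence and linearity of Caputo solutions *)

Section CaputoSolutions.
Context {R : realType}.
Variable nu : R.

(** At t > 0 the derivative only sees a neighbourhood inside ]0, +oo[, so agreement at nonnegative
    times suffices. *)
Lemma eq_caputo_cauchy_solution (f g x y : R -> R) (x0 : R) :
  (forall t, 0 < t -> f t = g t) -> (forall t, 0 <= t -> x t = y t) ->
  caputo_cauchy_solution nu f x0 x -> caputo_cauchy_solution nu g x0 y.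
Proof.
move=> fg xy [cx dx ix Cx x_0].
have nxy (t : R) : 0 < t -> \forall u \near t, x u = y u.
  move=> t0; near=> u; apply: xy; apply: ltW; near: u; exact: lt_nbhsr.
have dxy (t : R) : 0 < t -> derivable y t 1 /\ derive1 y t = derive1 x t.
  move=> t0; have n := nxy t t0; split.
    by apply: near_eq_derivable n (dx t t0); exact: oner_neq0.
  by rewrite !derive1E; apply/esym/near_eq_derive => //; exact: oner_neq0.
have cixy (t u : R) : 0 < u -> caputo_integrand nu y t u = caputo_integrand nu x t u.
  by move=> u0; rewrite /caputo_integrand (dxy u u0).2.
split.
- apply: (@subspace_eq_continuous _ _ _ x y) => // u.
  by rewrite inE/= in_itv/= andbT; exact: xy.
- by move=> t /dxy[].
- move=> t t0; move: (ix t t0); apply: eq_integrable; first exact: measurable_itv.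
  by move=> u; rewrite inE/= in_itv/= => /andP[u0 _]; rewrite cixy.
- move=> t t0; rewrite -(fg t t0) -(Cx t t0) /caputo.
  suff -> : \int[lebesgue_measure]_(u in `]0, t[) caputo_integrand nu y t u =
    \int[lebesgue_measure]_(u in `]0, t[) caputo_integrand nu x t u by [].
  by apply: eq_Rintegral => u; rewrite inE/= in_itv/= => /andP[u0 _]; rewrite cixy.
- by rewrite -xy.
Unshelve. all: by end_near. Qed.

Lemma caputo_cauchy_solution_linear (a b : R) (f g x y : R -> R) :
  caputo_cauchy_solution nu f 0 x -> caputo_cauchy_solution nu g 0 y ->
  caputo_cauchy_solution nu (fun t => a * f t + b * g t) 0
    (fun t => a * x t + b * y t).
Proof.
move=> [cx dx ix Cx x0] [cy dy iy Cy y0].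
have mI (t : R) : measurable (`]0, t[%classic : set R) by exact: measurable_itv.
have D (t : R) : 0 < t -> is_derive t (1:R) (fun t => a * x t + b * y t)
    (a * derive1 x t + b * derive1 y t).
  move=> t0; rewrite !derive1E.
  have hx := @derivableP _ _ _ _ _ _ (dx t t0).
  have hy := @derivableP _ _ _ _ _ _ (dy t t0).
  have := @is_deriveD _ _ _ _ _ _ _ _ _ (is_deriveZ a hx) (is_deriveZ b hy).
  exact.
have ci (t u : R) : 0 < u -> caputo_integrand nu (fun t => a * x t + b * y t) t u =
    a * caputo_integrand nu x t u + b * caputo_integrand nu y t u.
  move=> u0; rewrite /caputo_integrand derive1E.
  by have [_ ->] := D u u0; rewrite !mulrA -mulrDl.
have iax (t : R) : 0 < t -> lebesgue_measure.-integrable `]0, t[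
    (EFin \o (fun u => a * caputo_integrand nu x t u)).
  move=> t0; have -> : EFin \o (fun u => a * caputo_integrand nu x t u) =
    (fun u => a%:E * (EFin \o caputo_integrand nu x t) u)%E by [].
  by apply: integrableZl => //; exact: ix.
have iby (t : R) : 0 < t -> lebesgue_measure.-integrable `]0, t[
    (EFin \o (fun u => b * caputo_integrand nu y t u)).
  move=> t0; have -> : EFin \o (fun u => b * caputo_integrand nu y t u) =
    (fun u => b%:E * (EFin \o caputo_integrand nu y t) u)%E by [].
  by apply: integrableZl => //; exact: iy.
split.
- move=> t; apply: cvgD; apply: cvgM; try exact: cvg_cst.
    exact: cx.
  exact: cy.
- by move=> t /D[].
- move=> t t0; have h : lebesgue_measure.-integrable `]0, t[
      ((EFin \o (fun u => a * caputo_integrand nu x t u)%R) \+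
       (EFin \o (fun u => b * caputo_integrand nu y t u)%R))%E.
    by apply: integrableD; [exact: measurable_itv|exact: iax|exact: iby].
  apply: eq_integrable h => //u; rewrite inE/= in_itv/= => /andP[u0 _].
  by rewrite ci.
- move=> t t0; rewrite -(Cx t t0) -(Cy t t0) /caputo.
  have -> : \int[lebesgue_measure]_(u in `]0, t[)
        caputo_integrand nu (fun t => a * x t + b * y t) t u =
      a * \int[lebesgue_measure]_(u in `]0, t[) caputo_integrand nu x t u +
      b * \int[lebesgue_measure]_(u in `]0, t[) caputo_integrand nu y t u.
    transitivity (\int[lebesgue_measure]_(u in `]0, t[)
        (a * caputo_integrand nu x t u + b * caputo_integrand nu y t u)).
      by apply: eq_Rintegral => u; rewrite inE/= in_itv/= => /andP[u0 _]; rewrite ci.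
    transitivity (\int[lebesgue_measure]_(u in `]0, t[) (a * caputo_integrand nu x t u) +
        \int[lebesgue_measure]_(u in `]0, t[) (b * caputo_integrand nu y t u)).
      by apply: RintegralD; [exact: measurable_itv|exact: iax|exact: iby].
    congr (_ + _).
      by apply: RintegralZl; [exact: measurable_itv|exact: ix].
    by apply: RintegralZl; [exact: measurable_itv|exact: iy].
  have alg (c u v : R) : c * (a * u + b * v) = a * (c * u) + b * (c * v) by ring.
  exact: alg.
- by rewrite x0 y0 !mulr0 addr0.
Qed.

End CaputoSolutions.

(** * The fractional queue *)

(** Layer-cake formula for a natural number; it turns an expected length into the sum of its
    tails. *)
Lemma nneseries_indicator {R : realType} (n : nat) :
  (\sum_(j <oo) ((j < n)%N%:R)%:E = (n%:R : R)%:E)%E.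
Proof.
apply: (@cvg_lim _ (@ereal_hausdorff R)); apply: cvg_near_cst.
exists n => // m /= nm; rewrite sumEFin; congr (_%:E).
rewrite (@big_cat_nat _ _ _ n)//= (eq_big_nat _ _ (F2 := fun=> 1)); last first.
  by move=> i /andP[_ ->].
rewrite sumr_const_nat subn0 [X in _ + X]big1_seq ?addr0// => i.
by rewrite mem_index_iota => /andP[_ /andP[ni _]]; rewrite ltnNge ni.
Qed.

Section FractionalErlangQueue.
Context {R : realType} {d : measure_display} {T : measurableType d}.
Variables (lambda mu nu : R) (k : nat) (P : probability T R).
Variables (Q : R -> {RV P >-> state k}) (sigma : R -> {RV P >-> R}).
Variable p : R -> state k -> state k -> R.
Hypotheses (lambda_ge0 : 0 <= lambda) (mu_ge0 : 0 <= mu) (k_gt0 : (0 < k)%N).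
Hypothesis nu01 : 0 < nu < 1.
Hypothesis Qright : forall w t, 0 <= t -> \forall s \near t^'+, Q s w = Q t w.
Hypothesis Hp : transition_function (erlang_rate lambda mu) p.
Hypothesis Qmarkov : forall (s h : R) A x y, 0 <= s -> 0 <= h -> history Q s A ->
  (P (A `&` [set w | Q s w = x] `&` [set w | Q (s + h)%R w = y])
   = P (A `&` [set w | Q s w = x]) * (p h x y)%:E)%E.
Hypothesis Hsigma : stable_subordinator nu sigma.
Hypothesis Qsigma : independent_processes Q sigma.

Let beta : R := k%:R * mu.
Let beta_ge0 : 0 <= beta. Proof. by rewrite mulr_ge0. Qed.

Let q := length_transition p.
Let q_ge0 t i j : 0 <= t -> 0 <= q t i j.
Proof. exact: (length_transition_ge0 Hp). Qed.
Let q_sum1 t i : 0 <= t -> \sum_(0 <= j < n) q t i j @[n --> \oo] --> (1 : R).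
Proof. exact: (length_transition_sum1 k_gt0 Hp). Qed.
Let q_init i j : q 0 i j = (i == j)%:R.
Proof. exact: (length_transition_init k_gt0 Hp). Qed.
Let q_ck s t i j : 0 <= s -> 0 <= t ->
  \sum_(0 <= z < n) (q s i z * q t z j) @[n --> \oo] --> q (s + t) i j.
Proof. exact: (length_transition_ck k_gt0 Hp). Qed.
Let q_rate i j : i != j -> q h i j / h @[h --> 0^'+] -->
  lambda *+ (j == i + k)%N + beta *+ ((0 < i)%N && (j == i.-1)).
Proof. exact: (length_transition_rate k_gt0 Hp). Qed.
Let q_exit i : (1 - q h i i) / h @[h --> 0^'+] --> lambda + beta *+ (0 < i)%N.
Proof. exact: (length_transition_exit k_gt0 lambda_ge0 mu_ge0 Hp). Qed.

Let occ := occupation q.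
Let below := occupation_below q.
Let busy (s : R) : R := \int[lebesgue_measure]_(u in `[0, s]) occ 0%N u.
Let mean := mean_length k lambda beta q.

Let occ_ge0 j s : 0 <= occ j s. Proof. exact: occupation_ge0. Qed.
Let continuous_occ j : continuous (occ j).
Proof. exact: (continuous_occupation lambda_ge0 beta_ge0). Qed.
Let tail_ge0 j s : 0 <= 1 - below j s.
Proof. by rewrite subr_ge0 occupation_below_le1. Qed.
Let continuous_tail j : continuous (fun s => 1 - below j s).
Proof.
move=> s; apply: cvgB; first exact: cvg_cst.
exact: (continuous_occupation_below lambda_ge0 beta_ge0).
Qed.
Let tail_cvg s : 0 <= s -> \sum_(0 <= j < n) (1 - below j.+1 s) @[n --> \oo] --> mean s.
Proof. exact: (tail_sum_cvg k_gt0 lambda_ge0 beta_ge0). Qed.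

Let mean_ge0 s : 0 <= s -> 0 <= mean s.
Proof.
move=> /tail_cvg h; rewrite -(cvg_lim _ h)//; apply: limr_ge.
  by apply/cvg_ex; exists (mean s).
by apply: nearW => n; rewrite sumr_ge0.
Qed.

Let busy_bound s : 0 <= s -> 0 <= busy s <= s.
Proof. exact: (integral_occupation_bound lambda_ge0 beta_ge0). Qed.

(** [busy] is nondecreasing on the whole line, its segment being empty for negative times. *)
Let mbusy : measurable_fun setT busy.
Proof.
apply: nondecreasing_measurable => // x y xy; rewrite /busy /Rintegral.
have mocc (E : set R) : measurable_fun E (EFin \o occ 0%N).
  by apply/measurable_EFinP; apply: measurable_funTS; exact: continuous_measurable_fun.
have fin s : (\int[lebesgue_measure]_(u in `[0%R, s]) (occ 0%N u)%:E)%E \is a fin_num.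
  apply: integrable_fin_num; first exact: measurable_itv.
  exact: (integrable_occupation lambda_ge0 beta_ge0).
apply: fine_le => //; apply: ge0_subset_integral => //.
- exact: mocc.
- by move=> u _; rewrite lee_fin.
- by move=> u /=; rewrite !in_itv/= => /andP[-> /le_trans]; exact.
Qed.

Let mocc j : measurable_fun setT (occ j).
Proof. apply: continuous_measurable_fun; exact: continuous_occ. Qed.
Let mtail j : measurable_fun setT (fun s => 1 - below j s).
Proof. apply: continuous_measurable_fun; exact: continuous_tail. Qed.
Let meanE s : mean s = (lambda * k%:R - beta) * s + beta * busy s.
Proof. by []. Qed.
Let mmean : measurable_fun setT mean.
Proof.
have -> : mean = (fun s => (lambda * k%:R - beta) * s) \+ (fun s => beta * busy s).
  exact/funext/meanE.
by apply: measurable_funD; exact: measurable_funM.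
Qed.

Let len (s : R) (w : T) : nat := length_in_phases (Q s w).
(** Emptiness of the chain at its own time 0, to be compared with [start], emptiness of the
    fractional queue. *)
Let A0 : set T := [set w | Q 0 w = empty_state k].

Let empty_stateE : empty_state k = state_of_length k 0.
Proof. by apply/esym/eqP; rewrite -length_in_phases_eq0 ?state_of_lengthK. Qed.

Let len_preimage (D : set nat) s : [set w | D (len s w)] =
  Q s @^-1` [set x | D (length_in_phases x)].
Proof. by []. Qed.

Let mlen (D : set nat) s : measurable [set w | D (len s w)].
Proof. by rewrite len_preimage -[X in measurable X]setTI; apply: measurable_funP. Qed.

Let A0E : A0 = Q 0 @^-1` [set empty_state k]. Proof. by []. Qed.
Let mA0 : measurable A0.
Proof. by rewrite A0E -[X in measurable X]setTI; apply: measurable_funP. Qed.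

(** The Markov property at time 0, with the sure event as history. *)
Let joint_law j s : 0 <= s ->
  (P (A0 `&` [set w | len s w = j]) = P A0 * (occ j s)%:E)%E.
Proof.
move=> s0; have hT : history Q 0 setT.
  exact: (@measurableT _ (g_sigma_algebraType _)).
have := Qmarkov (empty_state k) (state_of_length k j) (lexx 0) s0 hT.
rewrite add0r !setTI -/A0 /occ /occupation max_l// /q /length_transition -empty_stateE.
move=> <-; congr (P (_ `&` _)); apply/seteqP; split => w /=; rewrite /len.
  by move=> <-; rewrite length_in_phasesK.
by move=> ->; rewrite state_of_lengthK.
Qed.

Let joint_tail j s : 0 <= s ->
  (P (A0 `&` [set w | (j <= len s w)%N]) = P A0 * (1 - below j s)%:E)%E.
Proof.
move=> s0; elim: j => [|j IH].
  rewrite /below /occupation_below big_nil subr0 mule1; congr (P _).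
  by apply/seteqP; split => w //= [].
have -> : A0 `&` [set w | (j < len s w)%N] =
    (A0 `&` [set w | (j <= len s w)%N]) `\` (A0 `&` [set w | len s w = j]).
  apply/seteqP; split => w /=.
    by move=> [Aw jw]; split; [split => //; exact: ltnW|move=> [_ E]; move: jw; rewrite E ltnn].
  move=> [[Aw jw] h]; split => //; rewrite ltn_neqAle jw andbT.
  by apply/eqP => E; exact: h.
have mj1 := mlen [set n | (j <= n)%N] s; have mj2 := mlen [set j] s.
rewrite measureD//.
- rewrite [X in (_ - P X)%E](_ : _ = A0 `&` [set w | len s w = j]); last first.
    by apply/seteqP; split => w /= [] // => Aw; split => //; split => //; rewrite b.
  have Afin : P A0 \is a fin_num by exact: fin_num_measure.
  rewrite [X in (X - _)%E]IH [X in (_ - X)%E]joint_law// /below /occupation_below big_nat_recr//= -/occ.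
  rewrite opprD addrA [in RHS]EFinB muleBr//.
- exact: measurableI.
- exact: measurableI.
- by rewrite (le_lt_trans (probability_le1 _ _)) ?ltry//; exact: measurableI.
Qed.

Let Y (t : R) : T -> R := inverse_process sigma t.

Let Y_ge0 t w : 0 <= Y t w.
Proof.
exact: inverse_process_ge0.
Qed.

Let mY t : measurable_fun setT (Y t). Proof. exact: (measurable_inverse_process Hsigma). Qed.

Let L (t : R) (w : T) : nat := fractional_queue_length Q sigma t w.
Let start : set T := [set w | L 0 w = 0%N].

Let LE t w : L t w = len (Y t w) w. Proof. by []. Qed.

Let len_right (D : set nat) w s : 0 <= s ->
  \forall u \near s^'+, D (len u w) <-> D (len s w).
Proof. by move=> /(Qright w); apply: filterS => u; rewrite /len => ->. Qed.

Let mL (D : set nat) t : measurable [set w | D (L t w)].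
Proof.
apply: (@measurable_random_time _ _ _ (fun s => [set w | D (len s w)]) (Y t)) => //.
by move=> w s; exact: (len_right D).
Qed.

Let mstart : measurable start. Proof. exact: (mL [set 0%N]). Qed.

(** [A0] depends on the chain only, so intersecting with it preserves independence from the random
    time: [random_time_law] applies to the events A0 and {len s in D} together, with the function
    P(A0) g. *)
Let A0_law (D : set nat) (g : R -> R) t : 0 <= t -> continuous g ->
  (forall s, 0 <= s -> 0 <= g s) ->
  (forall s, 0 <= s -> P (A0 `&` [set w | D (len s w)]) = (P A0 * (g s)%:E)%E) ->
  P (A0 `&` [set w | D (L t w)]) = (P A0 * \int[P]_w (g (Y t w))%:E)%E.
Proof.
move=> t0 cg g0 hg; have Afin : P A0 \is a fin_num by exact: fin_num_measure.
rewrite (@random_time_law _ _ _ P (fun s => A0 `&` [set w | D (len s w)]) (Y t)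
   _ _ _ _ (sigma_generated [set t | 0 <= t] Q)
   (sigma_generated [set t | 0 <= t] sigma) (fun s => fine (P A0) * g s)) //.
- under eq_integral do rewrite EFinM.
  rewrite ge0_integralZl//=.
  + by rewrite fineK.
  + by apply/measurable_EFinP/measurableT_comp => //; exact: continuous_measurable_fun.
  + by move=> w _; rewrite lee_fin g0.
  + by rewrite lee_fin fine_ge0.
- by move=> s _; apply: measurableI => //; exact: mlen.
- move=> w s /len_right h; have {}h := h D w.
  by apply: filterS h => u [h1 h2]; split=> -[? ?]; split => //; [exact: h1|exact: h2].
- move=> s s0; apply: (@measurableI _ (g_sigma_algebraType
    [set A | exists2 t, [set t : R | 0 <= t] t &
      preimage_set_system setT (Q t) measurable A])).
    by rewrite A0E; apply: sigma_generated_preimage => /=.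
  by rewrite len_preimage; exact: sigma_generated_preimage.
- move=> a b.
  have -> : [set w | a <= Y t w < b] = [set w | a <= Y t w] `\` [set w | b <= Y t w].
    apply/seteqP; split => w /=.
      by move=> /andP[aY Yb]; split => //; rewrite leNgt Yb.
    by move=> [aY /negP]; rewrite -ltNge => bY; rewrite aY.
  apply: (@measurableD _ (g_sigma_algebraType
    [set A | exists2 t, [set t : R | 0 <= t] t &
      preimage_set_system setT (sigma t) measurable A]));
    exact: (inverse_process_sigma Hsigma).
- by move=> s; apply: cvgM; [exact: cvg_cst|exact: cg].
- by move=> s s0; rewrite hg// EFinM fineK.
Qed.

Let N0 : set T := [set w | 0 < Y 0 w].
Let mN0 : measurable N0. Proof. exact: measurable_gt0. Qed.

(** At time 0 the law of [Y] is that of 0^nu S^(-nu) = 0. *)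
Let N0_null : P N0 = 0%E.
Proof.
have nu0 : nu != 0 by case/andP: nu01 => /lt0r_neq0.
transitivity (\int[P]_w (\1_[set s : R | 0 < s] (Y 0 w))%:E)%E.
  by rewrite -(setIT N0) -integral_indic.
rewrite (integral_inverse_process nu01 Hsigma (lexx 0)
  (phi := fun s => (\1_[set s : R | 0 < s] s)%:E)).
- apply: integral0_eq => w _.
  by rewrite powR0// mul0r indicE memNset//= ltxx.
- apply/measurable_EFinP/measurable_indic.
  rewrite (_ : [set s : R | _] = `]0, +oo[%classic) ?measurable_itv//.
  by apply/seteqP; split => s /=; rewrite in_itv/= andbT.
- by move=> s; rewrite lee_fin.
Qed.

(** Off the null event [N0] the inverse process at time 0 is 0, and there [start] and [A0]
    coincide. *)
Let start_law B : measurable B -> P (start `&` B) = P (A0 `&` B).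
Proof.
move=> mB; have null E : measurable E -> P E = P (E `\` N0).
  move=> mE; rewrite measureD//; last first.
    by rewrite (le_lt_trans (probability_le1 _ _)) ?ltry.
  rewrite (@subset_measure0 _ _ _ P (E `&` N0) N0) ?sube0//.
  exact: measurableI.
rewrite (null (start `&` B)) ?(null (A0 `&` B)); [|exact: measurableI..].
congr (P _); apply/seteqP; split => w /= [[sw Bw] nw]; split => //; split => //.
  have Y0w : Y 0 w = 0 by apply/eqP; rewrite eq_le Y_ge0 andbT leNgt; exact/negP.
  apply/eqP; rewrite -length_in_phases_eq0//; apply/eqP.
  by move: sw; rewrite /start/= LE Y0w.
have Y0w : Y 0 w = 0 by apply/eqP; rewrite eq_le Y_ge0 andbT leNgt; exact/negP.
rewrite /start/= LE Y0w /len sw; apply/eqP.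
by rewrite length_in_phases_eq0.
Qed.

Let start_A0 : P start = P A0.
Proof. by rewrite -(setIT start) start_law// setIT. Qed.

Let law (D : set nat) (g : R -> R) t : 0 <= t -> continuous g ->
  (forall s, 0 <= s -> 0 <= g s) ->
  (forall s, 0 <= s -> P (A0 `&` [set w | D (len s w)]) = (P A0 * (g s)%:E)%E) ->
  P (start `&` [set w | D (L t w)]) = (P start * \int[P]_w (g (Y t w))%:E)%E.
Proof. by move=> t0 cg g0 hg; rewrite start_law ?start_A0//; exact: A0_law. Qed.

Let S : T -> R := sigma 1.
Let S_ge0 w : 0 <= S w. Proof. exact: (subordinator_ge0 Hsigma). Qed.
Let mS : measurable_fun setT S. Proof. exact: measurable_funP. Qed.
Let lS v : 0 < v -> laplace_transform P S v = (expR (- v `^ nu))%:E.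
Proof. by move=> v0; rewrite (subordinator_laplace Hsigma)// mul1r. Qed.

Let integral_Y (g : R -> R) t : 0 <= t -> measurable_fun setT g ->
  (forall s, 0 <= s -> 0 <= g s) ->
  (\int[P]_w (g (Y t w))%:E =
   \int[P]_(w in [set w | (0 < S w)%R]) (g (t `^ nu * S w `^ (- nu)))%:E)%E.
Proof.
move=> t0 mg g0.
(* [integral_inverse_process] wants a function nonnegative on the whole line, while [g] is known to
   be so on [0, +oo[; as [Y] is nonnegative, the cut-off changes nothing. *)
transitivity (\int[P]_w (g (Num.max (Y t w) 0))%:E)%E.
  by apply: eq_integral => w _; rewrite max_l.
rewrite (integral_inverse_process nu01 Hsigma t0 (phi := fun s => (g (Num.max s 0))%:E)).
- apply: eq_integral => w _; rewrite max_l// mulr_ge0 ?powR_ge0//.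
- apply/measurable_EFinP/measurableT_comp => //.
  exact: measurable_maxr.
- by move=> s; rewrite lee_fin g0// le_max lexx orbT.
Qed.

(** Layer cake, then exchange of sum and integral, valid for nonnegative terms even if the total is
    infinite; each tail is given by [law]. *)
Let start_mean t : 0 <= t ->
  (\int[P]_(w in start) ((L t w)%:R)%:E = P start * \int[P]_w (mean (Y t w))%:E)%E.
Proof.
move=> t0; under eq_integral do rewrite -nneseries_indicator.
rewrite integral_nneseries//; last first.
  move=> j; apply/measurable_EFinP; apply: measurable_funTS.
  have -> : (fun w => (j < L t w)%N%:R : R) = \1_[set w | (j < L t w)%N].
    by apply/funext => w; rewrite indicE; congr ((nat_of_bool _)%:R); apply/idP/idP; rewrite inE.
  exact/measurable_indic/(mL [set n | (j < n)%N]).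
transitivity (\sum_(j <oo) (P start * \int[P]_w (1 - below j.+1 (Y t w))%:E))%E.
  apply: eq_eseriesr => j _.
  rewrite -(@law [set n | (j < n)%N] (fun s => 1 - below j.+1 s))//; last first.
    by move=> s s0; exact: joint_tail.
  have mj := mL [set n | (j < n)%N] t; rewrite setIC -integral_indic//.
  apply: eq_integral => w _; rewrite indicE; congr ((nat_of_bool _)%:R%:E).
  by apply/idP/idP; rewrite inE.
have sfin : P start \is a fin_num by exact: fin_num_measure.
rewrite -(fineK sfin) nneseriesZl; last first.
  by move=> j _; apply: integral_ge0 => w _; rewrite lee_fin.
congr (_ * _)%E; rewrite -integral_nneseries//; last 2 first.
- move=> j; apply/measurable_EFinP.
  by apply: (@measurableT_comp _ _ _ _ _ _ (fun s => 1 - below j.+1 s)).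
- by move=> j w _; rewrite lee_fin.
apply: eq_integral => w _; apply: (@cvg_lim _ (@ereal_hausdorff R)).
under eq_fun do rewrite sumEFin.
apply: cvg_EFin; first exact: nearW.
exact: tail_cvg.
Qed.

Let integrable_busy t : P.-integrable [set w | 0 < S w]
  (fun w => (busy (t `^ nu * S w `^ (- nu)))%:E).
Proof.
apply: (integrable_subordinated nu01 mS S_ge0 lS (f := cst 1) (C := 1)) => //.
by move=> s s0; rewrite mul1r; have /andP[h1 h2] := busy_bound s0; rewrite ger0_norm.
Qed.

Let integrable_id t : P.-integrable [set w | 0 < S w]
  (fun w => (t `^ nu * S w `^ (- nu))%:E).
Proof.
apply: (integrable_subordinated nu01 mS S_ge0 lS (f := cst 1) (F := id) (C := 1)) => //.
by move=> s s0; rewrite mul1r ger0_norm.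
Qed.

Hypothesis start_gt0 : (0 < P start)%E.

Let start_fine : fine (P start) != 0.
Proof. by rewrite gt_eqF// fine_gt0// start_gt0 ltey_eq fin_num_measure. Qed.

Let mD : measurable [set w | 0 < S w]. Proof. exact: measurable_gt0. Qed.

Let M t := cond_expectation P (fun w => (L t w)%:R) start.
Let P0 t := cond_probability P [set w | L t w = 0%N] start.

Let imean t : P.-integrable [set w | 0 < S w]
    (fun w => (mean (t `^ nu * S w `^ (- nu)))%:E).
Proof.
have h : P.-integrable [set w | 0 < S w]
    ((fun w => (lambda * k%:R - beta)%:E * (t `^ nu * S w `^ (- nu))%:E) \+
     (fun w => beta%:E * (busy (t `^ nu * S w `^ (- nu)))%:E))%E.
  by apply: integrableD => //; exact: integrableZl.
exact: h.
Qed.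

Let ML t : 0 <= t -> M t = subordinated P nu S mean t.
Proof.
move=> t0; rewrite /M /cond_expectation /Rintegral start_mean// integral_Y//.
rewrite fineM ?fin_num_measure//; last by apply: integrable_fin_num => //; exact: imean.
by rewrite mulrAC mulfV// mul1r.
Qed.

Let P0E t : 0 <= t -> P0 t = subordinated P nu S (occ 0%N) t.
Proof.
move=> t0; rewrite /P0 /cond_probability setIC.
rewrite (@law [set 0%N] (occ 0%N))//; last by move=> s s0; exact: joint_law.
rewrite integral_Y// fineM ?fin_num_measure//; last first.
  apply: integrable_fin_num => //.
  apply: (@le_integrable _ _ _ _ _ mD _ (EFin \o cst 1)).
  - apply/measurable_EFinP; apply: measurable_funTS; apply: measurableT_comp => //.
    by apply: measurable_funM => //; apply: (measurableT_comp (measurable_powR _)).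
  - move=> w _; rewrite /= lee_fin !ger0_norm//.
    exact: occupation_le1.
  - exact: finite_measure_integrable_cst.
by rewrite mulrAC mulfV// mul1r.
Qed.

Lemma integrable_fractional_queue_length t : 0 <= t ->
  P.-integrable start (fun w => ((L t w)%:R)%:E).
Proof.
move=> t0; apply/integrableP; split.
  apply/measurable_EFinP; apply: measurable_funTS => _ B mB; rewrite setTI.
  exact: (mL [set n | B n%:R]).
under eq_integral do rewrite gee0_abs ?lee_fin//.
rewrite start_mean// integral_Y// lte_mul_pinfty//.
  by rewrite fin_num_measure.
by rewrite ltey_eq (integrable_fin_num mD (imean t)).
Qed.

(** [subordinated_solution] asks for a nonnegative derivative, which the mean length may lack when
    lambda < mu. It is therefore applied to the identity, with derivative 1, and to [busy], with
    derivative P(length = 0); linearity recombines them with coefficients k (lambda - mu) and k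
    mu. *)
Lemma fractional_queue_length_solution : caputo_cauchy_solution nu
  (fun t => k%:R * (lambda - mu) + k%:R * mu * P0 t) 0 M.
Proof.
have sid : caputo_cauchy_solution nu (subordinated P nu S (cst 1)) 0 (subordinated P nu S id).
  apply: (subordinated_solution nu01 mS S_ge0 lS (C := 1)) => //.
  - by move=> s _; exact: cvg_cst.
  - by move=> s s0; rewrite mul1r ger0_norm.
have sbusy : caputo_cauchy_solution nu (subordinated P nu S (occ 0%N)) 0
    (subordinated P nu S busy).
  apply: (subordinated_solution nu01 mS S_ge0 lS (C := 1)) => //.
  - by move=> s _; exact: occupation_le1.
  - by move=> s _; exact: continuous_occ.
  - by move=> s; exact: (is_derive_integral_occupation lambda_ge0 beta_ge0).
  - by move=> s s0; rewrite mul1r; have /andP[h1 h2] := busy_bound s0; rewrite ger0_norm.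
have := caputo_cauchy_solution_linear (k%:R * (lambda - mu)) beta sid sbusy.
apply: eq_caputo_cauchy_solution => t t0.
  rewrite -P0E ?ltW//; congr (_ + _).
  rewrite /subordinated Rintegral_cst//.
  (* The identity contributes the constant P(S > 0), which is 1 since [S] is almost surely
     positive. *)
  have S1 : P [set w | 0 < S w] = 1%E.
    have null := @stable_null _ _ _ P nu S nu01 mS S_ge0 lS.
    have -> : [set w | 0 < S w] = ~` [set w | S w <= 0].
      by apply/seteqP; split => w /=; rewrite ltNge => /negP.
    rewrite probability_setC ?null ?sube0//.
    by rewrite set_le0E; exact: measurableC.
  by rewrite [X in fine X]S1/= mul1r mulr1.
rewrite ML// /subordinated.
have -> : \int[P]_(w in [set w | 0 < S w]) mean (t `^ nu * S w `^ (- nu)) =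
   \int[P]_(w in [set w | 0 < S w])
     ((k%:R * (lambda - mu)) * (t `^ nu * S w `^ (- nu)) +
      beta * busy (t `^ nu * S w `^ (- nu))).
  by apply: eq_Rintegral => w _; rewrite meanE /beta mulrBr (mulrC lambda).
rewrite RintegralD//.
- by congr (_ + _); apply/esym/RintegralZl => //; [exact: integrable_id|exact: integrable_busy].
- exact: (integrableZl mD _ (integrable_id t)).
- exact: (integrableZl mD _ (integrable_busy t)).
Qed.

End FractionalErlangQueue.

Theorem theorem6p1 (R : realType) (lambda mu nu : R) (k : nat)
    (d : measure_display) (T : measurableType d) (P : probability T R)
    (Q : R -> {RV P >-> state k}) (sigma : R -> {RV P >-> R}) :
  0 < lambda -> 0 < mu -> (1 <= k)%N -> 0 < nu < 1 ->
  markov_chain (erlang_rate lambda mu) Q ->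
  stable_subordinator nu sigma ->
  independent_processes Q sigma ->
  let L : R -> T -> nat := fractional_queue_length Q sigma in
  let start : set T := [set w | L 0 w = 0%N] in
  (0 < P start)%E ->
  let M : R -> R := fun t => cond_expectation P (fun w => (L t w)%:R) start in
  let P0 : R -> R := fun t => cond_probability P [set w | L t w = 0%N] start in
  (forall t, 0 <= t -> P.-integrable start (fun w => ((L t w)%:R)%:E)) /\
  caputo_cauchy_solution nu
    (fun t => k%:R * (lambda - mu) + k%:R * mu * P0 t) 0 M.

Proof.
move=> lambda0 mu0 k0 nu01 [Qright [p Hp Qmarkov]] Hsigma Qsigma L start start0 M P0.
split=> [t t0|].
  exact: (integrable_fractional_queue_length (ltW lambda0) (ltW mu0) k0 nu01
    Qright Hp Qmarkov Hsigma Qsigma).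
exact: (fractional_queue_length_solution (ltW lambda0) (ltW mu0) k0 nu01
  Qright Hp Qmarkov Hsigma Qsigma start0).
Qed.
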